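(* Let $n,r$ be positive integers, let $I$ be the two-sided ideal of $U(\mathfrak{q}(n))$ generated by $h_1+\cdots+h_n-r$ and the elements $h_{\bar i}(h_i-1)(h_i-2)\cdots(h_i-r)$ for $1\le i\le n$, and let $U(n,r)=U(\mathfrak q(n))/I$. The homomorphism $\overline{\phi}_r:U(n,r)\to\mathcal{Q}(n,r)$ induced by $\phi_r$ (which satisfies $I\subseteq\ker\phi_r$) is an isomorphism. In other words, the queer Schur superalgebra $\mathcal{Q}(n,r)$ is the associative superalgebra over $\mathbb{Q}$ generated by even generators $h_i,e_j,f_j$ and odd generators $h_{\bar i},e_{\bar j},f_{\bar j}$ ($1\le i\le n$, $1\le j\le n-1$) subject to the following relations (for all indices for which the terms make sense): (QS1) $[h_i,h_j]=0$, $[h_i,h_{\bar j}]=0$, $[h_{\bar i},h_{\bar j}]=2\delta_{ij}h_i$; (QS2) $[h_i,e_j]=(\epsilon_i,\alpha_j)e_j$, $[h_i,e_{\bar j}]=(\epsilon_i,\alpha_j)e_{\bar j}$, $[h_i,f_j]=-(\epsilon_i,\alpha_j)f_j$, $[h_i,f_{\bar j}]=-(\epsilon_i,\alpha_j)f_{\bar j}$; (QS3) $[h_{\bar i},e_j]=(\epsilon_i,\alpha_j)e_{\bar j}$, $[h_{\bar i},f_j]=-(\epsilon_i,\alpha_j)f_{\bar j}$; $[h_{\bar i},e_{\bar j}]=e_j$ and $[h_{\bar i},f_{\bar j}]=f_j$ if $i=j$ or $i=j+1$, and both are $0$ otherwise; (QS4) $[e_i,f_j]=\delta_{ij}(h_i-h_{i+1})$,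 $[e_{\bar i},f_{\bar j}]=\delta_{ij}(h_i+h_{i+1})$, $[e_{\bar i},f_j]=\delta_{ij}(h_{\bar i}-h_{\overline{i+1}})$, $[e_i,f_{\bar j}]=\delta_{ij}(h_{\bar i}-h_{\overline{i+1}})$; (QS5) $[e_i,e_{\bar j}]=[e_{\bar i},e_{\bar j}]=[f_i,f_{\bar j}]=[f_{\bar i},f_{\bar j}]=0$ for $|i-j|\ne1$; $[e_i,e_j]=[f_i,f_j]=0$ for $|i-j|>1$; $[e_i,e_{i+1}]=[e_{\bar i},e_{\overline{i+1}}]$, $[e_i,e_{\overline{i+1}}]=[e_{\bar i},e_{i+1}]$, $[f_{i+1},f_i]=[f_{\overline{i+1}},f_{\bar i}]$, $[f_{i+1},f_{\bar i}]=[f_{\overline{i+1}},f_i]$; (QS6) $[e_i,[e_i,e_j]]=[e_{\bar i},[e_i,e_j]]=0$ and $[f_i,[f_i,f_j]]=[f_{\bar i},[f_i,f_j]]=0$ for $|i-j|=1$; (QS7) $h_1+h_2+\cdots+h_n=r$; (QS8) $h_{\bar i}(h_i-1)\cdots(h_i-r)=0$ for $1\le i\le n$.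
   Context: In a superalgebra, $[x,y]=xy-(-1)^{\hat x\hat y}yx$ for homogeneous $x,y$, where $\hat x\in\{0,1\}$ is the parity. The Lie superalgebra $\mathfrak{gl}(n|n)$ over $\mathbb{Q}$ has matrix units $E_{i,j}$ with $i,j\in I(n|n)=\{1,\dots,n,-1,\dots,-n\}$, where $E_{i,j}$ is even if $ij>0$ and odd if $ij<0$. The queer Lie superalgebra $\mathfrak{q}(n)$ is its subalgebra of matrices $\begin{pmatrix} A & B \\ B & A \end{pmatrix}$ with $A,B$ arbitrary $n\times n$ matrices. Put $h_i=E_{i,i}+E_{-i,-i}$, $h_{\bar i}=E_{i,-i}+E_{-i,i}$ ($1\le i\le n$), $e_j=E_{j,j+1}+E_{-j,-j-1}$, $e_{\bar j}=E_{j,-j-1}+E_{-j,j+1}$, $f_j=E_{j+1,j}+E_{-j-1,-j}$, $f_{\bar j}=E_{j+1,-j}+E_{-j-1,j}$ ($1\le j\le n-1$). Let $\epsilon_1,\dots,\epsilon_n$ be dual to $h_1,\dots,h_n$, with bilinear form $(\epsilon_i,\epsilon_j)=\delta_{ij}$, and $\alpha_j=\epsilon_j-\epsilon_{j+1}$. $U(\mathfrak{q}(n))$ is the universal enveloping superalgebra. $V$ is the $\mathbb{Q}$-superspace with even basis $v_1,\dots,v_n$ and odd basis $v_{-1},\dots,v_{-n}$, on which $E_{i,j}v_k=\delta_{jk}v_i$. $\phi_r:U(\mathfrak q(n))\to\mathrm{End}_{\mathbb{Q}}(V^{\otimes r})$ is the superalgebra homomorphism giving the action on $V^{\otimes r}$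 through the comultiplication $x\mapsto x\otimes1+1\otimes x$ ($x\in\mathfrak q(n)$), with the usual sign rule for tensor products of superspaces. The queer Schur superalgebra is $\mathcal{Q}(n,r)=\phi_r(U(\mathfrak q(n)))$. *)

(* Defs.v *)
From HB Require Import structures.
From mathcomp Require Import all_boot all_order all_algebra.
From mathcomp Require Import generic_quotient ring_quotient mxtens boolp.
From mathcomp Require Import finmap monalg.

Set Implicit Arguments.
Unset Strict Implicit.
Unset Printing Implicit Defensive.

Import GRing.Theory.
Local Open Scope ring_scope.

(* The rational algebra structure is a central homomorphism from rat (algType
   is not used because it excludes the zero ring, hence arbitrary quotients). *)
HB.mixin Record isSuperalgebra A of GRing.PzRing A := {
  inQ : rat -> A;
  inQ_zmod : zmod_morphism inQ;
  inQ_monoid : monoid_morphism inQ;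
  inQ_central : forall a x, inQ a * x = x * inQ a;
  homog : bool -> A -> Prop;
  homog0 : forall p, homog p 0;
  homogD : forall p x y, homog p x -> homog p y -> homog p (x + y);
  homogQ : forall a, homog false (inQ a);
  homogM : forall p q x y, homog p x -> homog q y -> homog (p (+) q) (x * y);
  homog_decomp : forall x, exists x0 x1,
    [/\ homog false x0, homog true x1 & x = x0 + x1];
  homog_direct : forall x, homog false x -> homog true x -> x = 0
}.
#[short(type="superalgType")]
HB.structure Definition Superalgebra := {A of GRing.PzRing A & isSuperalgebra A}.

HB.instance Definition _ (A : superalgType) :=
  GRing.isZmodMorphism.Build rat A (@inQ A) inQ_zmod.
HB.instance Definition _ (A : superalgType) :=
  GRing.isMonoidMorphism.Build rat A (@inQ A) inQ_monoid.

Arguments homog {s} p x.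
Arguments homog0 {s} p.
Arguments homogD {s p x y}.
Arguments homogQ {s} a.
Arguments homogM {s p q x y}.
Arguments homog_decomp {s} x.
Arguments homog_direct {s x}.

Record superalg_hom (A B : superalgType) (f : A -> B) : Prop := SuperalgHom {
  superalg_homB : zmod_morphism f;
  superalg_homM : monoid_morphism f;
  superalg_homQ : forall a, f (inQ a) = inQ a;
  superalg_hom_homog : forall p x, homog p x -> homog p (f x)
}.

Definition superalg_iso (A B : superalgType) (f : A -> B) : Prop :=
  superalg_hom f /\ bijective f.

(* [x, y] for x of parity p and y of parity q *)
Definition scomm (A : superalgType) (p q : bool) (x y : A) : A :=
  x * y - (-1) ^+ (p && q) * (y * x).

Section SuperalgTheory.
Variable A : superalgType.
Implicit Types x y : A.

Lemma homogN p x : homog p x -> homog p (- x).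
Proof.
move=> hx; have := homogM (homogQ (-1) : homog false (inQ (-1) : A)) hx.
by rewrite rmorphN1 mulN1r.
Qed.

Lemma homogB p x y : homog p x -> homog p y -> homog p (x - y).
Proof. by move=> hx hy; apply: homogD => //; apply: homogN. Qed.

Lemma homog1 : homog false (1 : A).
Proof. by rewrite -(rmorph1 (@inQ A)); apply: homogQ. Qed.

Lemma homog_nat k : homog false (k%:R : A).
Proof. by rewrite -(rmorph_nat (@inQ A)); apply: homogQ. Qed.

Lemma homog_sum p I (s : seq I) (P : pred I) (F : I -> A) :
  (forall i, P i -> homog p (F i)) -> homog p (\sum_(i <- s | P i) F i).
Proof.
move=> hF; elim/big_rec: _ => [|i x Pi hx]; first exact: homog0.
by apply: homogD => //; apply: hF.
Qed.

Lemma homog_prod_even I (s : seq I) (P : pred I) (F : I -> A) :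
  (forall i, P i -> homog false (F i)) ->
  homog false (\prod_(i <- s | P i) F i).
Proof.
move=> hF; elim/big_rec: _ => [|i x Pi hx]; first exact: homog1.
by have := homogM (hF i Pi) hx.
Qed.

Lemma homog_sign (b : bool) p x : homog p x -> homog p ((-1) ^+ b * x).
Proof. by case: b; rewrite ?expr0 ?expr1 ?mulN1r ?mul1r //; apply: homogN. Qed.

Lemma homog_scomm p q x y :
  homog p x -> homog q y -> homog (p (+) q) (scomm p q x y).
Proof.
move=> hx hy; apply: homogB; first exact: homogM.
by apply: homog_sign; rewrite addbC; apply: homogM.
Qed.

Lemma homog_scomm_eq p q s x y : p (+) q = s ->
  homog p x -> homog q y -> homog s (scomm p q x y).
Proof. by move=> <-; apply: homog_scomm. Qed.

Lemma homog_inQM p a x : homog p x -> homog p (inQ a * x).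
Proof. by move=> hx; rewrite -[p]addFb; apply: homogM hx; apply: homogQ. Qed.

Lemma homog_NinQM p a x : homog p x -> homog p (- inQ a * x).
Proof. by rewrite -rmorphN; apply: homog_inQM. Qed.

Lemma homog_natM p k x : homog p x -> homog p (k%:R * x).
Proof. by move=> hx; rewrite -[p]addFb; apply: homogM hx; apply: homog_nat. Qed.

Lemma homog_if p (b : bool) x : homog p x -> homog p (if b then x else 0).
Proof. by case: b => // _; apply: homog0. Qed.

Lemma scommDl p q x y z : scomm p q (x + y) z = scomm p q x z + scomm p q y z.
Proof. by rewrite /scomm mulrDl !mulrDr opprD addrACA. Qed.

Lemma scommDr p q x y z : scomm p q x (y + z) = scomm p q x y + scomm p q x z.
Proof. by rewrite /scomm mulrDl !mulrDr opprD addrACA. Qed.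

Lemma scomm_mor (B : superalgType) (F : A -> B) p q x y : zmod_morphism F ->
  F (scomm p q x y) = F (x * y) - (-1) ^+ (p && q) * F (y * x).
Proof.
move=> FB; have F0 : F 0 = 0 by rewrite -[0 in LHS](subrr 0) FB subrr.
rewrite /scomm FB; case: (p && q); rewrite ?expr0 ?mul1r // expr1 !mulN1r.
by rewrite -[- (y * x)]sub0r FB F0 sub0r.
Qed.

Lemma superalg_hom_scomm (B : superalgType) (f : A -> B) p q x y :
  superalg_hom f -> f (scomm p q x y) = scomm p q (f x) (f y).
Proof. by move=> hf; rewrite (scomm_mor _ _ _ _ (superalg_homB hf)) !(superalg_homM hf).2. Qed.

End SuperalgTheory.

Record homset (A : superalgType) := HomSet {
  homset_pred :> A -> Prop;
  _ : forall x, homset_pred x -> exists p, homog p x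
}.

Inductive ideal (A : superalgType) (S : A -> Prop) : A -> Prop :=
| ideal0 : ideal S 0
| ideal_cons a s b x : S s -> ideal S x -> ideal S (a * s * b + x).

Section Ideal.
Variables (A : superalgType) (S : homset A).

Lemma ideal_gen a s b : S s -> ideal S (a * s * b).
Proof. by move=> Ss; rewrite -[_ * b]addr0; apply: ideal_cons Ss (ideal0 _). Qed.

Lemma idealD x y : ideal S x -> ideal S y -> ideal S (x + y).
Proof.
elim=> [|a s b z Ss _ IH] hy; first by rewrite add0r.
by rewrite -addrA; apply: ideal_cons => //; apply: IH.
Qed.

Lemma idealMlr c d x : ideal S x -> ideal S (c * x * d).
Proof.
elim=> [|a s b z Ss _ IH]; first by rewrite mulr0 mul0r; apply: ideal0.
rewrite mulrDr mulrDl; apply: idealD => //.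
by rewrite !mulrA -mulrA; apply: ideal_gen.
Qed.

Lemma idealMl c x : ideal S x -> ideal S (c * x).
Proof. by move=> /(idealMlr c 1); rewrite mulr1. Qed.

Lemma idealMr c x : ideal S x -> ideal S (x * c).
Proof. by move=> /(idealMlr 1 c); rewrite mul1r. Qed.

Lemma ideal_zmod_closed : zmod_closed (fun x : A => `[< ideal S x >]).
Proof.
split=> [|x y /asboolP hx /asboolP hy]; apply/asboolP; first exact: ideal0.
by rewrite -mulN1r; apply: idealD => //; apply: idealMl.
Qed.

Definition ideal_split (x : A) := exists x0 x1,
  [/\ homog false x0, homog true x1, ideal S x0, ideal S x1 & x = x0 + x1].

Lemma ideal_splitD x y : ideal_split x -> ideal_split y -> ideal_split (x + y).
Proof.
move=> [x0 [x1 [h0 h1 i0 i1 ->]]] [y0 [y1 [k0 k1 j0 j1 ->]]].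
exists (x0 + y0), (x1 + y1); rewrite addrACA.
by split=> //; [apply: homogD|apply: homogD|apply: idealD|apply: idealD].
Qed.

Lemma ideal_split_homog p x : homog p x -> ideal S x -> ideal_split x.
Proof.
case: p => hx ix; [exists 0, x|exists x, 0]; rewrite ?add0r ?addr0.
  by split=> //; [apply: homog0|apply: ideal0].
by split=> //; [apply: homog0|apply: ideal0].
Qed.

Lemma ideal_splitP x : ideal S x -> ideal_split x.
Proof.
elim=> [|a s b z Ss _ IH].
  exact: ideal_split_homog (homog0 false) (ideal0 _).
apply: ideal_splitD IH => {z}.
have [p hs] : exists p, homog p s by case: (S) Ss => ? /= H /H.
have [a0 [a1 [ha0 ha1 ->]]] := homog_decomp a.
have [b0 [b1 [hb0 hb1 ->]]] := homog_decomp b.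
rewrite !mulrDl !mulrDr.
by do 2 apply: ideal_splitD; apply: ideal_split_homog;
  try (apply: homogM; [apply: homogM|]; eassumption); apply: ideal_gen.
Qed.

End Ideal.

Definition ideal_pred (A : superalgType) (S : homset A) : {pred A} :=
  fun x => `[< ideal S x >].
HB.instance Definition _ (A : superalgType) (S : homset A) :=
  GRing.isZmodClosed.Build A (ideal_pred S) (ideal_zmod_closed S).

Definition squot (A : superalgType) (S : homset A) : Type :=
  Quotient.quot (ideal_pred S).
HB.instance Definition _ A (S : homset A) := GRing.Zmodule.on (squot S).

Definition spi (A : superalgType) (S : homset A) (x : A) : squot S :=
  \pi_(Quotient.quot (ideal_pred S))%qT x.
Definition srepr (A : superalgType) (S : homset A) (u : squot S) : A :=
  repr (u : Quotient.quot (ideal_pred S)).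

Section SuperQuotient.
Variables (A : superalgType) (S : homset A).
Local Notation Q := (squot S).
Local Notation pi := (@spi A S).

Lemma sreprK u : pi (srepr u) = u.
Proof. exact: reprK. Qed.

Lemma spiP x y : pi x = pi y <-> ideal S (x - y).
Proof.
split=> [/eqP|H].
  by rewrite -(Quotient.idealrBE (ideal_pred S)) => /asboolP.
by apply/eqP; rewrite -(Quotient.idealrBE (ideal_pred S)); apply/asboolP.
Qed.

Lemma srepr_pi x : ideal S (srepr (pi x) - x).
Proof. by apply/spiP; rewrite sreprK. Qed.

Lemma spi_is_zmod_morphism : zmod_morphism pi.
Proof. by move=> x y; rewrite /spi raddfB. Qed.
HB.instance Definition _ := GRing.isZmodMorphism.Build A Q pi spi_is_zmod_morphism.

Definition squot_mul (u v : Q) : Q := pi (srepr u * srepr v).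
Local Notation mul := squot_mul.

Lemma spi_mul x y : pi (x * y) = mul (pi x) (pi y).
Proof.
apply/spiP; set x' := srepr _; set y' := srepr _.
have -> : x * y - x' * y' = (x - x') * y + x' * (y - y').
  by rewrite mulrBl mulrBr addrA subrK.
by apply: idealD; [apply: idealMr|apply: idealMl]; apply/spiP; rewrite sreprK.
Qed.

Lemma squot_mulA : associative mul.
Proof.
move=> u v w; rewrite -[u]sreprK -[v]sreprK -[w]sreprK.
by rewrite -!spi_mul mulrA.
Qed.
Lemma squot_mul1 : left_id (pi 1) mul.
Proof. by move=> u; rewrite -[u]sreprK -!spi_mul mul1r. Qed.
Lemma squot_mulr1 : right_id (pi 1) mul.
Proof. by move=> u; rewrite -[u]sreprK -!spi_mul mulr1. Qed.
Lemma squot_mulDl : left_distributive mul +%R.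
Proof.
move=> u v w; rewrite -[u]sreprK -[v]sreprK -[w]sreprK.
by rewrite -raddfD -!spi_mul mulrDl raddfD.
Qed.
Lemma squot_mulDr : right_distributive mul +%R.
Proof.
move=> u v w; rewrite -[u]sreprK -[v]sreprK -[w]sreprK.
by rewrite -raddfD -!spi_mul mulrDr raddfD.
Qed.

HB.instance Definition _ := GRing.Zmodule_isPzRing.Build Q
  squot_mulA squot_mul1 squot_mulr1 squot_mulDl squot_mulDr.

Lemma spi_is_monoid_morphism : monoid_morphism pi.
Proof. by split=> // x y; rewrite spi_mul. Qed.
HB.instance Definition _ := GRing.isMonoidMorphism.Build A Q pi spi_is_monoid_morphism.

Definition squot_inQ (a : rat) : Q := pi (inQ a).
Definition squot_homog (p : bool) (u : Q) : Prop :=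
  exists2 x, homog p x & u = pi x.

Lemma squot_inQ_zmod : zmod_morphism squot_inQ.
Proof. by move=> a b; rewrite /squot_inQ !rmorphB. Qed.
Lemma squot_inQ_monoid : monoid_morphism squot_inQ.
Proof. by split=> [|a b]; rewrite /squot_inQ ?rmorph1 ?rmorphM. Qed.
Lemma squot_inQ_central a u : squot_inQ a * u = u * squot_inQ a.
Proof. by rewrite -[u]sreprK -!rmorphM inQ_central. Qed.
Lemma squot_homog0 p : squot_homog p 0.
Proof. by exists 0; [apply: homog0|rewrite rmorph0]. Qed.
Lemma squot_homogD p u v :
  squot_homog p u -> squot_homog p v -> squot_homog p (u + v).
Proof.
move=> [x hx ->] [y hy ->]; exists (x + y); last by rewrite rmorphD.
exact: homogD.
Qed.
Lemma squot_homogQ a : squot_homog false (squot_inQ a).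
Proof. by exists (inQ a) => //; apply: homogQ. Qed.
Lemma squot_homogM p q u v :
  squot_homog p u -> squot_homog q v -> squot_homog (p (+) q) (u * v).
Proof.
move=> [x hx ->] [y hy ->]; exists (x * y); last by rewrite rmorphM.
exact: homogM.
Qed.
Lemma squot_homog_decomp u : exists u0 u1,
  [/\ squot_homog false u0, squot_homog true u1 & u = u0 + u1].
Proof.
have [x0 [x1 [h0 h1 e]]] := homog_decomp (srepr u).
exists (pi x0), (pi x1); split; [by exists x0|by exists x1|].
by rewrite -rmorphD -e /= sreprK.
Qed.
Lemma squot_homog_direct u : squot_homog false u -> squot_homog true u -> u = 0.
Proof.
move=> [x hx ->] [y hy /spiP/ideal_splitP [z0 [z1 [h0 h1 i0 i1 e]]]].
have e' : x - z0 = y + z1.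
  by apply/eqP; rewrite subr_eq -addrA [z1 + _]addrC -e addrC subrK.
have x0 : x - z0 = 0.
  by apply: homog_direct; [apply: homogB|rewrite e'; apply: homogD].
rewrite -(rmorph0 pi); apply/spiP; rewrite subr0.
by have /eqP := x0; rewrite subr_eq0 => /eqP ->.
Qed.

HB.instance Definition _ := isSuperalgebra.Build Q
  squot_inQ_zmod squot_inQ_monoid squot_inQ_central squot_homog0 squot_homogD
  squot_homogQ squot_homogM squot_homog_decomp squot_homog_direct.

Lemma spi_hom : superalg_hom pi.
Proof.
split=> //; first exact: spi_is_zmod_morphism.
  exact: spi_is_monoid_morphism.
by move=> p x hx; exists x.
Qed.

Definition squot_lift (B : superalgType) (f : A -> B) (u : Q) : B := f (srepr u).

Section Lift.
Variables (B : superalgType) (f : A -> B).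
Hypotheses (hf : superalg_hom f) (fS : forall s, S s -> f s = 0).

Lemma hom_ideal x : ideal S x -> f x = 0.
Proof.
have f0 : f 0 = 0 by rewrite -[0 in LHS](subrr 0) (superalg_homB hf) subrr.
have fD y z : f (y + z) = f y + f z.
  rewrite -[z in LHS]opprK (superalg_homB hf) -[- z]sub0r (superalg_homB hf).
  by rewrite f0 sub0r opprK.
elim=> // a s b z Ss _ IH.
by rewrite fD IH addr0 !(superalg_homM hf).2 (fS Ss) mulr0 mul0r.
Qed.

Lemma squot_liftE x : squot_lift f (pi x) = f x.
Proof.
apply/eqP; rewrite -subr_eq0 -(superalg_homB hf); apply/eqP/hom_ideal.
exact: srepr_pi.
Qed.

Lemma squot_lift_hom : superalg_hom (squot_lift f).
Proof.
split=> [u v||a|p u [x hx ->]].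
- by rewrite -[u]sreprK -[v]sreprK -raddfB !squot_liftE (superalg_homB hf).
- split=> [|u v]; first by rewrite -(rmorph1 pi) squot_liftE (superalg_homM hf).1.
  by rewrite -[u]sreprK -[v]sreprK -rmorphM !squot_liftE (superalg_homM hf).2.
- by rewrite [inQ a]/(pi (inQ a)) squot_liftE (superalg_homQ hf).
- by rewrite squot_liftE; apply: (superalg_hom_homog hf).
Qed.

End Lift.
End SuperQuotient.

Section Image.
Variables (A B : superalgType) (f : A -> B) (hf : superalg_hom f).

Definition simage_pred : {pred B} := fun y => `[< exists x, f x = y >].

Lemma simage_subring_closed : subring_closed simage_pred.
Proof.
split=> [|_ _ /asboolP[x <-] /asboolP[y <-]|_ _ /asboolP[x <-] /asboolP[y <-]];
  apply/asboolP.
- by exists 1; rewrite (superalg_homM hf).1.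
- by exists (x - y); rewrite (superalg_homB hf).
- by exists (x * y); rewrite (superalg_homM hf).2.
Qed.

End Image.

Record simage (A B : superalgType) (f : A -> B) (hf : superalg_hom f) :=
  SImage { simage_val :> B; _ : simage_val \in simage_pred f }.

Section ImageSuperalg.
Variables (A B : superalgType) (f : A -> B) (hf : superalg_hom f).
Local Notation Im := (simage hf).

HB.instance Definition _ := [isSub for @simage_val A B f hf].
HB.instance Definition _ := [Choice of Im by <:].
HB.instance Definition _ := 
  GRing.SubChoice_isSubPzRing.Build B (simage_pred f) Im (simage_subring_closed hf).

Lemma simageP (y : Im) : exists x, f x = \val y.
Proof. by apply/asboolP; apply: (valP y). Qed.

Lemma simage_subproof x : f x \in simage_pred f.
Proof. by apply/asboolP; exists x. Qed.

Definition to_simage (x : A) : Im := SImage hf (simage_subproof x).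

Lemma val_to_simage x : \val (to_simage x) = f x. Proof. by []. Qed.

Definition simage_inQ (a : rat) : Im := to_simage (inQ a).
Definition simage_homog (p : bool) (y : Im) : Prop := homog p (\val y).

Lemma simage_inQ_zmod : zmod_morphism simage_inQ.
Proof. by move=> a b; apply: val_inj; rewrite /= !(superalg_homQ hf) rmorphB. Qed.
Lemma simage_inQ_monoid : monoid_morphism simage_inQ.
Proof.
by split=> [|a b]; apply: val_inj; rewrite /= !(superalg_homQ hf) ?rmorph1 ?rmorphM.
Qed.
Lemma simage_inQ_central a y : simage_inQ a * y = y * simage_inQ a.
Proof. by apply: val_inj; rewrite /= !(superalg_homQ hf) inQ_central. Qed.
Lemma simage_homog0 p : simage_homog p 0.
Proof. exact: homog0. Qed.
Lemma simage_homogD p y z :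
  simage_homog p y -> simage_homog p z -> simage_homog p (y + z).
Proof. exact: homogD. Qed.
Lemma simage_homogQ a : simage_homog false (simage_inQ a).
Proof. by rewrite /simage_homog /= (superalg_homQ hf); apply: homogQ. Qed.
Lemma simage_homogM p q y z :
  simage_homog p y -> simage_homog q z -> simage_homog (p (+) q) (y * z).
Proof. exact: homogM. Qed.
Lemma simage_homog_decomp y : exists y0 y1,
  [/\ simage_homog false y0, simage_homog true y1 & y = y0 + y1].
Proof.
have [x e] := simageP y; have [x0 [x1 [h0 h1 ex]]] := homog_decomp x.
exists (to_simage x0), (to_simage x1); split.
- exact: (superalg_hom_homog hf).
- exact: (superalg_hom_homog hf).
apply: val_inj; rewrite /= -[RHS]/(f x0 + f x1) -e ex.
by rewrite -[x1 in LHS]opprK (superalg_homB hf) -[- x1]sub0r (superalg_homB hf)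
  -[0 in LHS](subrr 0) (superalg_homB hf) subrr sub0r opprK.
Qed.
Lemma simage_homog_direct y : simage_homog false y -> simage_homog true y -> y = 0.
Proof. by move=> h0 h1; apply: val_inj; apply: homog_direct. Qed.

HB.instance Definition _ := isSuperalgebra.Build Im
  simage_inQ_zmod simage_inQ_monoid simage_inQ_central simage_homog0 simage_homogD
  simage_homogQ simage_homogM simage_homog_decomp simage_homog_direct.

End ImageSuperalg.

Definition fsalg (X : choiceType) (par : X -> bool) : Type := {malg rat[{fmonom X}]}.

Section FreeSuperalg.
Variables (X : choiceType) (par : X -> bool).
Local Notation F := (fsalg par).

HB.instance Definition _ := GRing.Lalgebra.on F.

Definition fgen (x : X) : F := << fmu x >>.

Definition wpar (k : {fmonom X}) : bool := odd (count par k).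
Definition fsalg_inQ (a : rat) : F := malgC a.
Definition fsalg_homog (p : bool) (g : F) : Prop :=
  forall k, k \in msupp g -> wpar k = p.

Lemma fsalg_inQ_zmod : zmod_morphism fsalg_inQ.
Proof. by move=> a b; rewrite /fsalg_inQ raddfB. Qed.
Lemma fsalg_inQ_monoid : monoid_morphism fsalg_inQ.
Proof. by split=> [|a b]; rewrite /fsalg_inQ ?rmorph1 ?rmorphM. Qed.
Lemma malgC_central a (g : {malg rat[{fmonom X}]}) : malgC a * g = g * malgC a.
Proof.
rewrite mul_malgC; apply/malgP => k; rewrite mcoeffZ.
rewrite malgM_def (fgmulgU a (mone : {fmonom X}) g) [g in LHS]monalgE.
rewrite raddf_sum mulr_sumr raddf_sum /=.
by apply: eq_bigr => k' _; rewrite mulm1 !mcoeffU mulrnAr mulrC.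
Qed.
Lemma fsalg_inQ_central a (g : F) : fsalg_inQ a * g = g * fsalg_inQ a.
Proof. exact: malgC_central. Qed.
Lemma fsalg_homog0 p : fsalg_homog p 0.
Proof. by move=> k; rewrite msupp0 in_fset0. Qed.
Lemma fsalg_homogD p g h :
  fsalg_homog p g -> fsalg_homog p h -> fsalg_homog p (g + h).
Proof.
move=> hg hh k /(fsubsetP (msuppD_le g h)); rewrite in_fsetU.
by case/orP => [/hg|/hh].
Qed.
Lemma fsalg_homogQ a : fsalg_homog false (fsalg_inQ a).
Proof.
by move=> k /(fsubsetP (msuppC_le a)); rewrite in_fset1 => /eqP ->; rewrite /wpar fm1.
Qed.
Lemma wparM k l : wpar (mmul k l) = wpar k (+) wpar l.
Proof. by rewrite /wpar fmM count_cat oddD. Qed.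
Lemma fsalg_homogM p q g h :
  fsalg_homog p g -> fsalg_homog q h -> fsalg_homog (p (+) q) (g * h).
Proof.
move=> hg hh k /(fsubsetP (msuppM_incl g h)) /imfset2P /= [k1 k1g [k2 k2h ->]].
by rewrite wparM (hg _ k1g) (hh _ k2h).
Qed.
Lemma fsalg_homogU p a k : wpar k = p -> fsalg_homog p << a *g k >>.
Proof. by move=> e l /(fsubsetP msuppU_le); rewrite in_fset1 => /eqP ->. Qed.
Lemma fsalg_homog_decomp g : exists g0 g1,
  [/\ fsalg_homog false g0, fsalg_homog true g1 & g = g0 + g1].
Proof.
have hs p (s : seq {fmonom X}) :
    fsalg_homog p (\sum_(k <- s | wpar k == p) << g@_k *g k >>).
  elim/big_rec: _ => [|k x /eqP e hx]; first exact: fsalg_homog0.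
  by apply: fsalg_homogD => //; apply: fsalg_homogU.
exists (\sum_(k <- msupp g | wpar k == false) << g@_k *g k >>),
       (\sum_(k <- msupp g | wpar k == true) << g@_k *g k >>); split=> //.
rewrite {1}[g]monalgE (bigID (fun k => wpar k == false)) /=; congr (_ + _).
by apply: eq_bigl => k; case: (wpar k).
Qed.
Lemma fsalg_homog_direct g : fsalg_homog false g -> fsalg_homog true g -> g = 0.
Proof.
move=> h0 h1; apply/malgP => k; rewrite mcoeff0; apply/eqP; rewrite mcoeff_eq0.
by apply/negP => kg; have := h0 _ kg; rewrite (h1 _ kg).
Qed.

HB.instance Definition _ := isSuperalgebra.Build F
  fsalg_inQ_zmod fsalg_inQ_monoid fsalg_inQ_central fsalg_homog0 fsalg_homogD
  fsalg_homogQ fsalg_homogM fsalg_homog_decomp fsalg_homog_direct.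

Lemma homog_fgen x : homog (par x) (fgen x).
Proof. by apply: fsalg_homogU; rewrite /wpar fmU /= addn0 oddb. Qed.

Section Eval.
Variables (B : superalgType) (h : X -> B).
Hypothesis hh : forall x, homog (par x) (h x).

Definition feval (g : F) : B :=
  \sum_(k <- msupp g) inQ g@_k * \prod_(x <- (k : seq X)) h x.

Lemma fevalEw (d : {fset {fmonom X}}) g : (msupp g `<=` d)%fset ->
  feval g = \sum_(k <- d) inQ g@_k * \prod_(x <- (k : seq X)) h x.
Proof.
move=> le; rewrite /feval (big_fset_incl _ le) => //= k kd /mcoeff_outdom ->.
by rewrite rmorph0 mul0r.
Qed.

Lemma fevalU a k : feval << a *g k >> = inQ a * \prod_(x <- (k : seq X)) h x.
Proof. by rewrite (fevalEw msuppU_le) big_seq_fset1 mcoeffUU. Qed.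

Lemma feval_gen x : feval (fgen x) = h x.
Proof. by rewrite fevalU rmorph1 mul1r fmU big_seq1. Qed.

Lemma feval_zmod : zmod_morphism feval.
Proof.
move=> g1 g2; set d := (msupp g1 `|` msupp g2)%fset.
rewrite !(@fevalEw d) ?fsubsetUl ?fsubsetUr ?msuppB_le //.
by rewrite -sumrB; apply: eq_bigr => k _; rewrite mcoeffB rmorphB mulrBl.
Qed.
HB.instance Definition _ := GRing.isZmodMorphism.Build F B feval feval_zmod.

Lemma feval_monoid : monoid_morphism feval.
Proof.
split=> [|g1 g2].
  by rewrite -[1]/(<< mone >> : F) fevalU rmorph1 mul1r fm1 big_nil.
rewrite malgME raddf_sum mulr_suml /=; apply: eq_bigr => i _.
rewrite raddf_sum mulr_sumr /=; apply: eq_bigr => j _.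
rewrite fevalU fmM big_cat rmorphM /= -!mulrA; congr (_ * _).
by rewrite mulrA inQ_central -mulrA.
Qed.
HB.instance Definition _ := GRing.isMonoidMorphism.Build F B feval feval_monoid.

Lemma feval_inQ a : feval (inQ a) = inQ a.
Proof. by rewrite [LHS]fevalU fm1 big_nil mulr1. Qed.

Lemma feval_hom : superalg_hom feval.
Proof.
split; [exact: feval_zmod|exact: feval_monoid|exact: feval_inQ|].
move=> p g hg; rewrite /feval big_seq; apply: homog_sum => k /hg <-.
rewrite -[wpar k]addFb; apply: homogM; first exact: homogQ.
rewrite /wpar; elim: (k : seq X) => [|x s IH] /=.
  by rewrite big_nil; apply: homog1.
by rewrite big_cons oddD oddb; apply: homogM.
Qed.

End Eval.
End FreeSuperalg.

(* Endomorphisms of a superspace with basis indexed by 'I_N, par giving the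
   parity of the basis vectors; M i j is the coefficient of the i-th basis
   vector in the image of the j-th one. *)

Definition superEnd (N : nat) (par : 'I_N -> bool) : Type := 'M[rat]_N.

Section SuperEnd.
Variables (N : nat) (par : 'I_N -> bool).
Local Notation E := (superEnd par).

HB.instance Definition _ := GRing.PzRing.on E.

Definition superEnd_inQ (a : rat) : E := a%:M.
Definition superEnd_homog (p : bool) (M : E) : Prop :=
  forall i j, M i j != 0 -> par i (+) par j = p.

Lemma superEnd_inQ_zmod : zmod_morphism superEnd_inQ.
Proof. by move=> a b; apply: raddfB. Qed.
Lemma superEnd_inQ_monoid : monoid_morphism superEnd_inQ.
Proof. by split=> // a b; apply: scalar_mxM. Qed.
Lemma superEnd_inQ_central a (M : E) : superEnd_inQ a * M = M * superEnd_inQ a.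
Proof. exact: (comm_scalar_mx a M). Qed.
Lemma superEnd_homog0 p : superEnd_homog p 0.
Proof. by move=> i j; rewrite mxE eqxx. Qed.
Lemma superEnd_homogD p (M M' : E) :
  superEnd_homog p M -> superEnd_homog p M' -> superEnd_homog p (M + M').
Proof.
move=> h h' i j; rewrite mxE; have [e|/h //] := eqVneq (M i j) 0.
by rewrite e add0r => /h'.
Qed.
Lemma superEnd_homogQ a : superEnd_homog false (superEnd_inQ a).
Proof.
by move=> i j; rewrite mxE; have [->|_] := eqVneq i j; rewrite ?addbb // mulr0n eqxx.
Qed.
Lemma superEnd_homogM p q (M M' : E) :
  superEnd_homog p M -> superEnd_homog q M' -> superEnd_homog (p (+) q) (M * M').
Proof.
move=> h h' i j; rewrite mxE => nz.
have [k] : exists k, M i k * M' k j != 0.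
  apply: contrapT => H; case/negP: nz; apply/eqP/big1 => k _.
  by apply/eqP; apply: contrapT => /negP e; apply: H; exists k.
rewrite mulf_eq0 negb_or => /andP[/h <- /h' <-].
by case: (par i) (par j) (par k) => [] [] [].
Qed.
Lemma superEnd_homog_decomp (M : E) : exists M0 M1,
  [/\ superEnd_homog false M0, superEnd_homog true M1 & M = M0 + M1].
Proof.
pose part p : E := \matrix_(i, j) (M i j *+ (par i (+) par j == p)).
have hp p : superEnd_homog p (part p).
  by move=> i j; rewrite mxE; have [//|_] := eqVneq (_ (+) _) p; rewrite mulr0n eqxx.
exists (part false), (part true); split=> //.
by apply/matrixP => i j; rewrite !mxE; case: (_ (+) _); rewrite ?add0r ?addr0.
Qed.
Lemma superEnd_homog_direct (M : E) :
  superEnd_homog false M -> superEnd_homog true M -> M = 0.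
Proof.
move=> h0 h1; apply/matrixP => i j; rewrite mxE; apply/eqP/negP => /negP nz.
by have := h0 _ _ nz; rewrite (h1 _ _ nz).
Qed.

HB.instance Definition _ := isSuperalgebra.Build E
  superEnd_inQ_zmod superEnd_inQ_monoid superEnd_inQ_central superEnd_homog0
  superEnd_homogD superEnd_homogQ superEnd_homogM superEnd_homog_decomp
  superEnd_homog_direct.

Lemma superEndBE (M M' : E) i j : (M - M') i j = M i j - M' i j.
Proof. by rewrite mxE; congr (_ + _); rewrite mxE. Qed.

Lemma superEndQE a (M : E) i j : (inQ a * M) i j = a * M i j.
Proof. by rewrite -[_ * M]/(a%:M *m M) mul_scalar_mx mxE. Qed.

End SuperEnd.

(* The index set I(n|n): 'I_(n + n), where the i-th index of the first half is
   i and the i-th index of the second half is -i. *)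

Definition vpar (n : nat) (i : 'I_(n + n)) : bool := (n <= i)%N.

(* gl(n|n) is End(V) with the bracket scomm *)
Notation gl n := (superEnd (@vpar n)).

Definition pos (n : nat) (i : 'I_n) : 'I_(n + n) := lshift n i.
Definition neg (n : nat) (i : 'I_n) : 'I_(n + n) := rshift n i.
Definition glE (n : nat) (i j : 'I_(n + n)) : gl n := delta_mx i j.

Definition queer (n : nat) (x : gl n) : Prop :=
  exists A B : 'M[rat]_n, x = block_mx A B B A.

Definition qunit (n : nat) (p : bool) (i j : 'I_n) : gl n :=
  if p then glE (pos i) (neg j) + glE (neg i) (pos j)
  else glE (pos i) (pos j) + glE (neg i) (neg j).

Section Simple.
Variable n : nat.
Lemma fst_index_proof (j : 'I_n.-1) : (j < n)%N.
Proof. by case: n j => [|m] [k hk] //=; apply: ltn_trans hk _. Qed.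
Lemma snd_index_proof (j : 'I_n.-1) : (j.+1 < n)%N.
Proof. by case: n j => [|m] [k hk]. Qed.
(* The simple roots are indexed by 'I_n.-1; cur j and nxt j are the indices j
   and j + 1 as elements of 'I_n. *)
Definition cur (j : 'I_n.-1) : 'I_n := Ordinal (fst_index_proof j).
Definition nxt (j : 'I_n.-1) : 'I_n := Ordinal (snd_index_proof j).

(* p = true for the barred elements *)
Definition qh (p : bool) (i : 'I_n) : gl n := qunit p i i.
Definition qe (p : bool) (j : 'I_n.-1) : gl n := qunit p (cur j) (nxt j).
Definition qf (p : bool) (j : 'I_n.-1) : gl n := qunit p (nxt j) (cur j).

Definition eps (i : 'I_n) : 'rV[rat]_n := delta_mx 0 i.
Definition alpha (j : 'I_n.-1) : 'rV[rat]_n := eps (cur j) - eps (nxt j).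
Definition wform (u v : 'rV[rat]_n) : rat := (u *m v^T) 0 0.
End Simple.

Section QueerTheory.
Variable n : nat.

Lemma vpar_pos (i : 'I_n) : vpar (pos i) = false.
Proof. by rewrite /vpar /= leqNgt ltn_ord. Qed.
Lemma vpar_neg (i : 'I_n) : vpar (neg i) = true.
Proof. by rewrite /vpar /= leq_addr. Qed.

Lemma homog_glE (i j : 'I_(n + n)) : homog (vpar i (+) vpar j) (glE i j).
Proof. by move=> k l; rewrite mxE; case: andP => // -[/eqP -> /eqP ->]. Qed.

Lemma homog_qunit p (i j : 'I_n) : homog p (qunit p i j).
Proof.
case: p; apply: homogD.
- by have := @homog_glE (pos i) (neg j); rewrite vpar_pos vpar_neg.
- by have := @homog_glE (neg i) (pos j); rewrite vpar_pos vpar_neg.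
- by have := @homog_glE (pos i) (pos j); rewrite !vpar_pos.
- by have := @homog_glE (neg i) (neg j); rewrite !vpar_neg.
Qed.

Definition qcoef (p : bool) (i j : 'I_n) (x : gl n) : rat :=
  x (pos i) (if p then neg j else pos j).

Lemma qcoefB p i j : zmod_morphism (qcoef p i j).
Proof. by move=> x y; rewrite /qcoef !mxE. Qed.

Lemma queer_sum (x : gl n) : queer x ->
  x = \sum_p \sum_i \sum_j inQ (qcoef p i j x) * qunit p i j.
Proof.
move=> [A [B ex]]; apply/matrixP => k l.
have inQE (a : rat) (M : gl n) u v : (inQ a * M) u v = a * M u v.
  by rewrite -[_ * M]/(a%:M *m M) mul_scalar_mx mxE.
rewrite big_bool /= mxE !summxE.
under eq_bigr => i _ do (rewrite summxE; under eq_bigr => j _ do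
  rewrite inQE !mxE).
under [X in _ = _ + X]eq_bigr => i _ do (rewrite summxE; under eq_bigr => j _ do
  rewrite inQE !mxE).
rewrite {1}ex.
have cE i j : qcoef false i j x = A i j by rewrite /qcoef ex block_mxEul.
have cE' i j : qcoef true i j x = B i j by rewrite /qcoef ex block_mxEur.
have Epp (i j : 'I_n) : (pos i == pos j) = (i == j) by apply: inj_eq; apply: lshift_inj.
have Enn (i j : 'I_n) : (neg i == neg j) = (i == j) by apply: inj_eq; apply: rshift_inj.
have Epn (i j : 'I_n) : (pos i == neg j) = false by apply: eq_lrshift.
have Enp (i j : 'I_n) : (neg i == pos j) = false by apply: eq_rlshift.
have dsum (C : 'M[rat]_n) (a b : 'I_n) :
    \sum_i \sum_j C i j * ((a == i) && (b == j))%:R = C a b.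
  rewrite (bigD1 a) //= (bigD1 b) //= !eqxx mulr1 !big1 ?addr0 // => i /negPf ni.
    by rewrite big1 // => j _; rewrite eq_sym ni mulr0.
  by rewrite eq_sym ni andbF mulr0.
have zsum (C : 'M[rat]_n) : \sum_i \sum_j C i j * (0 : rat) = 0.
  by rewrite big1 // => i _; rewrite big1 // => j _; rewrite mulr0.
case: (split_ordP k) => a ->; case: (split_ordP l) => b ->;
  rewrite ?(block_mxEul, block_mxEur, block_mxEdl, block_mxEdr) -/(pos _) -/(neg _);
  under eq_bigr => i _ do under eq_bigr => j _ do
    rewrite cE' ?(Epp, Enn, Epn, Enp) /= ?andbF ?mulr0n ?addr0 ?add0r;
  under [X in _ = _ + X]eq_bigr => i _ do under eq_bigr => j _ do
    rewrite cE ?(Epp, Enn, Epn, Enp) /= ?andbF ?mulr0n ?addr0 ?add0r;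
  by rewrite dsum zsum ?addr0 ?add0r.
Qed.

Lemma queer_qunit p (i j : 'I_n) : queer (qunit p i j).
Proof.
exists (if p then 0 else delta_mx i j), (if p then delta_mx i j else 0).
by case: p; apply/matrixP => k l; case: (split_ordP k) => a ->;
  case: (split_ordP l) => b ->;
  rewrite ?(block_mxEul, block_mxEur, block_mxEdl, block_mxEdr) !mxE
    /pos /neg ?(eq_lshift, eq_rshift, eq_lrshift, eq_rlshift) /= ?andbF
    ?addr0 ?add0r.
Qed.

End QueerTheory.

(* U(q(n)): the tensor superalgebra of q(n) is the free superalgebra on the
   homogeneous basis qunit. *)

Definition qbpar (n : nat) (b : bool * 'I_n * 'I_n) : bool := b.1.1.
Notation tq n := (fsalg (@qbpar n)).

Definition tq_inj (n : nat) (x : gl n) : tq n :=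
  \sum_p \sum_i \sum_j inQ (qcoef p i j x) * fgen _ (p, i, j).

Variant uq_rel (n : nat) : tq n -> Prop :=
  UqRel p q (x y : gl n) of queer x & queer y & homog p x & homog q y :
    uq_rel (scomm p q (tq_inj x) (tq_inj y) - tq_inj (scomm p q x y)).

Section Uq.
Variable n : nat.

Lemma homog_tq_inj p (x : gl n) : homog p x -> homog p (tq_inj x).
Proof.
move=> hx; rewrite /tq_inj; do 3 (apply: homog_sum => ? _).
set q := (X in qcoef X _ _ _); set i := (X in qcoef _ X _ _).
set j := (X in qcoef _ _ X _).
have [->|/hx] := eqVneq (qcoef q i j x) 0.
  by rewrite rmorph0 mul0r; apply: homog0.
rewrite vpar_pos addFb => e.
have -> : p = false (+) q by rewrite -e; case: (q); rewrite ?vpar_pos ?vpar_neg.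
by apply: homogM; [apply: homogQ|apply: homog_fgen].
Qed.

Lemma uq_rel_homog (x : tq n) : uq_rel x -> exists p, homog p x.
Proof.
case=> p q {}x y _ _ hx hy; exists (p (+) q).
by apply: homogB; [apply: homog_scomm|apply/homog_tq_inj/homog_scomm];
  try apply: homog_tq_inj.
Qed.

Definition uq_rels : homset (tq n) := HomSet uq_rel_homog.

Definition uq_inj (x : gl n) : squot uq_rels := spi uq_rels (tq_inj x).

Lemma homog_uq_inj p x : homog p x -> homog p (uq_inj x).
Proof. by move=> hx; exists (tq_inj x) => //; apply: homog_tq_inj. Qed.

End Uq.
Notation Uq n := (squot (uq_rels n)).

(* Tensor products: by the sign rule, f (x) g maps v_j (x) w_l to
   (-1)^(|g| |v_j|) f v_j (x) g w_l for homogeneous g, where the (k, l) matrix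
   unit has parity par k + par l. *)

Definition spar (M N : nat) (a : 'I_M -> bool) (b : 'I_N -> bool)
  (k : 'I_(M * N)) : bool :=
  a (mxtens_unindex k).1 (+) b (mxtens_unindex k).2.

Definition stens (M N : nat) (a : 'I_M -> bool) (b : 'I_N -> bool)
    (f : superEnd a) (g : superEnd b) : superEnd (spar a b) :=
  \matrix_(s, t)
    let: (i, k) := mxtens_unindex s in let: (j, l) := mxtens_unindex t in
    (-1) ^+ ((b k (+) b l) && a j) * f i j * g k l.

Section Stens.
Variables (M N : nat) (a : 'I_M -> bool) (b : 'I_N -> bool).
Implicit Types (f : superEnd a) (g : superEnd b).

Lemma stensE f g i j k l :
  stens f g (mxtens_index (i, k)) (mxtens_index (j, l)) =
    (-1) ^+ ((b k (+) b l) && a j) * f i j * g k l.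
Proof. by rewrite mxE !mxtens_indexK. Qed.

Lemma stensM p q f f' g g' : homog p f' -> homog q g ->
  stens f g * stens f' g' = (-1) ^+ (q && p) * stens (f * f') (g * g').
Proof.
move=> hf hg.
have -> : (-1) ^+ (q && p) * stens (f * f') (g * g') =
          ((-1) ^+ (q && p) *: stens (f * f') (g * g') : 'M_(M * N)).
  by case: (q && p); rewrite ?expr0 ?expr1 ?scale1r ?scaleN1r ?mul1r ?mulN1r.
apply/matrixP => s t; case: (mxtens_indexP s) => i k; case: (mxtens_indexP t) => j l.
rewrite mxE [RHS]mxE stensE !mxE -!mulrA mulrA -signr_addb mulr_sum mulr_sumr.
apply: eq_bigr => u _; case: (mxtens_indexP u) => c d; rewrite !stensE mxtens_indexK /=.
have [->|/hf <-] := eqVneq (f' c j) 0; first by rewrite !(mulr0, mul0r).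
have [->|/hg <-] := eqVneq (g k d) 0; first by rewrite !(mulr0, mul0r).
rewrite [LHS](_ : _ = (-1) ^+ ((b k (+) b d) && a c) * (-1) ^+ ((b d (+) b l) && a j) *
    (f i c * f' c j * (g k d * g' d l))); last first.
  by rewrite mulrACA [X in X * _]mulrACA -mulrA.
rewrite -signr_addb; congr ((-1) ^+ nat_of_bool _ * _).
by case: (b k) (b d) (b l) (a c) (a j) => [] [] [] [] [].
Qed.

Lemma stens_homog p q f g : homog p f -> homog q g -> homog (p (+) q) (stens f g).
Proof.
move=> hf hg s t; case: (mxtens_indexP s) => i k; case: (mxtens_indexP t) => j l.
rewrite stensE !mulf_eq0 !negb_or -andbA => /and3P[_ /hf <- /hg <-].
by rewrite /spar !mxtens_indexK addbACA.
Qed.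

Lemma stensBl f f' g : stens (f - f') g = stens f g - stens f' g.
Proof.
apply/matrixP => s t; case: (mxtens_indexP s) => i k; case: (mxtens_indexP t) => j l.
by rewrite superEndBE !stensE superEndBE mulrBr mulrBl.
Qed.

Lemma stensBr f g g' : stens f (g - g') = stens f g - stens f g'.
Proof.
apply/matrixP => s t; case: (mxtens_indexP s) => i k; case: (mxtens_indexP t) => j l.
by rewrite superEndBE !stensE superEndBE mulrBr.
Qed.

Lemma stensQl c f g : stens (inQ c * f) g = inQ c * stens f g.
Proof.
apply/matrixP => s t; case: (mxtens_indexP s) => i k; case: (mxtens_indexP t) => j l.
by rewrite superEndQE !stensE superEndQE mulrCA !mulrA.
Qed.

Lemma stensQr c f g : stens f (inQ c * g) = inQ c * stens f g.
Proof.
apply/matrixP => s t; case: (mxtens_indexP s) => i k; case: (mxtens_indexP t) => j l.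
by rewrite superEndQE !stensE superEndQE mulrCA.
Qed.

End Stens.

Fixpoint tdim (n r : nat) : nat := if r is r'.+1 then (n + n) * tdim n r' else 1.

Fixpoint tpar (n r : nat) : 'I_(tdim n r) -> bool :=
  match r return 'I_(tdim n r) -> bool with
  | 0 => fun _ => false
  | r'.+1 => spar (@vpar n) (@tpar n r')
  end.

Notation tEnd n r := (superEnd (@tpar n r)).

(* The action of gl(n|n) on V^(x)r through x |-> x (x) 1 + 1 (x) x *)
Fixpoint tact (n r : nat) (x : gl n) : tEnd n r :=
  match r return tEnd n r with
  | 0 => 0
  | r'.+1 => stens x (1 : tEnd n r') + stens (1 : gl n) (tact r' x)
  end.

Section TensorAction.
Variables (n : nat).

Lemma tactB r : zmod_morphism (@tact n r).
Proof.
elim: r => [|r IH] x y /=; first by rewrite subrr.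
by rewrite stensBl IH stensBr opprD addrACA.
Qed.
HB.instance Definition _ r :=
  GRing.isZmodMorphism.Build (gl n) (tEnd n r) (@tact n r) (@tactB r).

Lemma tactQ r c x : tact r (inQ c * x) = inQ c * tact r x :> tEnd n r.
Proof.
elim: r => [|r IH] /=; first by rewrite mulr0.
by rewrite IH stensQl stensQr mulrDr.
Qed.

Lemma tact_homog r p (x : gl n) : homog p x -> homog p (tact r x).
Proof.
move=> hx; elim: r => [|r IH] /=; first exact: homog0.
apply: homogD; first by rewrite -[p]addbF; apply: stens_homog (homog1 _).
by rewrite -[p]addFb; apply: stens_homog IH; apply: homog1.
Qed.

Lemma tact_scomm r p q (x y : gl n) : homog p x -> homog q y ->
  tact r (scomm p q x y) = scomm p q (tact r x) (tact r y).
Proof.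
move=> hx hy; elim: r => [|r IH] /=; first by rewrite /scomm !mul0r mulr0 subrr.
have hX := @tact_homog r _ _ hx; have hY := @tact_homog r _ _ hy.
have h1 : homog false (1 : gl n) := homog1 _.
have h1' : homog false (1 : tEnd n r) := homog1 _.
rewrite scommDl !scommDr IH.
rewrite (scomm_mor (F := fun z : gl n => stens z (1 : tEnd n r))); last first.
  by move=> ? ?; apply: stensBl.
rewrite (scomm_mor (F := fun z : tEnd n r => stens (1 : gl n) z)); last first.
  by move=> ? ?; apply: stensBr.
have -> : scomm p q (stens x (1 : tEnd n r)) (stens (1 : gl n) (tact r y)) = 0.
  rewrite /scomm (stensM _ _ h1 h1') (stensM _ _ hx hY) !mulr1 !mul1r.
  by rewrite mulrA -signr_addb andbC addbb !expr0 !mul1r subrr.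
have -> : scomm p q (stens (1 : gl n) (tact r x)) (stens y (1 : tEnd n r)) = 0.
  rewrite /scomm (stensM _ _ h1 h1') (stensM _ _ hy hX) !mulr1 !mul1r.
  by rewrite subrr.
rewrite addr0 add0r; congr (_ + _).
  by rewrite /scomm (stensM _ _ hx h1') (stensM _ _ hy h1') !andFb !expr0 !mul1r.
by rewrite /scomm (stensM _ _ h1 hX) (stensM _ _ h1 hY) !andbF !expr0 !mul1r.
Qed.
End TensorAction.

Section Phi.
Variables (n r : nat).

Definition tq_act : tq n -> tEnd n r :=
  feval (fun b : bool * 'I_n * 'I_n => tact r (qunit b.1.1 b.1.2 b.2)).

Lemma tq_act_hom : superalg_hom tq_act.
Proof. by apply: feval_hom => -[[p i] j]; apply: tact_homog; apply: homog_qunit. Qed.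

Lemma tq_act_inj (x : gl n) : queer x -> tq_act (tq_inj x) = tact r x.
Proof.
move=> qx; rewrite [in RHS](queer_sum qx) /tq_act /tq_inj !raddf_sum.
apply: eq_bigr => p _; rewrite !raddf_sum; apply: eq_bigr => i _.
rewrite !raddf_sum; apply: eq_bigr => j _.
have act_hom := tq_act_hom; rewrite /tq_act in act_hom.
by rewrite /= (superalg_homM act_hom).2 (superalg_homQ act_hom) tactQ feval_gen.
Qed.

Lemma queer_scomm p q (x y : gl n) :
  queer x -> queer y -> queer (scomm p q x y).
Proof.
move=> [A [B ->]] [C [D ->]].
set s : rat := (-1) ^+ (p && q).
exists (A *m C + B *m D - s *: (C *m A + D *m B)),
       (A *m D + B *m C - s *: (C *m B + D *m A)).
have -> : scomm p q (block_mx A B B A : gl n) (block_mx C D D C : gl n) =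
   block_mx A B B A *m block_mx C D D C -
     s *: (block_mx C D D C *m block_mx A B B A) :> 'M_(n + n).
  rewrite /scomm /s; case: (p && q).
    by rewrite !expr1 mulN1r scaleN1r.
  by rewrite !expr0 mul1r scale1r.
rewrite !mulmx_block scale_block_mx opp_block_mx add_block_mx.
by congr block_mx; rewrite addrC ?[B *m D + _]addrC ?[B *m C + _]addrC
  ?[D *m B + _]addrC ?[D *m A + _]addrC addrC.
Qed.

Lemma tq_act_rel (u : tq n) : uq_rel u -> tq_act u = 0.
Proof.
case=> p q x y qx qy hx hy; rewrite (superalg_homB tq_act_hom).
rewrite (superalg_hom_scomm p q _ _ tq_act_hom).
apply/eqP; rewrite subr_eq0; apply/eqP.
apply: (etrans (congr2 (scomm p q) (tq_act_inj qx) (tq_act_inj qy))).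
apply: (etrans (esym (tact_scomm r hx hy))).
exact: esym (tq_act_inj (queer_scomm p q qx qy)).
Qed.

Definition phi : Uq n -> tEnd n r := squot_lift tq_act.

Lemma phi_hom : superalg_hom phi.
Proof. exact: (@squot_lift_hom _ (uq_rels n) _ _ tq_act_hom tq_act_rel). Qed.

Lemma phi_uq_inj (x : gl n) : queer x -> phi (uq_inj x) = tact r x.
Proof.
by move=> qx; rewrite /phi /uq_inj (@squot_liftE _ (uq_rels n) _ _ tq_act_hom tq_act_rel) tq_act_inj.
Qed.

End Phi.

Notation QSchur n r := (simage (phi_hom n r)).

Variant unr_rel (n r : nat) : Uq n -> Prop :=
| UnrSum : unr_rel r ((\sum_i uq_inj (qh false i)) - r%:R)
| UnrProd i : unr_rel r
    (uq_inj (qh true i) * \prod_(1 <= k < r.+1) (uq_inj (qh false i) - k%:R)).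

Lemma unr_rel_homog n r (u : Uq n) : unr_rel r u -> exists p, homog p u.
Proof.
have hqh p i : homog p (uq_inj (qh p i) : Uq n).
  by apply: homog_uq_inj; apply: homog_qunit.
case=> [|i]; [exists false|exists true].
  by apply: homogB (homog_nat _ _); apply: homog_sum => i _; apply: hqh.
rewrite -[true]addbF; apply: homogM; first exact: hqh.
by apply: homog_prod_even => k _; apply: homogB (homog_nat _ _); apply: hqh.
Qed.

Definition unr_rels (n r : nat) : homset (Uq n) := HomSet (@unr_rel_homog n r).
Notation Unr n r := (squot (unr_rels n r)).

(* The presentation by generators and relations: (p, inl i) is h_i,
   (p, inr (inl j)) is e_j and (p, inr (inr j)) is f_j, barred for p = true. *)

Definition qsgen (n : nat) : Type := (bool * ('I_n + ('I_n.-1 + 'I_n.-1)))%type.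
HB.instance Definition _ n := Choice.on (qsgen n).
Definition qspar (n : nat) (x : qsgen n) : bool := x.1.
Notation qsfree n := (fsalg (@qspar n)).

Definition gh (n : nat) (p : bool) (i : 'I_n) : qsfree n := fgen _ (p, inl i).
Definition ge (n : nat) (p : bool) (j : 'I_n.-1) : qsfree n := fgen _ (p, inr (inl j)).
Definition gf (n : nat) (p : bool) (j : 'I_n.-1) : qsfree n := fgen _ (p, inr (inr j)).

Definition qselt (n : nat) (x : qsgen n) : gl n :=
  match x with
  | (p, inl i) => qh p i
  | (p, inr (inl j)) => qe p j
  | (p, inr (inr j)) => qf p j
  end.

Section QS.
Variables (n r : nat).
Local Notation F := (qsfree n).
Local Notation h := (@gh n false).
Local Notation h' := (@gh n true).
Local Notation e := (@ge n false).
Local Notation e' := (@ge n true).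
Local Notation f := (@gf n false).
Local Notation f' := (@gf n true).
Local Notation "[ x , y ]_00" := (scomm false false x y) (format "[ x ,  y ]_00").
Local Notation "[ x , y ]_01" := (scomm false true x y) (format "[ x ,  y ]_01").
Local Notation "[ x , y ]_10" := (scomm true false x y) (format "[ x ,  y ]_10").
Local Notation "[ x , y ]_11" := (scomm true true x y) (format "[ x ,  y ]_11").
Local Notation c i j := (inQ (wform (eps i) (alpha j))).
Local Notation delta i j := ((i == j)%:R).
Implicit Types (i j : 'I_n) (k l : 'I_n.-1).

Variant QS : F -> F -> Prop :=
| QS1_hh i j : QS [h i, h j]_00 0
| QS1_hh' i j : QS [h i, h' j]_01 0
| QS1_h'h' i j : QS [h' i, h' j]_11 (2%:R * (delta i j * h i))
| QS2_he i l : QS [h i, e l]_00 (c i l * e l)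
| QS2_he' i l : QS [h i, e' l]_01 (c i l * e' l)
| QS2_hf i l : QS [h i, f l]_00 (- c i l * f l)
| QS2_hf' i l : QS [h i, f' l]_01 (- c i l * f' l)
| QS3_h'e i l : QS [h' i, e l]_10 (c i l * e' l)
| QS3_h'f i l : QS [h' i, f l]_10 (- c i l * f' l)
| QS3_h'e' i l : QS [h' i, e' l]_11
    (if (i == cur l) || (i == nxt l) then e l else 0)
| QS3_h'f' i l : QS [h' i, f' l]_11
    (if (i == cur l) || (i == nxt l) then f l else 0)
| QS4_ef k l : QS [e k, f l]_00 (delta k l * (h (cur k) - h (nxt k)))
| QS4_e'f' k l : QS [e' k, f' l]_11 (delta k l * (h (cur k) + h (nxt k)))
| QS4_e'f k l : QS [e' k, f l]_10 (delta k l * (h' (cur k) - h' (nxt k)))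
| QS4_ef' k l : QS [e k, f' l]_01 (delta k l * (h' (cur k) - h' (nxt k)))
| QS5_ee' k l : `|k - l|%N != 1%N -> QS [e k, e' l]_01 0
| QS5_e'e' k l : `|k - l|%N != 1%N -> QS [e' k, e' l]_11 0
| QS5_ff' k l : `|k - l|%N != 1%N -> QS [f k, f' l]_01 0
| QS5_f'f' k l : `|k - l|%N != 1%N -> QS [f' k, f' l]_11 0
| QS5_ee k l : (1 < `|k - l|)%N -> QS [e k, e l]_00 0
| QS5_ff k l : (1 < `|k - l|)%N -> QS [f k, f l]_00 0
| QS5_eeS k l : l = k.+1 :> nat -> QS [e k, e l]_00 [e' k, e' l]_11
| QS5_eeS' k l : l = k.+1 :> nat -> QS [e k, e' l]_01 [e' k, e l]_10
| QS5_ffS k l : l = k.+1 :> nat -> QS [f l, f k]_00 [f' l, f' k]_11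
| QS5_ffS' k l : l = k.+1 :> nat -> QS [f l, f' k]_01 [f' l, f k]_10
| QS6_eee k l : `|k - l|%N = 1%N -> QS [e k, [e k, e l]_00]_00 0
| QS6_e'ee k l : `|k - l|%N = 1%N -> QS [e' k, [e k, e l]_00]_10 0
| QS6_fff k l : `|k - l|%N = 1%N -> QS [f k, [f k, f l]_00]_00 0
| QS6_f'ff k l : `|k - l|%N = 1%N -> QS [f' k, [f k, f l]_00]_10 0
| QS7 : QS (\sum_i h i) r%:R
| QS8 i : QS (h' i * \prod_(1 <= m < r.+1) (h i - m%:R)) 0.

Definition qs_rel (u : F) : Prop := exists2 xy, QS xy.1 xy.2 & u = xy.1 - xy.2.

Lemma homog_gh p i : homog p (gh p i). Proof. exact: homog_fgen. Qed.
Lemma homog_ge p k : homog p (ge p k). Proof. exact: homog_fgen. Qed.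
Lemma homog_gf p k : homog p (gf p k). Proof. exact: homog_fgen. Qed.

Ltac qs_homog := repeat match goal with
  | |- homog _ (gh _ _) => apply: homog_gh
  | |- homog _ (ge _ _) => apply: homog_ge
  | |- homog _ (gf _ _) => apply: homog_gf
  | |- homog _ (scomm ?p ?q _ _) => apply: (homog_scomm_eq (p := p) (q := q)); first reflexivity
  | |- homog _ 0 => apply: homog0
  | |- homog _ (inQ _ * _) => apply: homog_inQM
  | |- homog _ (- inQ _ * _) => apply: homog_NinQM
  | |- homog _ (_%:R * _) => apply: homog_natM
  | |- homog _ (if _ then _ else _) => apply: homog_if
  | |- homog _ (_ - _) => apply: homogB
  | |- homog _ (_ + _) => apply: homogD
  end.

Lemma qs_rel_homog (u : F) : qs_rel u -> exists p, homog p u.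
Proof.
move=> [[x y] /= H ->] {u}.
suff [p [hx hy]] : exists p, homog p x /\ homog p y.
  by exists p; apply: homogB.
case: H => *.
all: try (exists false; split; qs_homog; fail).
all: try (exists true; split; qs_homog; fail).
- exists false; split; last exact: homog_nat.
  by apply: homog_sum => i _; apply: homog_gh.
exists true; split; last exact: homog0.
rewrite -[true]addbF; apply: homogM; first exact: homog_gh.
by apply: homog_prod_even => m _; apply: homogB (homog_nat _ _); apply: homog_gh.
Qed.

Definition qs_rels : homset F := HomSet qs_rel_homog.

End QS.

Notation QSpres n r := (squot (qs_rels n r)).

(* Main.v *)
Require Import Defs.
From mathcomp Require Import all_boot all_order all_algebra.
From mathcomp Require Import mxtens boolp zify finmap monalg.
Set Implicit Arguments.
Unset Strict Implicit.
Unset Printing Implicit Defensive.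
Import GRing.Theory.
Local Open Scope ring_scope.

(** Write q(n) for the matrices x with queer x. It is closed under products, so
    V^(x)r carries not only the action [tact] of q(n) but also the action of the
    associative superalgebra q(n)^(x)r, and U(q(n)) acts through the latter:
    phi(x) is the sum of the 1 (x) .. (x) x (x) .. (x) 1. The maps from U(n,r)
    and from the presented algebra to the Schur superalgebra exist because the
    relations hold in End(V^(x)r), and are surjective because q(n) is generated by
    the h_i, h'_i, e_j, f_j (h' for the barred, odd elements). Injectivity is
    proved by constructing a left inverse on q(n)^(x)r.

    Let B be a superalgebra with a bracket-preserving map iota from q(n). Define
    nord on q(n)^(x)k with values in B by nord(1) = 1 and
      nord(x (x) t) = iota(x) nord(t) - nord(tact(x) t).
    When B acts on V^(x)r through phi, nord(x_1 (x) .. (x) x_k) acts as the sum,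
    over k-tuples of pairwise distinct tensor positions, of the operators putting
    x_1, .., x_k there (with the usual signs): it is a normally ordered product.
    No k-tuple of distinct positions exists for k > r, so nord should vanish on
    q(n)^(x)(r+1) in an algebra in which the kernel of phi has been killed.
    Conversely, if it does vanish there ([nord_word0]), the recursion reads
      nord(tact(x) t) = iota(x) nord(t)    for t in q(n)^(x)r,
    so that nord(phi(u) t) = u nord(t) for all u in the algebra generated by q(n).
    With t = 1, where nord(1) = r!, this says that u = nord(phi(u)) / r!, and phi
    is injective ([kernel_sub]).

    Vanishing of nord on the words of length r+1 in the matrix units is where the
    relations enter. First, nord is supersymmetric ([nord_swaps]) and intertwines
    brackets, [iota(x), nord(t)] = nord([tact(x), t]) ([nord_scomm]). For words in
    the diagonal units h_i and h'_i without repeated h'_i, nord is a product of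
    factors h_i - m and of factors h'_i; the relations say that the h_i
    have simultaneous eigenvalues in {0, .., r} of sum r and that h'_i vanishes
    where h_i does, which kills all such words of length r+1 ([nord_diag0]). From
    there the bracket with an off-diagonal unit x produces words containing one
    more off-diagonal unit, and an induction reaches all words ([nord_word0]).

    For U(n,r) the map iota is the given one. For the presented algebra it has to
    be constructed: root vectors are iterated brackets of the simple ones, and the
    Serre-type relations imply that the h'_i, e_j, f_j act on all root vectors as
    in q(n) ([cartan_root], [ad_simple_root]); since these elements generate q(n),
    the Jacobi identity gives all other brackets ([root_rep_queer]). *)

(** * Identities in abelian groups *)

Inductive zexpr := ZAtom of nat | ZZero | ZAdd of zexpr & zexpr | ZOpp of zexpr.

Fixpoint zeval (V : zmodType) (env : nat -> V) t : V :=
  match t with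
  | ZAtom i => env i
  | ZZero => 0
  | ZAdd a b => zeval env a + zeval env b
  | ZOpp a => - zeval env a
  end.

Fixpoint zatoms (b : bool) t : seq nat :=
  match t with
  | ZAtom i => if b then [:: i] else [::]
  | ZZero => [::]
  | ZAdd a c => zatoms b a ++ zatoms b c
  | ZOpp a => zatoms (~~ b) a
  end.

(** Only the multisets of positive and of negative atoms matter, which reduces
    an identity to a boolean test. *)
Lemma zevalE (V : zmodType) (env : nat -> V) t :
  zeval env t = \sum_(i <- zatoms true t) env i - \sum_(i <- zatoms false t) env i.
Proof.
elim: t => [i||a IHa b IHb|a IH] /=; rewrite ?big_seq1 ?big_nil ?subr0 //.
  by rewrite IHa IHb !big_cat /= opprD addrACA.
by rewrite IH opprB.
Qed.

Lemma zeval_eq (V : zmodType) (env : nat -> V) a b :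
  perm_eq (zatoms true a ++ zatoms false b) (zatoms true b ++ zatoms false a) ->
  zeval env a = zeval env b.
Proof.
move=> e; rewrite !zevalE; apply/eqP.
rewrite subr_eq addrAC eq_sym subr_eq eq_sym -!big_cat; apply/eqP.
exact: perm_big.
Qed.

(** Atoms are compared up to conversion: equal products may carry different
    paths through the ring structures. *)
Ltac zmod_index x env :=
  match env with
  | ?y :: _ => let _ := match goal with _ => unify x y end in constr:(0%N)
  | _ :: ?env' => let i := zmod_index x env' in constr:(i.+1)
  end.
Ltac zmod_insert x env :=
  match goal with
  | _ => let _ := zmod_index x env in env
  | _ => constr:(x :: env)
  end.
Ltac zmod_env t env :=
  lazymatch t with
  | (?a + ?b)%R => let env1 := zmod_env a env in zmod_env b env1
  | (- ?a)%R => zmod_env a env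
  | 0%R => env
  | _ => zmod_insert t env
  end.
Ltac zmod_reify t env :=
  lazymatch t with
  | (?a + ?b)%R => let a' := zmod_reify a env in let b' := zmod_reify b env in
      constr:(ZAdd a' b')
  | (- ?a)%R => let a' := zmod_reify a env in constr:(ZOpp a')
  | 0%R => constr:(ZZero)
  | _ => let i := zmod_index t env in constr:(ZAtom i)
  end.
(** Proves equalities of sums of signed atoms. In a noncommutative ring,
    [ring_expand] first turns both sides into sums of signed left-associated
    products, which are then the atoms. *)
Ltac zmod :=
  lazymatch goal with
  | |- @eq ?V ?a ?b =>
    let env := zmod_env a (@nil V) in let env := zmod_env b env in
    let a' := zmod_reify a env in let b' := zmod_reify b env in
    let H := fresh in have H := @zeval_eq _ (nth 0 env) a' b' isT;
    cbv [zeval nth] in H; exact H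
  end.
Ltac ring_expand :=
  rewrite ?(mulrDl, mulrDr, mulNr, mulrN, mulrA, mul1r, mulr1, mul0r, mulr0).

(** * Additive maps, supercommutators and super tensor products *)

Section ZmodMorphism.
Variables (U V : zmodType) (f : U -> V).
Hypothesis fB : zmod_morphism f.
Lemma zmodmor0 : f 0 = 0.
Proof. by rewrite -[0 in LHS](subrr 0) fB subrr. Qed.
Lemma zmodmorN x : f (- x) = - f x.
Proof. by rewrite -[- x]sub0r fB zmodmor0 sub0r. Qed.
Lemma zmodmorD x y : f (x + y) = f x + f y.
Proof. by rewrite -[y in LHS]opprK fB zmodmorN opprK. Qed.
Lemma zmodmor_sum I (s : seq I) P (F : I -> U) :
  f (\sum_(i <- s | P i) F i) = \sum_(i <- s | P i) f (F i).
Proof. by apply: (big_morph f) => [x y|]; [apply: zmodmorD|apply: zmodmor0]. Qed.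
End ZmodMorphism.

Lemma zmodmor_sign (U V : pzRingType) (f : U -> V) (b : bool) x :
  zmod_morphism f -> f ((-1) ^+ b * x) = (-1) ^+ b * f x.
Proof. by move=> fB; rewrite !mulr_sign; case: b => //; rewrite zmodmorN. Qed.

(** The supercommutator with x is a superderivation. The parities p, q, s are
    formal: the identity is one between words in x, y, z. *)
Lemma scomm_mulr (A : superalgType) p q s (x y z : A) :
  scomm p (q (+) s) x (y * z) =
  scomm p q x y * z + (-1) ^+ (p && q) * (y * scomm p s x z).
Proof.
rewrite /scomm !mulr_sign.
case: p q s => [] [] [] /=; ring_expand; zmod.
Qed.

Lemma inQ_comm (A : superalgType) c (x y : A) : x * (inQ c * y) = inQ c * (x * y).
Proof. by rewrite mulrA -inQ_central mulrA. Qed.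

Lemma scommBr (A : superalgType) p q (x y z : A) :
  scomm p q x (y - z) = scomm p q x y - scomm p q x z.
Proof. by rewrite /scomm !mulr_sign; case: (p && q); ring_expand; zmod. Qed.

Lemma scomm0r (A : superalgType) p q (x : A) : scomm p q x 0 = 0.
Proof. by rewrite /scomm mulr0 mul0r mulr0 subrr. Qed.

Lemma scommxx (A : superalgType) (x : A) : scomm false false x x = 0.
Proof. by rewrite /scomm expr0 mul1r subrr. Qed.

Lemma scommQr (A : superalgType) p q c (x y : A) :
  scomm p q x (inQ c * y) = inQ c * scomm p q x y.
Proof. by rewrite /scomm inQ_comm -mulrA !mulr_sign; case: (p && q);
  rewrite ?mulrBr ?mulrN. Qed.

Lemma scommQl (A : superalgType) p q c (x y : A) :
  scomm p q (inQ c * x) y = inQ c * scomm p q x y.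
Proof. by rewrite /scomm inQ_comm -mulrA !mulr_sign; case: (p && q);
  rewrite ?mulrBr ?mulrN. Qed.

Lemma scommBl (A : superalgType) p q (x y z : A) :
  scomm p q (x - y) z = scomm p q x z - scomm p q y z.
Proof. by rewrite /scomm !mulr_sign; case: (p && q); ring_expand; zmod. Qed.

Lemma superalg_char0 (B : superalgType) m (x : B) : m.+1%:R * x = 0 -> x = 0.
Proof.
move=> h; have : inQ (m.+1%:R^-1) * (m.+1%:R * x) = 0 by rewrite h mulr0.
have -> : m.+1%:R = inQ m.+1%:R :> B by rewrite rmorph_nat.
rewrite mulrA -rmorphM mulVf ?rmorph1 ?mul1r //.
by rewrite Num.Theory.pnatr_eq0.
Qed.

Lemma superalg_no2tors (A : superalgType) (x : A) : x = - x -> x = 0.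
Proof.
move=> e; apply: (@superalg_char0 A 1); rewrite mulr_natl mulr2n.
by rewrite {1}e addNr.
Qed.

Lemma queerM n (x y : gl n) : queer x -> queer y -> queer (x * y).
Proof.
move=> [A [B ->]] [C [D ->]]; exists (A *m C + B *m D), (A *m D + B *m C).
rewrite -[_ * _]/(block_mx A B B A *m block_mx C D D C) mulmx_block.
by rewrite [B *m C + _]addrC [B *m D + _]addrC.
Qed.

Section StensLinear.
Variables (M N : nat) (a : 'I_M -> bool) (b : 'I_N -> bool).
Implicit Types (f : superEnd a) (g : superEnd b).
Lemma stens_zmodl g : zmod_morphism (fun f : superEnd a => stens f g).
Proof. by move=> f f'; apply: stensBl. Qed.
Lemma stens_zmodr f : zmod_morphism (fun g : superEnd b => stens f g).
Proof. by move=> g g'; apply: stensBr. Qed.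
Lemma stensDr f g g' : stens f (g + g') = stens f g + stens f g'.
Proof. exact: (zmodmorD (stens_zmodr f)). Qed.
Lemma stens_signr (e : bool) f g : stens f ((-1) ^+ e * g) = (-1) ^+ e * stens f g.
Proof. exact: (zmodmor_sign _ _ (stens_zmodr f)). Qed.
Lemma stens_signl (e : bool) f g : stens ((-1) ^+ e * f) g = (-1) ^+ e * stens f g.
Proof. exact: (zmodmor_sign _ _ (stens_zmodl g)). Qed.
End StensLinear.

(** Left multiplication by tact(x) is a superderivation of the tensor powers
    extending left multiplication by x on the first one. *)
Lemma tact_stens n k p q (x y : gl n) (t : tEnd n k) :
  homog p x -> homog q y ->
  tact k.+1 x * stens y t
    = stens (x * y) t + (-1) ^+ (p && q) * stens y (tact k x * t).
Proof.
move=> hx hy /=; rewrite mulrDl.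
rewrite (stensM (p := q) (q := false)) ?andbF ?expr0 ?mul1r //; last exact: homog1.
by rewrite (stensM (p := q) (q := p)) ?mul1r //; apply: tact_homog.
Qed.

(** * Normally ordered products *)

(** Morphisms of Lie superalgebras from q(n) to B. Only the restriction of
    iota to the queer matrices is constrained by the bracket; a map on all of
    gl(n|n) avoids a subtype. *)
Record queer_rep n (B : superalgType) (iota : gl n -> B) : Prop := QueerRep {
  queer_repB : zmod_morphism iota;
  queer_repQ : forall c x, iota (inQ c * x) = inQ c * iota x;
  queer_repL : forall p q x y, queer x -> queer y -> homog p x -> homog q y ->
    iota (scomm p q x y) = scomm p q (iota x) (iota y)
}.

Section Nord.
Variables (n : nat) (B : superalgType) (iota : gl n -> B).
Hypothesis rep : queer_rep iota.
Let iotaB := queer_repB rep.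
Let iotaQ := queer_repQ rep.
Let iotaL := queer_repL rep.

(** The coefficient of qunit p i j in the first tensor factor: for M in q(n)
    (x) End, M is the sum of the qunit p i j (x) slice p i j M. A queer matrix
    is determined by its top rows, hence the choice of the rows pos i. *)
Definition slice k (p : bool) (i j : 'I_n) (M : tEnd n k.+1) : tEnd n k :=
  \matrix_(s, t) ((-1) ^+ ((tpar s (+) tpar t) && p) *
    (M : 'M_((n + n) * tdim n k)) (mxtens_index (pos i, s))
      (mxtens_index (if p then neg j else pos j, t))).

Lemma slice_stens k p i j (x : gl n) (t : tEnd n k) :
  slice p i j (stens x t) = inQ (qcoef p i j x) * t.
Proof.
apply/matrixP => u v; rewrite mxE superEndQE stensE mulrA mulrA -signr_addb.
have -> : vpar (if p then neg j else pos j) = p.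
  by case: p; rewrite ?vpar_pos ?vpar_neg.
by rewrite addbb expr0 mul1r.
Qed.

Lemma sliceB k p i j : zmod_morphism (@slice k p i j).
Proof. by move=> M N; apply/matrixP => u v; rewrite !mxE mulrBr. Qed.

(** Summing over the slices extends the recursion for nord linearly to all
    matrices; the recursion itself is [nord_stens]. *)
Fixpoint nord k : tEnd n k -> B :=
  match k return tEnd n k -> B with
  | 0 => fun M => inQ ((M : 'M_1) 0 0)
  | k'.+1 => fun M => \sum_p \sum_i \sum_j
      (iota (qunit p i j) * nord (slice p i j M)
       - nord (tact k' (qunit p i j) * slice p i j M))
  end.

Lemma nordB k : zmod_morphism (@nord k).
Proof.
elim: k => [|k IH] M N /=; first by rewrite !mxE rmorphB.
rewrite -sumrB; apply: eq_bigr => p _; rewrite -sumrB; apply: eq_bigr => i _.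
rewrite -sumrB; apply: eq_bigr => j _.
by rewrite sliceB mulrBr !IH; ring_expand; zmod.
Qed.

Lemma nordQ k c (M : tEnd n k) : nord (inQ c * M) = inQ c * nord M.
Proof.
elim: k M => [|k IH] M /=.
  by rewrite -rmorphM; congr inQ; apply: (superEndQE (par := @tpar n 0)).
rewrite mulr_sumr; apply: eq_bigr => p _; rewrite mulr_sumr; apply: eq_bigr => i _.
rewrite mulr_sumr; apply: eq_bigr => j _.
have -> : slice p i j (inQ c * M) = inQ c * slice p i j M.
  by apply/matrixP => u v; rewrite [RHS]superEndQE [LHS]mxE [X in _ = _ * X]mxE mulrCA;
    congr (_ * _);
    apply: (superEndQE (par := @tpar n k.+1)).
by rewrite inQ_comm !IH inQ_comm mulrBr.
Qed.

Lemma nord_stens k (x : gl n) (t : tEnd n k) : queer x ->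
  nord (stens x t : tEnd n k.+1) = iota x * nord t - nord (tact k x * t).
Proof.
move=> qx; rewrite [x in RHS](queer_sum qx) (zmodmor_sum iotaB).
rewrite raddf_sum !mulr_suml /= (zmodmor_sum (@nordB k)) -sumrB.
apply: eq_bigr => p _; rewrite (zmodmor_sum iotaB).
rewrite raddf_sum !mulr_suml /= (zmodmor_sum (@nordB k)) -sumrB.
apply: eq_bigr => i _; rewrite (zmodmor_sum iotaB).
rewrite raddf_sum !mulr_suml /= (zmodmor_sum (@nordB k)) -sumrB.
apply: eq_bigr => j _; rewrite slice_stens iotaQ tactQ -!mulrA.
by rewrite inQ_comm !nordQ inQ_comm.
Qed.

(** Expanding both sides twice, the terms with a product in q(n) assemble into
    iota([x, y]) - [iota(x), iota(y)] and into the same expression for tact,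
    which are zero. *)
Lemma nord_swap k p q (x y : gl n) (t : tEnd n k) :
  queer x -> queer y -> homog p x -> homog q y ->
  nord (stens x (stens y t : tEnd n k.+1) : tEnd n k.+2) =
  (-1) ^+ (p && q) * nord (stens y (stens x t : tEnd n k.+1) : tEnd n k.+2).
Proof.
move=> qx qy hx hy.
have nN := @nordB k; have nN1 := @nordB k.+1.
rewrite !nord_stens // (tact_stens _ hx hy) (tact_stens _ hy hx).
rewrite !(zmodmorD nN1) !(zmodmor_sign _ _ nN1).
rewrite !nord_stens //; try by apply: queerM.
have := iotaL qx qy hx hy; have := tact_scomm k hx hy.
rewrite /scomm iotaB tactB (zmodmor_sign _ _ iotaB) (zmodmor_sign _ _ (@tactB n k)).
rewrite [q && p]andbC !mulr_sign => e1 e2.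
have {}e2 : iota (x * y) = iota x * iota y
   - (if p && q then - (iota y * iota x) else iota y * iota x)
   + (if p && q then - iota (y * x) else iota (y * x)).
  by rewrite -e2; zmod.
have {}e1 : tact k (x * y) = tact k x * tact k y
   - (if p && q then - (tact k y * tact k x) else tact k y * tact k x)
   + (if p && q then - tact k (y * x) else tact k (y * x)).
  by rewrite -e1; case: (p && q) => /=; zmod.
rewrite e1 e2 {e1 e2}; case: (p && q); ring_expand;
 rewrite ?(zmodmorD nN, zmodmorN nN); zmod.
Qed.

(** * Supersymmetry *)

(** The span of the differences of tensors that supersymmetry identifies.
    Working with this subspace, rather than with the relation nord u = nord v,
    allows congruence under x (x) -. *)
Inductive swaps : forall k, tEnd n k -> Prop :=
| swaps0 k : @swaps k 0
| swaps_swap k p q (x y : gl n) (t : tEnd n k) :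
    queer x -> queer y -> homog p x -> homog q y ->
    @swaps k.+2 (stens x (stens y t : tEnd n k.+1) -
            (-1) ^+ (p && q) * stens y (stens x t : tEnd n k.+1))
| swaps_stens k p (x : gl n) (t : tEnd n k) : queer x -> homog p x ->
   swaps t -> @swaps k.+1 (stens x t)
| swapsB k (u v : tEnd n k) : swaps u -> swaps v -> swaps (u - v).

Lemma swapsN k (u : tEnd n k) : swaps u -> swaps (- u).
Proof. by rewrite -[- u]sub0r; apply: swapsB; apply: swaps0. Qed.
Lemma swapsD k (u v : tEnd n k) : swaps u -> swaps v -> swaps (u + v).
Proof. by move=> hu hv; rewrite -[v]opprK; apply: swapsB => //; apply: swapsN. Qed.
Lemma swaps_sign k (b : bool) (u : tEnd n k) : swaps u -> swaps ((-1) ^+ b * u).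
Proof. by rewrite mulr_sign; case: b => //; apply: swapsN. Qed.

Lemma swaps_tact k p (z : gl n) (u : tEnd n k) : queer z -> homog p z ->
  swaps u -> swaps (tact k z * u).
Proof.
move=> qz hz; elim=> {k u}
  [k|k q s x y t qx qy hx hy|k q x t qx hx ht IH|k u v _ hu _ hv].
- by rewrite mulr0; apply: swaps0.
- have -> : tact k.+2 z * (stens x (stens y t : tEnd n k.+1) -
               (-1) ^+ (q && s) * stens y (stens x t : tEnd n k.+1)) =
     (stens (z * x) (stens y t : tEnd n k.+1) -
               (-1) ^+ ((p (+) q) && s) * stens y (stens (z * x) t : tEnd n k.+1))
     + (-1) ^+ (p && q) * (stens x (stens (z * y) t : tEnd n k.+1) -
               (-1) ^+ (q && (p (+) s)) * stens (z * y) (stens x t : tEnd n k.+1))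
     + (-1) ^+ ((p && q) (+) (p && s)) * (stens x (stens y (tact k z * t) : tEnd n k.+1) -
               (-1) ^+ (q && s) * stens y (stens x (tact k z * t) : tEnd n k.+1)).
    rewrite mulrBr mulr_sign (fun_if (fun w => tact _ _ * w)) mulrN -mulr_sign.
    rewrite (tact_stens _ hz hx) (tact_stens _ hz hy).
    rewrite (tact_stens _ hz hy) (tact_stens _ hz hx) !stensDr !stens_signr !mulr_sign.
    by case: p q s {hz hx hy} => [] [] [] /=; zmod.
  apply: swapsD; last by apply/swaps_sign/swaps_swap.
  apply: swapsD; last apply/swaps_sign.
    apply: swaps_swap => //; first exact: queerM.
    exact: homogM.
  by apply: swaps_swap => //; [apply: queerM|apply: homogM].
- rewrite (tact_stens _ hz hx); apply: swapsD.
    by apply: (swaps_stens (p := p (+) q)) => //; [apply: queerM|apply: homogM].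
  by apply/swaps_sign/(swaps_stens qx hx).
by rewrite mulrBr; apply: swapsB.
Qed.

(** The recursion of nord on x (x) t leads to tact(x) t, which is again in the
    span but not a smaller derivation: hence the outer induction on the tensor
    degree. *)
Lemma nord_swaps k (u : tEnd n k) : swaps u -> nord u = 0.
Proof.
suff H m : forall k (u : tEnd n k), (k <= m)%N -> swaps u -> nord u = 0.
  exact: (H k k u).
elim: m {k u} => [|m IHm] k u lekm su.
  elim: k u / su lekm => [k _|k|k|k u v _ hu _ hv lek] //.
    exact: zmodmor0 (@nordB k).
  by rewrite nordB hu // hv // subr0.
elim: k u / su lekm =>
  [k _|k q s x y t qx qy hx hy _|k q x t qx hx ht IH lekm|k u v _ hu _ hv lekm].
- exact: zmodmor0 (@nordB k).
- by rewrite nordB (zmodmor_sign _ _ (@nordB _)) (nord_swap _ qx qy hx hy) subrr.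
- rewrite nord_stens // IH ?(ltnW lekm) // mulr0 sub0r IHm ?oppr0 //.
  exact: swaps_tact qx hx ht.
by rewrite nordB hu // hv // subr0.
Qed.

End Nord.

(** * Compatibility with brackets *)

Section QueerTensors.
Variable n : nat.

(** The part of parity q of q(n) (x) W, where P gives the homogeneous elements
    of W. *)
Inductive qspan k (P : bool -> tEnd n k -> Prop) : bool -> tEnd n k.+1 -> Prop :=
| qspan0 q : qspan P q 0
| qspan_cons p q (x : gl n) (u : tEnd n k) (v : tEnd n k.+1) :
    queer x -> homog p x -> P q u -> qspan P (p (+) q) v ->
    qspan P (p (+) q) (stens x u + v).

(** The homogeneous elements of q(n)^(x)k. *)
Fixpoint qtens k : bool -> tEnd n k -> Prop :=
  match k with
  | 0 => fun q u => homog q u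
  | k'.+1 => qspan (@qtens k')
  end.

Lemma qtens0 k q : @qtens k q 0.
Proof. by case: k => [|k] /=; [apply: homog0|apply: qspan0]. Qed.

Lemma qtensD k q (u v : tEnd n k) : qtens q u -> qtens q v -> qtens q (u + v).
Proof.
case: k u v => [|k] u v /=; first exact: homogD.
elim=> {q u} [q|p q x u w qx hx hu _ IH] hv; first by rewrite add0r.
by rewrite -addrA; apply: qspan_cons => //; apply: IH.
Qed.

Lemma qtens_stens k p q (x : gl n) (u : tEnd n k) : queer x -> homog p x ->
  qtens q u -> @qtens k.+1 (p (+) q) (stens x u).
Proof.
by move=> qx hx hu; rewrite -[stens x u]addr0; apply: qspan_cons => //; apply: qspan0.
Qed.

Lemma queerN (x : gl n) : queer x -> queer (- x).
Proof. by move=> [A [B' ->]]; exists (- A), (- B'); rewrite -opp_block_mx. Qed.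

Lemma qtensN k q (u : tEnd n k) : qtens q u -> qtens q (- u).
Proof.
case: k u => [|k] u /=; first exact: homogN.
elim=> {q u} [q|p q x u w qx hx hu _ IH]; first by rewrite oppr0; apply: qspan0.
rewrite opprD -(zmodmorN (stens_zmodl u)); apply: qspan_cons => //.
  exact: queerN.
exact: homogN.
Qed.

Lemma qtens_sign k q (b : bool) (u : tEnd n k) : qtens q u -> qtens q ((-1) ^+ b * u).
Proof. by rewrite mulr_sign; case: b => //; apply: qtensN. Qed.

Lemma qtens_homog k q (u : tEnd n k) : qtens q u -> homog q u.
Proof.
elim: k q u => [//|k IH] q u /=.
elim=> {q u} [q|p q x u w qx hx hu _ hw]; first exact: homog0.
by apply: homogD => //; apply: stens_homog => //; apply: IH.
Qed.

Lemma qtens_tact k p q (z : gl n) (u : tEnd n k) : queer z -> homog p z ->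
  qtens q u -> qtens (p (+) q) (tact k z * u).
Proof.
move=> qz hz; elim: k q u => [|k IH] q u.
  by rewrite mul0r => _; apply: homog0.
elim=> {q u} [q|p' q x u w qx hx hu _ IHw]; first by rewrite mulr0; apply: qspan0.
rewrite mulrDr (tact_stens _ hz hx); apply: qtensD => //; apply: qtensD.
  by rewrite addbA; apply: qtens_stens => //; [apply: queerM|apply: homogM].
by apply: qtens_sign; rewrite addbCA; apply: qtens_stens => //; apply: IH.
Qed.

Lemma tact_scomm_stens k p q s (x y : gl n) (u : tEnd n k) :
  homog p x -> homog q y -> homog s u ->
  scomm p (q (+) s) (tact k.+1 x) (stens y u)
   = stens (scomm p q x y) u + (-1) ^+ (p && q) * stens y (scomm p s (tact k x) u).
Proof.
move=> hx hy hu; rewrite {1}/scomm (tact_stens _ hx hy) /= mulrDr.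
rewrite (stensM _ _ hx hu) (stensM _ _ (homog1 _) hu) ?andbF ?mulr1.
rewrite /scomm stensBl stensBr stens_signl stens_signr !mulr_sign.
by case: p q s {hx hy hu} => [] [] [] /=; rewrite ?mulr1; zmod.
Qed.

End QueerTensors.

Section NordScomm.
Variables (n : nat) (B : superalgType) (iota : gl n -> B).
Hypothesis rep : queer_rep iota.

(** By induction on k: both sides are derivations in u, and left
    multiplication by tact(y) obeys the Leibniz rule for the bracket with
    tact(x). *)
Lemma nord_scomm k p q (x : gl n) (u : tEnd n k) : queer x -> homog p x ->
  qtens q u -> scomm p q (iota x) (nord iota u) = nord iota (scomm p q (tact k x) u).
Proof.
move=> qx hx; elim: k q u => [|k IH] q u.
  rewrite /scomm mul0r mulr0 mulr0 subrr (zmodmor0 (@nordB n B iota 0)) /= => hu.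
  case: q hu => hu; last by rewrite andbF expr0 mul1r inQ_central subrr.
  have -> : (u : 'M_1) 0 0 = 0.
    by apply/eqP/negPn/negP => /hu.
  by rewrite rmorph0 mulr0 mul0r mulr0 subrr.
elim=> {q u} [q|p' q y u w qy hy hu _ IHw].
  by rewrite scomm0r (zmodmor0 (@nordB n B iota _)) scomm0r.
have hhu := qtens_homog hu; have nB := @nordB n B iota k.
rewrite (zmodmorD (@nordB n B iota _)) scommDr IHw [in RHS]scommDr.
rewrite [in RHS](zmodmorD (@nordB n B iota k.+1)); congr (_ + _).
rewrite (tact_scomm_stens hx hy hhu) (zmodmorD (@nordB n B iota k.+1)).
rewrite (zmodmor_sign _ _ (@nordB n B iota k.+1)) !(nord_stens rep) //;
  last exact: queer_scomm.
have E : nord iota (scomm p (p' (+) q) (tact k x) (tact k y * u)) =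
    nord iota (scomm p p' (tact k x) (tact k y) * u)
    + (-1) ^+ (p && p') * nord iota (tact k y * scomm p q (tact k x) u).
  rewrite scomm_mulr; set U := (_ * u); set W := (_ * scomm _ _ _ _).
  by rewrite (zmodmorD nB U) (zmodmor_sign _ _ nB).
rewrite scommBr scomm_mulr (IH _ _ hu) (IH _ _ (qtens_tact qy hy hu)) {}E.
rewrite (queer_repL rep) // (tact_scomm _ hx hy).
by rewrite !mulr_sign; case: (p && p'); ring_expand; zmod.
Qed.

End NordScomm.

(** * Words in the matrix units *)

Notation letter n := (bool * 'I_n * 'I_n)%type.

Section Words.
Variable n : nat.
Implicit Types (x y : letter n) (s : seq (letter n)).
Local Notation lpar := (@qbpar n).

Definition letter_unit x : gl n := qunit x.1.1 x.1.2 x.2.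
Lemma queer_letter_unit x : queer (letter_unit x). Proof. exact: queer_qunit. Qed.
Lemma homog_letter_unit x : homog (lpar x) (letter_unit x). Proof. exact: homog_qunit.
  Qed.
Hint Resolve queer_letter_unit homog_letter_unit : core.

Definition wordpar s : bool := odd (count lpar s).
Lemma wordpar_cons x s : wordpar (x :: s) = lpar x (+) wordpar s.
Proof. by rewrite /wordpar /= oddD oddb. Qed.
Lemma wordpar_cat s1 s2 : wordpar (s1 ++ s2) = wordpar s1 (+) wordpar s2.
Proof. by rewrite /wordpar count_cat oddD. Qed.

(** Meaningful when k is the length of s. *)
Fixpoint word_tensor k s : tEnd n k :=
  match k return tEnd n k with
  | 0 => 1
  | k'.+1 => if s is x :: s' then stens (letter_unit x) (word_tensor k' s') else 0
  end.

Lemma qtens_word k s : size s = k -> qtens (wordpar s) (word_tensor k s).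
Proof.
elim: s k => [|x s IH] [|k] //= [es].
rewrite wordpar_cons; apply: qtens_stens => //; exact: IH.
Qed.

(** The sign is the one of moving x past s1. *)
Lemma swaps_move k s1 x s2 : size (s1 ++ x :: s2) = k ->
  swaps (word_tensor k (s1 ++ x :: s2) -
         (-1) ^+ (lpar x && wordpar s1) * word_tensor k (x :: s1 ++ s2)).
Proof.
elim: s1 k => [|y s1 IH] [|k] //=.
  by rewrite andbF expr0 mul1r subrr => _; apply: swaps0.
case=> es; have := IH _ es; case: k es => [|k]; first by rewrite size_cat addnS.
move=> es /(swaps_stens (queer_letter_unit y) (@homog_letter_unit y)).
rewrite stensBr stens_signr /= => /swapsD h.
have := h _ (swaps_sign (lpar x && wordpar s1) (swaps_swap (word_tensor k (s1 ++ s2))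
   (queer_letter_unit y) (queer_letter_unit x) (@homog_letter_unit y) (@homog_letter_unit
     x))).
rewrite wordpar_cons; congr swaps; rewrite !mulr_sign.
by case: (lpar x) (lpar y) (wordpar s1) => [] [] [] /=; zmod.
Qed.

Lemma swaps_perm k s s' : perm_eq s s' -> size s = k ->
  exists b : bool, swaps (word_tensor k s - (-1) ^+ b * word_tensor k s').
Proof.
elim: s s' k => [|x s IH] s' k.
  rewrite perm_sym => /perm_nilP -> _; exists false.
  by rewrite expr0 mul1r subrr; apply: swaps0.
move=> e; have xs' : x \in s' by rewrite -(perm_mem e) mem_head.
case/splitPr: xs' e => s1 s2; rewrite perm_sym -[x :: s2]cat1s perm_catCA /= perm_cons
  perm_sym => e es.
case: k es => [//|k] [es]; have [b hb] := IH _ _ e es.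
have e2 : size (s1 ++ x :: s2) = k.+1.
  by rewrite size_cat addnS -size_cat -(perm_size e) es.
have hm := swaps_move e2.
have hs := swaps_stens (queer_letter_unit x) (@homog_letter_unit x) hb.
exists (b (+) (lpar x && wordpar s1)).
have := swapsB hs (swaps_sign (b (+) (lpar x && wordpar s1)) hm).
rewrite stensBr stens_signr; congr swaps; rewrite !mulr_sign /=.
by case: b {hb hs} (lpar x && _) => [] [] /=; zmod.
Qed.

(** The bracket of x with the word pre ++ s, expanded over the letters of s
    only, each new factor [x, y] being moved to the front. The sign of that
    move is the one of y itself: the sign of passing x over pre cancels the
    contribution of x to the parity of [x, y]. *)
Fixpoint ad_expansion k p (x : gl n) pre s : tEnd n k.+1 :=
  if s is y :: s' then
    (-1) ^+ (lpar y && wordpar pre) *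
      stens (scomm p (lpar y) x (letter_unit y)) (word_tensor k (pre ++ s'))
    + ad_expansion k p x (rcons pre y) s'
  else 0.

Lemma stens_ad_expansion k p (x : gl n) y pre s : queer x -> homog p x ->
  @swaps n k.+2 ((-1) ^+ (p && lpar y) * stens (letter_unit y) (ad_expansion k p x pre s)
         - ad_expansion k.+1 p x (y :: pre) s).
Proof.
move=> qx hx; elim: s pre => [|z s IH] pre /=.
  by rewrite (zmodmor0 (stens_zmodr _)) mulr0 subrr; apply: swaps0.
have := swapsD (swaps_sign ((p && lpar y) (+) (lpar z && wordpar pre))
  (swaps_swap (word_tensor k (pre ++ s)) (queer_letter_unit y)
  (queer_scomm p (lpar z) qx (queer_letter_unit z)) (@homog_letter_unit y)
  (homog_scomm hx (@homog_letter_unit z)))) (IH (rcons pre z)).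
rewrite stensDr stens_signr wordpar_cons /=; congr swaps; rewrite !mulr_sign.
by case: p (lpar y) (lpar z) (wordpar pre) {hx IH} => [] [] [] [] /=; ring_expand; zmod.
Qed.

(** The first letter y of the word contributes the first term; the expansion
    of the rest is multiplied by y on the left, and [stens_ad_expansion] moves
    the new factors past y. *)
Lemma swaps_ad_expansion k p (x : gl n) s : queer x -> homog p x -> size s = k.+1 ->
  swaps (scomm p (wordpar s) (tact k.+1 x) (word_tensor k.+1 s) - ad_expansion k p x [::]
    s).
Proof.
move=> qx hx; elim: k s => [|k IH] [|y s] // [es]; rewrite wordpar_cons.
  case: s es => // _; rewrite (tact_scomm_stens hx (@homog_letter_unit y) (homog1 _)).
  rewrite [X in stens (letter_unit y) X](_ : _ = 0); last first.
    by rewrite /scomm mul0r mulr0 mulr0 subrr.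
  rewrite (zmodmor0 (stens_zmodr _)) mulr0 /= andbF expr0 mul1r subrr.
  exact: swaps0.
have hw := qtens_homog (qtens_word es).
rewrite [word_tensor _ _]/= (tact_scomm_stens hx (@homog_letter_unit y) hw).
have := swapsD (swaps_sign (p && lpar y) (swaps_stens (queer_letter_unit y)
  (@homog_letter_unit y) (IH _ es)))
  (stens_ad_expansion k y [::] s qx hx).
rewrite stensBr /= andbF expr0 mul1r; congr swaps; rewrite !mulr_sign.
by case: (p && _); zmod.
Qed.

End Words.

Lemma nord_ad n (B : superalgType) (iota : gl n -> B) k p (x : gl n) s :
  queer_rep iota -> queer x -> homog p x -> size s = k.+1 ->
  scomm p (wordpar s) (iota x) (nord iota (word_tensor k.+1 s)) =
  nord iota (ad_expansion k p x [::] s).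
Proof.
move=> rep qx hx es; rewrite (nord_scomm rep qx hx (qtens_word es)).
apply/eqP; rewrite -subr_eq0 -nordB; apply/eqP/(nord_swaps rep).
exact: swaps_ad_expansion.
Qed.

Lemma nord_perm0 n (B : superalgType) (iota : gl n -> B) k (s s' : seq (letter n)) :
  queer_rep iota -> perm_eq s s' -> size s = k ->
  nord iota (word_tensor k s) = 0 -> nord iota (word_tensor k s') = 0.
Proof.
move=> rep e es h0; have [b /(nord_swaps rep)] := swaps_perm e es.
rewrite nordB h0 sub0r (zmodmor_sign _ _ (@nordB n B iota k)) mulr_sign.
by case: b => /eqP; rewrite ?opprK ?oppr_eq0 => /eqP.
Qed.

(** * Diagonal words of length r + 1 *)

Lemma qunitM n p q (i j k l : 'I_n) :
  qunit p i j * qunit q k l = if j == k then qunit (p (+) q) i l else 0.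
Proof.
have Epp (a b : 'I_n) : (pos a == pos b) = (a == b) by apply: inj_eq; apply: lshift_inj.
have Enn (a b : 'I_n) : (neg a == neg b) = (a == b) by apply: inj_eq; apply: rshift_inj.
have Epn (a b : 'I_n) : (pos a == neg b) = false by apply: eq_lrshift.
have Enp (a b : 'I_n) : (neg a == pos b) = false by apply: eq_rlshift.
have M (a b c d : 'I_(n + n)) : glE a b * glE c d = if b == c then glE a d else 0.
  by rewrite -[_ * _]/(delta_mx a b *m delta_mx c d) mul_delta_mx_cond; case: (b == c).
rewrite /qunit; case: p q => [] [] /=; rewrite !mulrDl !mulrDr !M ?(Epp, Enn, Epn, Enp);
  by case: (j == k); rewrite ?(addr0, add0r) // addrC.
Qed.

Lemma scomm_qunit n p q (i j k l : 'I_n) :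
  scomm p q (qunit p i j) (qunit q k l) =
  (if j == k then qunit (p (+) q) i l else 0)
  - (-1) ^+ (p && q) * (if l == i then qunit (p (+) q) k j else 0).
Proof. by rewrite /scomm !qunitM [q (+) p]addbC. Qed.

Lemma perm_extract (T : eqType) (y : T) s :
  perm_eq s (nseq (count_mem y s) y ++ filter (predC1 y) s).
Proof.
have e : filter (pred1 y) s = nseq (count_mem y s) y.
  by elim: s => //= x s IH; case: eqP => [->|_] /=; rewrite IH.
by rewrite -e perm_sym; apply/permPl/perm_filterC.
Qed.

(** If c i <= r then the same hypotheses hold for (H i - c i) y with c i
    increased by one; once this element is known to be zero, y is an
    eigenvector of H i of eigenvalue c i. Thus either some c i exceeds r, and
    the empty product gives y = 0, or comparing the eigenvalue of the sum of
    the H i with r does. *)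
Lemma joint_eigenvector0 (B : superalgType) n r (H : 'I_n -> B) (c : 'I_n -> nat) y :
  (forall i j, GRing.comm (H i) (H j)) -> \sum_i H i = r%:R ->
  (r < \sum_i c i)%N ->
  (forall i, \prod_(c i <= m < r.+1) (H i - m%:R) * y = 0) -> y = 0.
Proof.
move=> Hc Hsum; have [d] := ubnP (\sum_i (r.+1 - c i))%N.
elim: d c y => // d IH c y led ltr h.
have eig i : (c i <= r)%N -> H i * y = (c i)%:R * y.
  move=> lei; apply/eqP; rewrite -subr_eq0 -mulrBl; apply/eqP.
  apply: (IH (fun j => c j + (j == i))%N).
  - rewrite ltnS in led; apply: leq_trans led.
    rewrite (bigD1 i) //= [X in (_ < X)%N](bigD1 i) //= eqxx.
    rewrite -addSn leq_add //; first by lia.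
    by apply: leq_sum => j /negPf ->; rewrite addn0.
  - by apply: leq_trans ltr _; apply: leq_sum => j _; apply: leq_addr.
  move=> j; have comm_prod m1 m2 : GRing.comm (H i - (c i)%:R)
       (\prod_(m1 <= m < m2) (H j - m%:R)).
    apply: commr_prod => m _; apply: commrB; last exact: commr_nat.
    by apply/commr_sym/commrB; [apply: Hc|apply: commr_nat].
  rewrite mulrA -comm_prod; have [->|nij] := eqVneq j i.
    by rewrite addn1 -big_ltn.
  by rewrite addn0 -mulrA h mulr0.
have [/existsP [i lti]|] := boolP [exists i, (r < c i)%N].
  by have := h i; rewrite big_geq ?mul1r.
rewrite negb_exists => /forallP h'.
have : r%:R * y = (\sum_i c i)%N%:R * y.
  rewrite -Hsum natr_sum !mulr_suml; apply: eq_bigr => i _; apply: eig.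
  by rewrite leqNgt; apply: h'.
move/eqP; rewrite eq_sym -subr_eq0 -mulrBl -natrB ?(ltnW ltr) //.
by case: (_ - _)%N (subn_gt0 r (\sum_i c i)%N) => [|m _ /eqP/superalg_char0 //];
  rewrite ltr.
Qed.

Section Vanishing.
Variables (n r : nat) (B : superalgType) (iota : gl n -> B).
Hypothesis rep : queer_rep iota.
Local Notation nord := (nord iota).
Local Notation H i := (iota (qh false i)).
Local Notation H' i := (iota (qh true i)).
Hypothesis sumH : \sum_i H i = r%:R.
Hypothesis prodH : forall i, H' i * \prod_(1 <= m < r.+1) (H i - m%:R) = 0.
Implicit Types (s : seq (letter n)) (x y : letter n).

Lemma qh_comm p i j : GRing.comm (H i) (iota (qh p j)).
Proof.
have := queer_repL rep (queer_qunit false i i) (queer_qunit p j j)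
  (@homog_qunit n false i i) (@homog_qunit n p j j).
rewrite scomm_qunit expr0 mul1r [j == i]eq_sym; have [->|_] := eqVneq i j.
  by rewrite subrr (zmodmor0 (queer_repB rep)) /scomm expr0 mul1r => /esym/eqP;
    rewrite subr_eq0 => /eqP.
by rewrite subrr (zmodmor0 (queer_repB rep)) /scomm expr0 mul1r => /esym/eqP;
    rewrite subr_eq0 => /eqP.
Qed.

Lemma qh_odd_sq i : H' i * H' i = H i.
Proof.
have := queer_repL rep (queer_qunit true i i) (queer_qunit true i i)
  (@homog_qunit n true i i) (@homog_qunit n true i i).
rewrite scomm_qunit eqxx /scomm expr1 !mulN1r !opprK (zmodmorD (queer_repB rep)).
move=> e; apply/eqP; rewrite -subr_eq0; apply/eqP/(@superalg_char0 _ 1).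
by rewrite mulrBr !mulr_natl !mulr2n -e subrr.
Qed.

Definition diagonal x := x.1.2 == x.2.
Definition at_index i x := x.1.2 == i.

Lemma nord_nat k m (u : tEnd n k) : nord (m%:R * u) = m%:R * nord u.
Proof.
by rewrite -[m%:R in LHS](rmorph_nat (@inQ _)) nordQ // rmorph_nat.
Qed.

(** The unit E_ii acts on a diagonal letter as the identity or as zero,
    according to its index. *)
Lemma tact_diag k i s : size s = k -> all diagonal s ->
  tact k (qh false i) * word_tensor k s = (count (at_index i) s)%:R * word_tensor k s.
Proof.
elim: s k => [|[[p a] b] s IH] [|k] //.
case=> es /andP[/eqP ab ds]; have {}ab : a = b := ab; subst b;
  rewrite -[word_tensor k.+1 _]/(stens (qunit p a a) (word_tensor k s)).
rewrite (tact_stens _ (@homog_qunit n _ _ _) (@homog_qunit n _ _ _)) andFb expr0 mul1r IH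
  //.
rewrite qunitM [i == a]eq_sym [count _ (_ :: _)]/= {2}/at_index [X in X == i]/= addFb.
have -> : stens (qunit p a a) ((count (at_index i) s)%:R * word_tensor k s)
  = (count (at_index i) s)%:R * stens (qunit p a a) (word_tensor k s).
  by rewrite -!(rmorph_nat (@inQ _)) stensQr.
rewrite natrD mulrDl; congr (_ + _).
by have [->|_] := eqVneq a i; rewrite ?mul1r // mul0r (zmodmor0 (stens_zmodl _)).
Qed.

Lemma nord_h k i s : size s = k -> all diagonal s ->
  nord (word_tensor k.+1 ((false, i, i) :: s)) =
  (H i - (count (at_index i) s)%:R) * nord (word_tensor k s).
Proof.
move=> es ds; rewrite [word_tensor k.+1 _]/= (nord_stens rep);
  last exact: queer_letter_unit.
by rewrite tact_diag // nord_nat mulrBl.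
Qed.

Lemma tact_diag_odd k i s : size s = k -> all diagonal s -> ~~ has (at_index i) s ->
  tact k (qh true i) * word_tensor k s = 0.
Proof.
elim: s k => [|[[p a] b] s IH] [|k] //.
  by rewrite mul0r.
case=> es /andP[/eqP ab ds]; have {}ab : a = b := ab; subst b;
  rewrite [has _ _]/= negb_or => /andP[nai nis];
  rewrite -[word_tensor k.+1 _]/(stens (qunit p a a) (word_tensor k s)).
rewrite (tact_stens _ (@homog_qunit n _ _ _) (@homog_qunit n _ _ _)) IH //.
rewrite (zmodmor0 (stens_zmodr _)) mulr0 addr0.
rewrite qunitM eq_sym (negPf (nai : a != i)).
exact: (zmodmor0 (stens_zmodl _)).
Qed.

Lemma nord_h_odd k i s : size s = k -> all diagonal s -> ~~ has (at_index i) s ->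
  nord (word_tensor k.+1 ((true, i, i) :: s)) = H' i * nord (word_tensor k s).
Proof.
move=> es ds ns; rewrite [word_tensor k.+1 _]/= (nord_stens rep);
  last exact: queer_letter_unit.
by rewrite tact_diag_odd // (zmodmor0 (@nordB n B iota k)) subr0.
Qed.

(** Each new h_i in front of a diagonal word contributes the factor h_i - m,
    where m is the number of letters of index i after it. *)
Lemma nord_nseq a k i s : size s = k -> all diagonal s ->
  nord (word_tensor (a + k) (nseq a (false, i, i) ++ s)) =
  \prod_(count (at_index i) s <= m < count (at_index i) s + a) (H i - m%:R) * nord
    (word_tensor k s).
Proof.
move=> es ds; elim: a => [|a IH]; first by rewrite addn0 big_geq // mul1r.
have es' : size (nseq a (false, i, i) ++ s) = (a + k)%N by rewrite size_cat size_nseq es.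
have ds' : all diagonal (nseq a (false, i, i) ++ s) by rewrite all_cat all_nseq /diagonal
  eqxx orbT.
rewrite addSn [nseq _ _ ++ _]/= nord_h // IH mulrA addnS big_nat_recr ?leq_addr //=.
rewrite count_cat count_nseq /at_index /= eqxx mul1n addnC; congr (_ * _).
apply: commr_prod => m _; apply/commr_sym.
by apply: commrB; [apply/commr_sym/commrB=> //; apply: commr_nat|apply: commr_nat].
Qed.

Lemma nord_dup_odd k x s : x.1.1 -> nord (word_tensor k.+2 [:: x, x & s]) = 0.
Proof.
move=> ox; have := nord_swap rep (word_tensor k s) (queer_letter_unit x)
  (queer_letter_unit x)
  (@homog_letter_unit n x) (@homog_letter_unit n x).
rewrite /qbpar ox expr1 mulN1r => /eqP; rewrite -addr_eq0 => /eqP e.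
by apply: (@superalg_char0 _ 1); rewrite mulr_natl mulr2n.
Qed.

(** Collect the letters of index i in front. Without odd letter the value
    contains h_i (h_i - 1) .. (h_i - r) = h'_i h'_i (h_i - 1) .. (h_i - r);
    with one odd letter it contains (h_i - 1) .. (h_i - r) h'_i; two equal odd
    letters cancel by supersymmetry. *)
Lemma nord_diag_kill k i s : size s = k -> all diagonal s ->
  count (at_index i) s = r.+1 -> nord (word_tensor k s) = 0.
Proof.
move=> es ds ci; set y := (false, i, i) : letter n; set z := (true, i, i) : letter n.
set t := filter (predC1 y) s; set rest := filter (predC1 z) t.
set a := count_mem y s; set c := count_mem z t.
have pz := perm_extract z t.
have ps : perm_eq s (nseq a y ++ nseq c z ++ rest).
  by apply: perm_trans (perm_extract y s) _; rewrite perm_cat2l.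
have drest : all diagonal rest.
  by apply/allP => x; rewrite !mem_filter => /and3P[_ _ /(allP ds)].
have nrest : ~~ has (at_index i) rest.
  apply/hasPn => -[[p u] v]; rewrite !mem_filter /at_index => /and3P[/= nz ny /(allP ds)].
  rewrite /diagonal /= => /eqP e; subst v; apply: contra nz => /eqP e; subst u.
  by move: ny; rewrite /y /z !xpair_eqE eqxx !andbT; case: p.
have ac : (a + c = r.+1)%N.
  rewrite -ci (permP ps) !count_cat !count_nseq /at_index /= eqxx !mul1n.
  by rewrite [count _ rest](_ : _ = 0%N) ?addn0 //; apply/eqP;
    rewrite -leqn0 leqNgt -has_count.
have sz : (a + (c + size rest) = k)%N.
  by rewrite -es (perm_size ps) !size_cat !size_nseq.
rewrite perm_sym in ps; apply: (nord_perm0 rep ps); first by rewrite !size_cat !size_nseq.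
have c0 : count (at_index i) rest = 0%N by apply/eqP; rewrite -leqn0 leqNgt -has_count.
move: ac sz ps; rewrite {}/c; case: (count_mem z t) => [|[|c]] ac sz ps.
- rewrite -sz /= nord_nseq // c0 add0n; rewrite addn0 in ac; rewrite ac.
  by rewrite big_ltn // subr0 -{1}qh_odd_sq -(mulrA (H' i)) prodH mulr0 mul0r.
- rewrite -sz add1n [nseq 1 z ++ rest]/= nord_nseq //; last by rewrite /= /diagonal eqxx.
  rewrite nord_h_odd // [count _ (_ :: _)]/= c0 {1 2}/at_index eqxx addn0 mulrA.
  rewrite (_ : (1 + a)%N = r.+1); last by lia.
  rewrite [X in X * _](_ : _ = 0) ?mul0r // -[RHS](prodH i);
    apply/commr_sym/commr_prod => m _.
  apply/commr_sym/commr_sym/commrB; first exact/commr_sym/qh_comm.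
  exact: commr_nat.
have ps2 : perm_eq [:: z, z & nseq c z ++ nseq a y ++ rest]
  (nseq a y ++ nseq c.+2 z ++ rest).
  by rewrite -[X in perm_eq X _]/(nseq c.+2 z ++ nseq a y ++ rest) perm_catCA.
apply: (nord_perm0 rep ps2); first by rewrite (perm_size ps2) !size_cat !size_nseq.
by case: k {es} sz => [|[|k]] sz; [lia|lia|apply: nord_dup_odd].
Qed.

(** Adding letters h_i until r + 1 letters have index i gives zero by
    [nord_diag_kill], and amounts to multiplying by the h_i - m for c_i <= m
    <= r, where c_i counts the letters of index i. This is the situation of
    [joint_eigenvector0], as the c_i add up to r + 1. *)
Lemma nord_diag0 s : size s = r.+1 -> all diagonal s -> nord (word_tensor r.+1 s) = 0.
Proof.
move=> es ds; apply: (@joint_eigenvector0 B n r (fun i => H i)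
  (fun i => count (at_index i) s)) => //.
- exact: qh_comm.
- have -> : (\sum_i count (at_index i) s = size s)%N.
    elim: s {es ds} => [|x s IH] /=; first by rewrite big1.
    rewrite big_split /= IH; rewrite -add1n; congr (_ + _)%N;
      rewrite (bigD1 x.1.2) //= /at_index eqxx big1 //.
    by move=> j /negPf nj; rewrite eq_sym nj.
  by rewrite es.
move=> i; have le : (count (at_index i) s <= r.+1)%N by rewrite -es count_size.
rewrite -{1}(subnKC le) -nord_nseq //; apply: (@nord_diag_kill _ i).
- by rewrite size_cat size_nseq es.
- by rewrite all_cat ds all_nseq /diagonal eqxx orbT.
by rewrite count_cat count_nseq /at_index /= eqxx mul1n subnK.
Qed.
End Vanishing.

(** * All words of length r + 1 *)

Section VanishingWords.
Variables (n r : nat) (B : superalgType) (iota : gl n -> B).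
Hypothesis rep : queer_rep iota.
Local Notation nord := (nord iota).
Local Notation H i := (iota (qh false i)).
Local Notation H' i := (iota (qh true i)).
Hypothesis sumH : \sum_i H i = r%:R.
Hypothesis prodH : forall i, H' i * \prod_(1 <= m < r.+1) (H i - m%:R) = 0.
Implicit Types (s : seq (letter n)) (x y : letter n).
Let nB k := @nordB n B iota k.

(** Even letters y can be moved to the front without sign, so that the m
    copies of y contribute m equal terms. *)
Lemma ad_expansion_nseq k p (x : gl n) pre m y s : ~~ qbpar y -> ~~ wordpar pre ->
  ad_expansion k p x pre (nseq m y ++ s) =
  m%:R * stens (scomm p false x (letter_unit y)) (word_tensor k (pre ++ nseq m.-1 y ++ s))
  + ad_expansion k p x (pre ++ nseq m y) s.
Proof.
move=> /negPf py; elim: m pre => [|m IH] pre ppre; first by rewrite mul0r add0r cats0.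
rewrite [LHS]/= py expr0 mul1r IH; last first.
  by rewrite -cats1 wordpar_cat wordpar_cons py (negPf ppre).
rewrite -cats1 -!catA /= -natr1 addrC -addrA [ad_expansion _ _ _ _ _ + _]addrC addrA;
  congr (_ + _).
by rewrite mulrDl mul1r; case: m {IH} => [|m]; rewrite ?mul0r.
Qed.

Lemma nord_ad_expansion0 k p (x : gl n) pre s :
  (forall s1 y s2, s = s1 ++ y :: s2 ->
     nord (stens (scomm p (qbpar y) x (letter_unit y)) (word_tensor k (pre ++ s1 ++ s2))
       : tEnd n k.+1) = 0) ->
  nord (ad_expansion k p x pre s) = 0.
Proof.
elim: s pre => [|y s IH] pre h; first exact: (zmodmor0 (@nB k.+1)).
rewrite [ad_expansion _ _ _ _ _]/= -[X in nord X]/((_ : tEnd n k.+1) + _).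
rewrite (zmodmorD (@nB k.+1)) (zmodmor_sign _ _ (@nB k.+1)) (h [::] y s) // mulr0 add0r.
by apply: IH => s1 z s2 e; rewrite cat_rcons; apply: (h (y :: s1) z s2); rewrite e.
Qed.

Definition offdiag x := x.1.2 != x.2.
Definition odddiag x := x.1.1 && (x.1.2 == x.2).

(** The bracket of x = E_ij with ii^a jj^(b+1) rest: since [x, ii] = - x and
    [x, jj] = x, the diagonal letters give the two displayed words. A letter
    of rest gives words that vanish by hypothesis: either they have no more
    off-diagonal letters than rest, or the letter is an odd diagonal one and
    has been replaced by an off-diagonal one. *)
Lemma ad_relation p (i j : 'I_n) a b (rest : seq (letter n)) :
  let ii := (false, i, i) : letter n in let jj := (false, j, j) : letter n in
  let x := (p, i, j) : letter n in
  i != j -> ii \notin rest -> jj \notin rest -> (a + b + size rest)%N = r ->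
  (forall s, size s = r.+1 -> (count offdiag s <= count offdiag rest)%N ->
     nord (word_tensor r.+1 s) = 0) ->
  (forall s, size s = r.+1 -> count offdiag s = (count offdiag rest).+1 ->
     (count odddiag s < count odddiag rest)%N -> nord (word_tensor r.+1 s) = 0) ->
  - (a%:R * nord (word_tensor r.+1 (x :: nseq a.-1 ii ++ nseq b.+1 jj ++ rest)))
  + b.+1%:R * nord (word_tensor r.+1 (x :: nseq a ii ++ nseq b jj ++ rest)) = 0.
Proof.
move=> ii jj x nij iir jjr es hd ho.
set s0 := nseq a ii ++ nseq b.+1 jj ++ rest.
have offii m : count offdiag (nseq m ii) = 0%N by rewrite count_nseq /offdiag eqxx.
have offjj m : count offdiag (nseq m jj) = 0%N by rewrite count_nseq /offdiag eqxx.
have oddii m : count odddiag (nseq m ii) = 0%N by rewrite count_nseq.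
have oddjj m : count odddiag (nseq m jj) = 0%N by rewrite count_nseq.
have es0 : size s0 = r.+1 by rewrite /s0 !size_cat !size_nseq; lia.
have := nord_ad rep (queer_letter_unit x) (@homog_letter_unit n x) es0.
rewrite (hd _ es0); last by rewrite /s0 !count_cat offii offjj.
rewrite scomm0r ad_expansion_nseq // ad_expansion_nseq //;
  last by rewrite /wordpar count_nseq.
have xii : scomm p false (letter_unit x) (letter_unit ii) = - letter_unit x.
  by rewrite scomm_qunit andbF expr0 mul1r eq_sym (negPf nij) eqxx sub0r addbF.
have xjj : scomm p false (letter_unit x) (letter_unit jj) = letter_unit x.
  by rewrite scomm_qunit andbF expr0 mul1r eqxx eq_sym (negPf nij) subr0 addbF.
rewrite xii xjj !(zmodmorD (@nB r.+1)) !nord_nat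
  [nord (ad_expansion _ _ _ _ rest)]nord_ad_expansion0.
  rewrite addr0 (zmodmorN (stens_zmodl _)) (zmodmorN (@nB r.+1)) mulrN cat0s => e.
  by rewrite [RHS]e.
move=> s1 y s2 erest; case: y erest => [[q k] l] erest.
have yr : (q, k, l) \in rest by rewrite erest mem_cat mem_head orbT.
rewrite cat0s; set front := nseq a ii ++ nseq b.+1 jj.
have sfr : size front = (a + b.+1)%N by rewrite size_cat !size_nseq.
have offfr : count offdiag front = 0%N by rewrite count_cat offii offjj.
have oddfr : count odddiag front = 0%N by rewrite count_cat oddii oddjj.
clearbody front; pose w z := z :: front ++ s1 ++ s2.
have sw z : size (w z) = r.+1.
  have er : size rest = (size s1 + (size s2).+1)%N by rewrite erest size_cat.
  by rewrite /w /= size_cat sfr size_cat -es er; lia.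
have lower z : (k == l -> q && offdiag z) -> nord (word_tensor r.+1 (w z)) = 0.
  have [ekl /(_ isT) /andP[qT oz]|nkl _] := eqVneq k l.
    have dz : odddiag z = false by rewrite /odddiag (negPf oz) andbF.
    apply: ho => //.
      by rewrite /w /= !count_cat offfr erest !count_cat /= oz /offdiag /= ekl eqxx.
    by rewrite /w /= !count_cat oddfr erest !count_cat /= dz /odddiag /= ekl eqxx qT; lia.
  apply: hd => //; rewrite /w /= !count_cat offfr erest !count_cat /=.
  by rewrite [offdiag (q, k, l)]nkl; case: (offdiag z); lia.
rewrite scomm_qunit stensBl nB stens_signl (zmodmor_sign _ _ (@nB r.+1)).
rewrite [X in nord X - _](_ : _ =
  if j == k then word_tensor r.+1 (w (p (+) q, i, l)) else 0).
  rewrite [X in _ - _ * nord X](_ : _ =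
    if l == i then word_tensor r.+1 (w (p (+) q, k, j)) else 0).
    have -> : nord (if j == k then word_tensor r.+1 (w (p (+) q, i, l)) else 0) = 0.
      case: eqP => [ejk|_]; last exact: (zmodmor0 (@nB r.+1)).
      apply: lower => /eqP ekl; rewrite /offdiag /= -ekl -ejk nij andbT.
      apply/negPn/negP => nq; case/negP: jjr; rewrite /jj {2}ejk.
      by move: yr; rewrite -ekl -ejk (negPf nq).
    have -> : nord (if l == i then word_tensor r.+1 (w (p (+) q, k, j)) else 0) = 0.
      case: eqP => [eli|_]; last exact: (zmodmor0 (@nB r.+1)).
      apply: lower => /eqP ekl; rewrite /offdiag /= ekl eli nij andbT.
      apply/negPn/negP => nq; case/negP: iir.
      by move: yr; rewrite ekl eli (negPf nq).
    by rewrite mulr0 subrr.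
  by case: eqP => // _; apply: (zmodmor0 (stens_zmodl _)).
by case: eqP => // _; apply: (zmodmor0 (stens_zmodl _)).
Qed.

(** Solving [ad_relation] for the second word, by induction on a. *)
Lemma nord_front_offdiag p (i j : 'I_n) : i != j -> forall a b (rest : seq (letter n)),
  let ii := (false, i, i) : letter n in let jj := (false, j, j) : letter n in
  let x := (p, i, j) : letter n in
  ii \notin rest -> jj \notin rest ->
  (a + b + size rest)%N = r ->
  (forall s, size s = r.+1 -> (count offdiag s <= count offdiag rest)%N ->
     nord (word_tensor r.+1 s) = 0) ->
  (forall s, size s = r.+1 -> count offdiag s = (count offdiag rest).+1 ->
     (count odddiag s < count odddiag rest)%N -> nord (word_tensor r.+1 s) = 0) ->
  nord (word_tensor r.+1 (x :: nseq a ii ++ nseq b jj ++ rest)) = 0.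
Proof.
move=> nij a b rest ii jj x iir jjr; elim: a b => [|a IHa] b es hd ho.
  have := ad_relation p nij iir jjr es hd ho.
  by rewrite mul0r oppr0 add0r => /superalg_char0.
have := ad_relation p nij iir jjr es hd ho.
rewrite [X in - (_ * X)]IHa ?mulr0 ?oppr0 ?add0r; first exact: superalg_char0.
- by rewrite -es addnS addSn.
- exact: hd.
exact: ho.
Qed.

(** Induction on the number of off-diagonal letters, then on the number of odd
    diagonal letters: pick an off-diagonal letter E_ij and collect in front of
    the rest the even letters E_ii and E_jj. *)
Lemma nord_word0 s : size s = r.+1 -> nord (word_tensor r.+1 s) = 0.
Proof.
have [d] := ubnP (count offdiag s); elim: d s => // d IHd s.
have [o] := ubnP (count odddiag s); elim: o s => // o IHo s lto ltd es.
have [ds|/allPn [[[p i] j] xs nij]] := boolP (all (@diagonal n) s).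
  exact: (nord_diag0 rep).
rewrite /diagonal /= in nij.
set x := (p, i, j) in xs; set ii := (false, i, i) : letter n.
set jj := (false, j, j) : letter n.
set s1 := rem x s; set s2 := filter (predC1 ii) s1.
set rest := filter (predC1 jj) s2.
have ps : perm_eq (x :: nseq (count_mem ii s1) ii ++ nseq (count_mem jj s2) jj ++ rest) s.
  rewrite perm_sym; apply: perm_trans (perm_to_rem xs) _; rewrite perm_cons.
  by apply: perm_trans (perm_extract ii s1) _; rewrite perm_cat2l; apply: perm_extract.
have ec (P : pred (letter n)) : P ii = false -> P jj = false ->
  count P s = (P x + count P rest)%N.
  by move=> Pi Pj; rewrite -(permP ps) /= !count_cat !count_nseq Pi Pj.
have es' := perm_size ps; rewrite es /= !size_cat !size_nseq in es'.
have offr : count offdiag s = (count offdiag rest).+1.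
  by rewrite ec /offdiag /= ?eqxx // nij.
have oddr : count odddiag s = count odddiag rest.
  by rewrite ec /odddiag //= (negPf nij) andbF.
apply: (nord_perm0 rep ps); first by rewrite (perm_size ps).
apply: (nord_front_offdiag p nij).
- by rewrite !mem_filter /= eqxx andbF.
- by rewrite mem_filter /= eqxx.
- by case: es' => <-; rewrite addnA.
- move=> t et ht; apply: IHd => //; rewrite -ltnS.
  by apply: leq_trans ltd; rewrite offr !ltnS.
move=> t et ht1 ht2; apply: IHo => //; last by rewrite ht1 -offr.
by rewrite -ltnS; apply: leq_trans lto; rewrite oddr !ltnS.
Qed.

End VanishingWords.

(** * The left inverse *)

Lemma fsalg_ind (X : choiceType) (par : X -> bool) (P : fsalg par -> Prop) :
  (forall a, P (inQ a)) -> (forall x, P (fgen par x)) ->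
  (forall u v, P u -> P v -> P (u + v)) ->
  (forall u v, P u -> P v -> P (u * v)) -> forall u, P u.
Proof.
move=> PQ Px PD PM u.
have UU c1 c2 (k1 k2 : {fmonom X}) :
    << c1 *g k1 >> * << c2 *g k2 >> = << c1 * c2 *g mmul k1 k2 >> :> fsalg par.
  exact: fgmulUU.
have Pw (k : {fmonom X}) : P << k >>.
  case: k; elim=> [|x s IH].
    rewrite [FMonom _](_ : _ = mone); last by apply: val_inj; rewrite /= fm1.
    exact: (PQ 1).
  rewrite [FMonom _](_ : _ = mmul (fmu x) (FMonom s)); last first.
    by apply: val_inj; rewrite /= fmM fmU.
  by rewrite -[1]mulr1 -UU; apply: PM => //; apply: Px.
rewrite [u]monalgE; elim/big_rec: _ => [|k v _ Pv].
  by rewrite -(rmorph0 (@inQ (fsalg par))); apply: PQ.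
apply: PD => //; have -> : << u@_k *g k >> =
    (inQ u@_k : fsalg par) * (<< k >> : fsalg par).
  by rewrite [RHS]UU mulr1 mul1m.
by apply: PM.
Qed.

Lemma stens11 M N (a : 'I_M -> bool) (b : 'I_N -> bool) :
  stens (1 : superEnd a) (1 : superEnd b) = 1.
Proof.
apply/matrixP => s t; case: (mxtens_indexP s) => i k; case: (mxtens_indexP t) => j l.
rewrite stensE !mxE (can_eq (@mxtens_indexK _ _)) xpair_eqE.
have [->|_] := eqVneq k l; last by rewrite andbF mulr0.
by rewrite addbb expr0 mul1r andbT mulr1.
Qed.

Lemma tact1 n k : tact k (1 : gl n) = k%:R.
Proof.
elim: k => [//|k IH]; rewrite [LHS]/= IH stens11 -natr1 addrC.
congr (_ + _); have -> : k%:R = inQ k%:R * 1 :> tEnd n k by rewrite mulr1 rmorph_nat.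
by rewrite stensQr stens11 mulr1 rmorph_nat.
Qed.

Lemma gl1_sum n : 1 = \sum_i qh false i :> gl n.
Proof.
have q1 : queer (1 : gl n).
  by exists 1%:M, 0; rewrite -[LHS]/(1%:M) scalar_mx_block.
rewrite [LHS](queer_sum q1) big_bool /= [X in X + _]big1 ?add0r.
  apply: eq_bigr => i _; rewrite (bigD1 i) //= big1 ?addr0.
    by rewrite [qcoef _ _ _ _](_ : _ = 1) ?rmorph1 ?mul1r // /qcoef mxE eqxx.
  move=> j /negPf nj; rewrite [qcoef _ _ _ _](_ : _ = 0) ?rmorph0 ?mul0r //.
  by rewrite /qcoef mxE (inj_eq (@lshift_inj _ _)) eq_sym nj.
move=> i _; rewrite big1 // => j _.
rewrite [qcoef _ _ _ _](_ : _ = 0) ?rmorph0 ?mul0r //.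
by rewrite /qcoef mxE eq_lrshift.
Qed.

Lemma queer1 n : queer (1 : gl n).
Proof. by exists 1%:M, 0; rewrite -[LHS]/(1%:M) scalar_mx_block. Qed.

Section Faithful.
Variables (n r : nat) (B : superalgType) (iota : gl n -> B).
Hypothesis rep : queer_rep iota.
Local Notation nord := (nord iota).
Local Notation H i := (iota (qh false i)).
Local Notation H' i := (iota (qh true i)).
Hypothesis sumH : \sum_i H i = r%:R.
Hypothesis prodH : forall i, H' i * \prod_(1 <= m < r.+1) (H i - m%:R) = 0.
Let nB k := @nordB n B iota k.

Lemma words_qtens0 k (F : tEnd n k -> B) : zmod_morphism F ->
  (forall c u, F (inQ c * u) = inQ c * F u) ->
  (forall s, size s = k -> F (word_tensor k s) = 0) ->
  forall q u, qtens q u -> F u = 0.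
Proof.
elim: k F => [|k IH] F FB FQ Fw q u /=.
  have -> : u = inQ ((u : 'M_1) 0 0) * word_tensor 0 [::].
    by apply/matrixP => i j; rewrite !ord1 mulr1 /= [RHS]mxE eqxx mulr1n.
  by rewrite FQ Fw ?mulr0.
elim=> {q u} [q|p q x u v qx hx hu _ IHv]; first exact: zmodmor0.
rewrite (zmodmorD FB) IHv addr0 (queer_sum qx).
rewrite (zmodmor_sum (stens_zmodl u)) (zmodmor_sum FB) big1 // => a _.
rewrite (zmodmor_sum (stens_zmodl u)) (zmodmor_sum FB) big1 // => i _.
rewrite (zmodmor_sum (stens_zmodl u)) (zmodmor_sum FB) big1 // => j _.
rewrite stensQl FQ [F _](_ : _ = 0) ?mulr0 //.
apply: (IH (fun u => F (stens (qunit a i j) u)) _ _ _ _ _ hu).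
- by move=> v1 v2; rewrite stensBr FB.
- by move=> c v1; rewrite stensQr FQ.
by move=> s es; apply: (Fw ((a, i, j) :: s)); rewrite /= es.
Qed.

(** The recursion for nord on x (x) u, whose left-hand side is zero in degree
    r + 1. *)
Lemma nord_tact p q (x : gl n) (u : tEnd n r) : queer x -> homog p x -> qtens q u ->
  nord (tact r x * u) = iota x * nord u.
Proof.
move=> qx hx hu; apply/eqP; rewrite eq_sym -subr_eq0 -(nord_stens rep) //.
apply/eqP/(words_qtens0 (@nB r.+1) _ _ (qtens_stens qx hx hu)).
  exact: nordQ.
exact: (nord_word0 rep sumH prodH).
Qed.

(** As tact(1) is multiplication by k on degree k and iota(1) = r, the
    recursion multiplies the value by r - k; at k = r the result is r!. *)
Lemma nord1 k : (k <= r)%N -> nord (1 : tEnd n k) = (r ^_ k)%:R.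
Proof.
elim: k => [_|k IH lek]; first by rewrite /= mxE eqxx rmorph1.
rewrite -[1](@stens11 _ _ (@vpar n) (@tpar n k)) (nord_stens rep _ (queer1 n)) tact1.
rewrite (nord_nat iota) {1}gl1_sum (zmodmor_sum (queer_repB rep)) sumH -mulrBl.
by rewrite IH ?(ltnW lek) // ffactnSr mulnC natrM natrB // ltnW.
Qed.

(** The elements u with nord(f(u) t) = g(u) nord(t) for all t in q(n)^(x)r
    form a subalgebra containing the generators. For t = 1 this gives r! g(u)
    = nord(f(u)). *)
Lemma kernel_sub (X : choiceType) (par : X -> bool) (f : fsalg par -> tEnd n r)
    (g : fsalg par -> B) : superalg_hom f -> superalg_hom g ->
  (forall x, exists p a, [/\ queer a, homog p a, f (fgen par x) = tact r a
     & g (fgen par x) = iota a]) ->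
  forall u, f u = 0 -> g u = 0.
Proof.
move=> hf hg gen u fu0.
pose span (t : tEnd n r) := exists t0 t1,
  [/\ qtens false t0, qtens true t1 & t = t0 + t1].
have spanD t t' : span t -> span t' -> span (t + t').
  move=> [t0 [t1 [h0 h1 ->]]] [t0' [t1' [h0' h1' ->]]].
  by exists (t0 + t0'), (t1 + t1'); split; [apply: qtensD|apply: qtensD|rewrite addrACA].
have spanQ k q (t : tEnd n k) c : qtens q t -> qtens q (inQ c * t).
  case: k t => [|k] t /=; first exact: homog_inQM.
  elim=> {q t} [q|p q x v w qx hx hv _ IHw]; first by rewrite mulr0; apply: qspan0.
  rewrite mulrDr -stensQl; apply: qspan_cons => //; last exact: homog_inQM.
  rewrite [inQ c](_ : _ = block_mx c%:M 0 0 c%:M); last by rewrite -scalar_mx_block.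
  by apply: queerM => //; exists c%:M, 0.
have span1 : span 1.
  exists 1, 0; split; [|exact: qtens0|by rewrite addr0].
  elim: (r) => [|k IH]; first exact: homog1.
  rewrite -(@stens11 _ _ (@vpar n) (@tpar n k));
    apply: (@qtens_stens n k false false) => //.
    exact: queer1.
  exact: homog1.
have P v : forall t, span t -> span (f v * t) /\ nord (f v * t) = g v * nord t.
  elim/fsalg_ind: v => [a|x|v w IHv IHw|v w IHv IHw] t st.
  - rewrite (superalg_homQ hf) (superalg_homQ hg) nordQ; split=> //.
    case: st => t0 [t1 [h0 h1 ->]].
    by exists (inQ a * t0), (inQ a * t1); split;
      [apply: spanQ|apply: spanQ|rewrite mulrDr].
  - have [p [a [qa ha -> ->]]] := gen x; case: st => t0 [t1 [h0 h1 ->]]; split.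
      have k0 := qtens_tact qa ha h0; have k1 := qtens_tact qa ha h1.
      rewrite mulrDr; apply: spanD.
        by case: p {ha k1} k0 => k0;
          [exists 0, (tact r a * t0)|exists (tact r a * t0), 0];
          split; rewrite ?addr0 ?add0r //; apply: qtens0.
      by case: p {ha k0} k1 => k1; [exists (tact r a * t1), 0|exists 0, (tact r a * t1)];
        split; rewrite ?addr0 ?add0r //; apply: qtens0.
    rewrite mulrDr !(zmodmorD (@nB r)) (nord_tact qa ha h0) (nord_tact qa ha h1).
    by rewrite mulrDr.
  - have [sv ev] := IHv _ st; have [sw ew] := IHw _ st.
    rewrite (zmodmorD (superalg_homB hf)) (zmodmorD (superalg_homB hg)) !mulrDl.
    by split; [apply: spanD|rewrite (zmodmorD (@nB r)) ev ew].
  have [sw ew] := IHw _ st; have [sv ev] := IHv _ sw.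
  by rewrite (superalg_homM hf).2 (superalg_homM hg).2 -!mulrA ev ew.
have [_] := P u 1 span1; rewrite fu0 mul0r (zmodmor0 (@nB r)) nord1 // ffactnn.
rewrite -(rmorph_nat (@inQ B)) -inQ_central (rmorph_nat (@inQ B)) => /esym.
by case: (r`!) (fact_gt0 r) => // m _ /superalg_char0.
Qed.
End Faithful.

(** * Brackets and Serre relations *)

Definition zsign (L : zmodType) (b : bool) (x : L) := if b then - x else x.

(** The axioms of a Lie superalgebra, with formal parity arguments instead of
    a grading, as satisfied by [scomm]. *)
Record super_bracket (L : zmodType) (br : bool -> bool -> L -> L -> L) : Prop :=
  SuperBracket {
    brBl : forall p q z, zmod_morphism (fun x => br p q x z);
    brBr : forall p q x, zmod_morphism (br p q x);
    brC : forall p q x y, br p q x y = - zsign (p && q) (br q p y x);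
    brJ : forall p q s x y z,
      br p (q (+) s) x (br q s y z) =
      br (p (+) q) s (br p q x y) z + zsign (p && q) (br q (p (+) s) y (br p s x z))
  }.

(** The Serre-type relations of q(n) with parities as variables, for families
    indexed by natural numbers below n. Exchanging e and f and flipping the
    bracket preserves them ([flip_serre]), which carries results on positive
    root vectors over to negative ones. *)
Record queer_serre (L : zmodType) (br : bool -> bool -> L -> L -> L) (n : nat)
    (h e f : bool -> nat -> L) : Prop := QueerSerre {
  qs_hh : forall p q i j, (i < n)%N -> (j < n)%N ->
    br p q (h p i) (h q j) =
      (h (p (+) q) i - zsign (p && q) (h (p (+) q) i)) *+ (i == j);
  qs_he : forall p q i j, (i < n)%N -> (j.+1 < n)%N ->
    br p q (h p i) (e q j) =
      e (p (+) q) j *+ (i == j) - zsign (p && q) (e (p (+) q) j) *+ (i == j.+1);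
  qs_hf : forall p q i j, (i < n)%N -> (j.+1 < n)%N ->
    br p q (h p i) (f q j) =
      f (p (+) q) j *+ (i == j.+1) - zsign (p && q) (f (p (+) q) j) *+ (i == j);
  qs_ef : forall p q i j, (i.+1 < n)%N -> (j.+1 < n)%N ->
    br p q (e p i) (f q j) =
      (h (p (+) q) i - zsign (p && q) (h (p (+) q) i.+1)) *+ (i == j);
  qs_ee_far : forall p q i j, (i.+1 < n)%N -> (j.+1 < n)%N ->
    ((i.+1 < j) || (j.+1 < i))%N -> br p q (e p i) (e q j) = 0;
  qs_ff_far : forall p q i j, (i.+1 < n)%N -> (j.+1 < n)%N ->
    ((i.+1 < j) || (j.+1 < i))%N -> br p q (f p i) (f q j) = 0;
  qs_ee_same : forall p q i, (i.+1 < n)%N -> br p q (e p i) (e q i) = 0;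
  qs_ff_same : forall p q i, (i.+1 < n)%N -> br p q (f p i) (f q i) = 0;
  qs_ee_next : forall q i, (i.+2 < n)%N ->
    br true q (e true i) (e q i.+1) = br false (~~ q) (e false i) (e (~~ q) i.+1);
  qs_ff_next : forall q i, (i.+2 < n)%N ->
    br q true (f q i.+1) (f true i) = br (~~ q) false (f (~~ q) i.+1) (f false i);
  qs_eee : forall p i j, (i.+1 < n)%N -> (j.+1 < n)%N -> (j == i.+1) || (i == j.+1) ->
    br p false (e p i) (br false false (e false i) (e false j)) = 0;
  qs_fff : forall p i j, (i.+1 < n)%N -> (j.+1 < n)%N -> (j == i.+1) || (i == j.+1) ->
    br p false (f p i) (br false false (f false i) (f false j)) = 0
}.

Definition flipbr (L : Type) (br : bool -> bool -> L -> L -> L) p q x y := br q p y x.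

Section Bracket.
Variables (L : zmodType) (br : bool -> bool -> L -> L -> L).
Hypothesis Hbr : super_bracket br.

Lemma br0l p q x : br p q 0 x = 0. Proof. exact: (zmodmor0 (brBl Hbr p q x)). Qed.
Lemma br0r p q x : br p q x 0 = 0. Proof. exact: (zmodmor0 (brBr Hbr p q x)). Qed.
Lemma brNr p q x y : br p q x (- y) = - br p q x y.
Proof. exact: (zmodmorN (brBr Hbr p q x)). Qed.
Lemma brMl p q x y (b : bool) : br p q (x *+ b) y = br p q x y *+ b.
Proof. by case: b; rewrite ?mulr1n ?mulr0n ?br0l. Qed.
Lemma brMr p q x y (b : bool) : br p q x (y *+ b) = br p q x y *+ b.
Proof. by case: b; rewrite ?mulr1n ?mulr0n ?br0r. Qed.
Lemma brSr p q x y (b : bool) : br p q x (zsign b y) = zsign b (br p q x y).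
Proof. by case: b; rewrite /zsign ?brNr. Qed.
Lemma brC0 q x y : br false q x y = - br q false y x.
Proof. exact: (brC Hbr). Qed.
Lemma brJl p q s x y z : br (p (+) q) s (br p q x y) z =
  br p (q (+) s) x (br q s y z) - zsign (p && q) (br q (p (+) s) y (br p s x z)).
Proof. by rewrite (brJ Hbr) addrK. Qed.
Lemma brJ0 q s x y z : br false (q (+) s) x (br q s y z) =
  br q s (br false q x y) z + br q s y (br false s x z).
Proof. exact: (brJ Hbr). Qed.
Lemma brJl0 q s x y z : br q s (br false q x y) z =
  br false (q (+) s) x (br q s y z) - br q s y (br false s x z).
Proof. exact: (brJl false). Qed.

Lemma brJ00 s x y z : br false s x (br false s y z) =
  br false s (br false false x y) z + br false s y (br false s x z).
Proof. exact: (brJ0 false). Qed.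
Lemma brJl00 s x y z : br false s (br false false x y) z =
  br false s x (br false s y z) - br false s y (br false s x z).
Proof. exact: (brJl0 false). Qed.

Lemma flip_bracket : super_bracket (flipbr br).
Proof.
split; rewrite /flipbr.
- by move=> p q z x y; apply: brBr.
- by move=> p q x y z; apply: (brBl Hbr).
- by move=> p q x y; rewrite {1}(brC Hbr) andbC.
move=> p q s x y z.
rewrite addbC brJl [p (+) q]addbC [p (+) s]addbC; congr (_ + _).
rewrite (brC Hbr q); move: (br (s (+) p) q _ _) => w.
by case: p q s => [] [] [] /=; rewrite /zsign /= ?opprK.
Qed.

Lemma flip_serre n h e f : queer_serre br n h e f -> queer_serre (flipbr br) n h f e.
Proof.
case=> hh he hf ef ee ff es fs en fn eee fff; split; rewrite /flipbr.
- move=> p q i j ii jj; rewrite hh // eq_sym addbC andbC.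
  by have [->|] := eqVneq i j.
- move=> p q i j ii jj; rewrite (brC Hbr) hf // addbC [q && p]andbC /zsign.
  by case: (p && q) (i == j) (i == j.+1) => [] [] [] /=; rewrite ?mulr1n ?mulr0n ?opprK;
    zmod.
- move=> p q i j ii jj; rewrite (brC Hbr) he // addbC [q && p]andbC /zsign.
  by case: (p && q) (i == j) (i == j.+1) => [] [] [] /=; rewrite ?mulr1n ?mulr0n ?opprK;
    zmod.
- by move=> p q i j ii jj; rewrite ef // eq_sym addbC andbC; have [->|] := eqVneq i j.
- by move=> p q i j ii jj d; rewrite ff // orbC.
- by move=> p q i j ii jj d; rewrite ee // orbC.
- by move=> p q i ii; rewrite fs.
- by move=> p q i ii; rewrite es.
- exact: fn.
- exact: en.
- move=> p i j ii jj d; by rewrite brC0 [br false false _ (f false i)]brC0 brNr fff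
  ?oppr0.
- move=> p i j ii jj d; by rewrite brC0 [br false false _ (e false i)]brC0 brNr eee
  ?oppr0.
Qed.
End Bracket.

(** * Positive root vectors *)

Section PositiveRoots.
Variables (L : zmodType) (br : bool -> bool -> L -> L -> L).
Hypothesis Hbr : super_bracket br.
Hypothesis no2tors : forall x : L, x = - x -> x = 0.
Variables (n : nat) (h e f : bool -> nat -> L).
Hypothesis R : queer_serre br n h e f.

(** The root vector E_kl for k < l, bracketed together from e_k, .., e_(l-1),
    with the parity q carried by the last factor. *)
Fixpoint posroot q k l : L :=
  if l is l'.+1 then
    if k == l' then e q k else br false q (posroot false k l') (e q l')
  else 0.
Arguments posroot : simpl never.
Local Notation E := posroot.

Lemma posroot_simple q k : E q k k.+1 = e q k.
Proof. by rewrite /posroot eqxx. Qed.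
Lemma posrootS q k l : (k < l)%N -> E q k l.+1 = br false q (E false k l) (e q l).
Proof. by move=> kl; rewrite {1}/posroot ltn_eqF. Qed.

Lemma posroot_far p q k l m : (k < l)%N -> (l < m)%N -> (m.+1 < n)%N ->
  br p q (E p k l) (e q m) = 0.
Proof.
elim: l p q => // l IH p q; rewrite ltnS leq_eqVlt => /predU1P [->|kl] lm mn.
  by rewrite posroot_simple (qs_ee_far R) ?lm //; lia.
rewrite posrootS // (brJl0 Hbr) (qs_ee_far R) ?lm //; last by lia.
by rewrite IH ?(ltnW lm) // !(br0r Hbr) subr0.
Qed.

Lemma posroot_split q k l m : (k < l)%N -> (l < m)%N -> (m < n)%N ->
  br false q (E false k l) (E q l m) = E q k m.
Proof.
elim: m q => // m IH q kl; rewrite ltnS leq_eqVlt => /predU1P [<-|lm] mn.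
  by rewrite posroot_simple posrootS.
rewrite !posrootS ?(ltn_trans kl) // (brJ00 Hbr) IH ?(ltnW mn) //.
by rewrite (posroot_far _ _ kl lm) // (br0r Hbr) addr0.
Qed.

(** The parity can be moved from E_kl to e_l because [e'_(l-1), e_l] =
    [e_(l-1), e'_l] and likewise with both parities changed, while the earlier
    factors commute with e_l. *)
Lemma posroot_step p q k l : (k < l)%N -> (l.+1 < n)%N ->
  br p q (E p k l) (e q l) = E (p (+) q) k l.+1.
Proof.
move=> kl ln; rewrite posrootS //; case: p => //.
case: l kl ln => // l; rewrite ltnS leq_eqVlt => /predU1P [->|kl] ln.
  by rewrite !posroot_simple (qs_ee_next R).
rewrite (posrootS _ kl) (brJl0 Hbr) (posroot_far _ _ kl (ltnSn l) ln) (br0r Hbr) subr0.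
rewrite (qs_ee_next R) // (brJ00 Hbr) (posroot_far _ _ kl (ltnSn l) ln) (br0r Hbr) addr0.
by rewrite (posrootS _ kl).
Qed.

Lemma cartan_posroot p q i k l : (i < n)%N -> (k < l)%N -> (l < n)%N ->
  br p q (h p i) (E q k l) =
    E (p (+) q) k l *+ (i == k) - zsign (p && q) (E (p (+) q) k l) *+ (i == l).
Proof.
move=> iln; elim: l p q => // l IH p q; rewrite ltnS leq_eqVlt => /predU1P [->|kl] ln.
  by rewrite !posroot_simple (qs_he R).
rewrite posrootS // -[q]addFb (brJ Hbr) addFb andbF [zsign false _]/= IH ?(ltnW ln) //.
rewrite addbF (qs_he R) // andbF /= (brBl Hbr) (brBr Hbr).
rewrite !(brMl Hbr) !(brMr Hbr) (brSr Hbr) (posroot_step _ _ kl ln).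
by rewrite [br false _ _ _](posroot_step _ _ kl ln) addFb; zmod.
Qed.

(** For k = l - 1 this is a Serre relation; for smaller k the factor E_(k,l-1)
    commutes with e_l. *)
Lemma ad_last q k l : (k <= l)%N -> (l.+1 < n)%N ->
  br false q (e false l) (E q k l.+1) = 0.
Proof.
have two l' : (l'.+2 < n)%N -> br false q (e false l'.+1) (E q l' l'.+2) = 0.
  move=> ln; rewrite posrootS // posroot_simple (brJ00 Hbr) (qs_ee_same R) //.
  by rewrite (br0r Hbr) addr0 (brC0 Hbr) (qs_eee R) ?oppr0 ?eqxx ?orbT // ltnW.
rewrite leq_eqVlt => /predU1P [->|kl] ln; first by rewrite posroot_simple (qs_ee_same R).
case: l kl ln => // l; rewrite ltnS leq_eqVlt => /predU1P [->|kl] ln; first exact: two.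
rewrite -(@posroot_split q k l) // (brJ00 Hbr) two // (br0r Hbr) addr0.
by rewrite (brC0 Hbr false) (posroot_far _ _ kl) // oppr0 (br0l Hbr).
Qed.

(** For k < l, writing E_(k,l+1) as [E_kl, e_l] shows that X = [e_l,
    E_(k,l+2)] satisfies X = - X. *)
Lemma ad_before_last q k l : (k <= l)%N -> (l.+2 < n)%N ->
  br false q (e false l) (E q k l.+2) = 0.
Proof.
have two l' : (l'.+2 < n)%N -> br false q (e false l') (E q l' l'.+2) = 0.
  move=> ln; rewrite posrootS // posroot_simple.
  case: q; last by rewrite (qs_eee R) ?eqxx // ltnW.
  rewrite -[true]/(~~ false) -(qs_ee_next R) // -[~~ false]/(true (+) false).
  rewrite (brJ0 Hbr) (qs_ee_same R) ?(br0l Hbr) ?add0r ?(ltnW ln) //.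
  by rewrite (qs_eee R) ?eqxx // ltnW.
rewrite leq_eqVlt => /predU1P [->|kl] ln; first exact: two.
(* E_(k,l+2) = [E_(k,l+1), e_(l+1)], then E_(k,l+1) = [E_kl, e_l] *)
apply: no2tors; rewrite {1}posrootS ?(leqW kl) // (brJ00 Hbr) ad_last ?(ltnW kl) ?(ltnW
  ln) //.
rewrite (br0l Hbr) add0r -[br _ _ _ (e q _)](_ : E q l l.+2 = _); last first.
  by rewrite posrootS // posroot_simple.
rewrite (posrootS _ kl) (brJl00 Hbr) two // (br0r Hbr) sub0r posroot_split //.
Qed.

Lemma ad_simple_posroot q j k l : (j.+1 < n)%N -> (k < l)%N -> (l < n)%N ->
  br false q (e false j) (E q k l) = E q j l *+ (j.+1 == k) - E q k l.+1 *+ (j == l).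
Proof.
move=> jn; elim: l q => // l IH q; rewrite ltnS => kl ln.
have [lj|jl] := ltnP l j.
  rewrite [j.+1 == k]gtn_eqF ?mulr0n ?sub0r; last by lia.
  move: lj; rewrite leq_eqVlt => /predU1P [ej|lj]; first subst j.
    by rewrite eqxx mulr1n (brC0 Hbr) posroot_step ?addbF.
  by rewrite [j == _]gtn_eqF // mulr0n (brC0 Hbr) posroot_far.
rewrite [j == l.+1]ltn_eqF // mulr0n subr0.
move: jl; rewrite leq_eqVlt => /predU1P [->|jl].
  by rewrite gtn_eqF // mulr0n ad_last.
move: kl; rewrite leq_eqVlt => /predU1P [->|kl].
  have [<-|nj] := eqVneq j.+1 l; first by rewrite posroot_simple posrootS //
    posroot_simple mulr1n.
  by rewrite posroot_simple mulr0n (qs_ee_far R) //; lia.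
have [ej|nj] := eqVneq j.+1 l.
  by rewrite -ej ad_before_last ?gtn_eqF ?mulr0n //; lia.
rewrite (posrootS _ kl) (brJ00 Hbr) (qs_ee_far R) //; last by lia.
rewrite (br0r Hbr) addr0 IH ?(ltnW ln) // [j == l]ltn_eqF // mulr0n subr0 (brMl Hbr).
by rewrite posrootS.
Qed.

Definition nonneg q k l := if k == l then h q k else E q k l.

(** Boundary cases are uniform with the convention that E_kk is h_k. *)
Lemma ad_opposite_posroot q j k l : (j.+1 < n)%N -> (k < l)%N -> (l < n)%N ->
  br false q (f false j) (E q k l) =
    nonneg q j.+1 l *+ (j == k) - nonneg q k j *+ (l == j.+1).
Proof.
move=> jn; elim: l q => // l IH q; rewrite ltnS leq_eqVlt => /predU1P [->|kl] ln.
  rewrite posroot_simple (brC0 Hbr) (qs_ef R) // andbF addbF eqSS eq_sym.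
  have [->|_] := eqVneq j l; last by rewrite !mulr0n subr0 oppr0.
  by rewrite !mulr1n /nonneg !eqxx opprB.
rewrite (posrootS _ kl) (brJ00 Hbr) IH ?(ltnW ln) // (brBl Hbr) !(brMl Hbr).
have -> : br false q (nonneg false j.+1 l) (e q l) *+ (j == k) =
    nonneg q j.+1 l.+1 *+ (j == k).
  have [->|//] := eqVneq j k; congr (_ *+ _); rewrite /nonneg [k.+1 == l.+1]ltn_eqF //.
  have [->|nl] := eqVneq k.+1 l; last by rewrite posroot_step //; lia.
  by rewrite (qs_he R false q (ltnW ln) ln) eqxx ltn_eqF // mulr0n subr0 posroot_simple.
have -> : br false q (nonneg false k j) (e q l) *+ (l == j.+1) = 0.
  have [ej|//] := eqVneq l j.+1; rewrite /nonneg mulr1n.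
  have [->|nj] := eqVneq k j; last by rewrite posroot_far //; lia.
  by rewrite (qs_he R) ?ej // ?[j == _]ltn_eqF ?mulr0n ?subr0 //; lia.
have hE i : (i < n)%N -> br false q (E false k l) (h q i) =
    E q k l *+ (i == l) - E q k l *+ (i == k).
  move=> ii; rewrite (brC0 Hbr) cartan_posroot ?(ltnW ln) //.
  by rewrite addbF andbF opprB.
have -> : br false q (E false k l) (br false q (f false j) (e q l)) = - E q k l *+ (j ==
  l).
  rewrite (brC0 Hbr q (f false j)) (qs_ef R) // andbF addbF eq_sym (brNr Hbr) (brMr Hbr).
  rewrite (brBr Hbr) !hE ?(ltnW ln) // eqxx ![_ == k]gtn_eqF //; last exact: leqW.
  by rewrite gtn_eqF // !mulr0n !subr0 mulNrn.
rewrite subr0 eqSS [l == j]eq_sym mulNrn; congr (_ - _).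
by have [->|//] := eqVneq j l; rewrite /nonneg ltn_eqF.
Qed.
End PositiveRoots.

(** * All root vectors *)

Section Roots.
Variables (L : zmodType) (n : nat).
Hypothesis no2tors : forall x : L, x = - x -> x = 0.
Implicit Types (br : bool -> bool -> L -> L -> L) (h e f : bool -> nat -> L).

Definition root_vector br h e f q k l :=
  if k == l then h q k
  else if (k < l)%N then posroot br e q k l else posroot (flipbr br) f q l k.

Lemma root_flip br h e f q k l : root_vector (flipbr br) h f e q k l = root_vector br h e
  f q l k.
Proof.
rewrite /root_vector eq_sym; case: eqVneq => [->|] //.
by case: (ltngtP k l) => // ->; rewrite eqxx.
Qed.

Lemma root_ge br h e f q k l : (l <= k)%N ->
  root_vector br h e f q k l = nonneg (flipbr br) h f q l k.
Proof.
rewrite /root_vector /nonneg eq_sym leq_eqVlt => /predU1P [->|lk]; first by rewrite eqxx.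
by rewrite (ltn_eqF lk) ltnNge (ltnW lk).
Qed.

Lemma root_lt br h e f q k l : (k < l)%N -> root_vector br h e f q k l = posroot br e q k
  l.
Proof. by move=> kl; rewrite /root_vector (ltn_eqF kl) kl. Qed.

Lemma root_diag br h e f q k : root_vector br h e f q k k = h q k.
Proof. by rewrite /root_vector eqxx. Qed.

Variables (br : bool -> bool -> L -> L -> L) (h e f : bool -> nat -> L).
Hypothesis Hbr : super_bracket br.
Hypothesis R : queer_serre br n h e f.
Local Notation E := (root_vector br h e f).

Lemma cartan_root p q i k l : (i < n)%N -> (k < n)%N -> (l < n)%N ->
  br p q (h p i) (E q k l) =
    E (p (+) q) k l *+ (i == k) - zsign (p && q) (E (p (+) q) k l) *+ (i == l).
Proof.
move=> ii kk ll; case: (ltngtP k l) => [kl|lk|->].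
- by rewrite !root_lt // (cartan_posroot Hbr R).
- rewrite !(root_ge _ _ _ _ _ (ltnW lk)) /nonneg ltn_eqF //.
  rewrite (brC Hbr); have := cartan_posroot (flip_bracket Hbr) (flip_serre Hbr R) p q ii
    lk kk.
  rewrite {1}/flipbr => ->; case: (p && q); case: (i == l); case: (i == k);
    rewrite /zsign ?mulr1n ?mulr0n; zmod.
rewrite !root_diag (qs_hh R) //.
by have [->|_] := eqVneq i l; rewrite ?mulr1n // !mulr0n subr0.
Qed.

Lemma ad_simple_root q j k l : (j.+1 < n)%N -> (k < n)%N -> (l < n)%N ->
  br false q (e false j) (E q k l) = E q j l *+ (j.+1 == k) - E q k j.+1 *+ (l == j).
Proof.
move=> jn kk ll; case: (ltngtP k l) => [kl|lk|->].
- rewrite [E q k l]root_lt // (ad_simple_posroot Hbr no2tors R) //; congr (_ - _).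
    by have [ek|//] := eqVneq j.+1 k; rewrite root_lt //; lia.
  by rewrite [l == j]eq_sym; have [ej|//] := eqVneq j l; rewrite ej root_lt ?(leqW kl).
- have H := ad_opposite_posroot (flip_bracket Hbr) (flip_serre Hbr R) q jn lk kk.
  rewrite [E q k l]root_ge ?(ltnW lk) // /nonneg (ltn_eqF lk) (brC0 Hbr).
  rewrite [br _ _ _ _]H.
  rewrite opprB; congr (_ - _).
    rewrite eq_sym; have [ek|//] := eqVneq j.+1 k; rewrite root_ge //; lia.
  by rewrite eq_sym; have [el|//] := eqVneq l j; rewrite root_ge //; lia.
rewrite root_diag (brC0 Hbr) (qs_he R) // andbF addbF opprB.
by congr (_ - _); [have [<-|//] := eqVneq j.+1 l|have [->|//] := eqVneq l j];
  rewrite ?eqxx root_lt // posroot_simple.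
Qed.

End Roots.

Lemma ad_opposite_root (L : zmodType) n (br : bool -> bool -> L -> L -> L) h e f q j k l :
  (forall x : L, x = - x -> x = 0) -> super_bracket br -> queer_serre br n h e f ->
  (j.+1 < n)%N -> (k < n)%N -> (l < n)%N ->
  br false q (f false j) (root_vector br h e f q k l)
    = root_vector br h e f q j.+1 l *+ (k == j) - root_vector br h e f q k j *+ (j.+1 ==
      l).
Proof.
move=> tors Hbr R jn kk ll.
have := ad_simple_root tors (flip_bracket Hbr) (flip_serre Hbr R) q jn ll kk.
rewrite !(root_flip br h e f) {1}/flipbr (brC0 Hbr) => ->.
by rewrite opprB.
Qed.

(** * The quotient of the enveloping superalgebra *)

(** The identity is a sum of diagonal words, namely the tensor power of the
    sum of the h_i. *)
Lemma diag_words1 n k (V : zmodType) (F : tEnd n k -> V) : zmod_morphism F ->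
  (forall s, size s = k -> all (@diagonal n) s -> F (word_tensor k s) = 0) -> F 1 = 0.
Proof.
elim: k F => [|k IH] F FB Fw; first exact: (Fw [::]).
rewrite -[1](@stens11 _ _ (@vpar n) (@tpar n k)) gl1_sum.
rewrite (zmodmor_sum (stens_zmodl _)) (zmodmor_sum FB) big1 // => i _.
apply: (IH (fun u => F (stens (qh false i) u))) => [u v|s es ds].
  by rewrite stensBr FB.
by apply: (Fw ((false, i, i) :: s)); rewrite /= ?es ?ds /diagonal ?eqxx.
Qed.

(** On a diagonal word h_i is multiplication by the number c of letters of
    index i. If c = 0 then h'_i kills the word; otherwise 1 <= c <= r and the
    factor h_i - c does. *)
Lemma tact_prod_h n r i :
  tact r (qh true i) * \prod_(1 <= m < r.+1) (tact r (qh false i) - m%:R) = 0 :> tEnd n r.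
Proof.
rewrite -[LHS]mulr1; set X := _ * \prod_(_ <= _ < _) _.
apply: (@diag_words1 n r _ (fun u => X * u)) => [u v|s es ds]; first by rewrite mulrBr.
rewrite /X -mulrA; set c := count (at_index i) s.
(* scalars are kept in the image of inQ, where they are central *)
have key (l : seq nat) : \prod_(m <- l) (tact r (qh false i) - m%:R) * word_tensor r s
   = inQ (\prod_(m <- l) (c%:R - m%:R)) * word_tensor r s.
  elim: l => [|m l IH]; first by rewrite !big_nil rmorph1.
  rewrite !big_cons -mulrA IH inQ_comm mulrBl tact_diag // -mulrBl.
  have -> : c%:R - m%:R = inQ (c%:R - m%:R) :> tEnd n r by rewrite rmorphB !rmorph_nat.
  by rewrite mulrA -rmorphM mulrC.
rewrite key inQ_comm; have [c0|cgt0] := posnP c.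
  by rewrite tact_diag_odd ?mulr0 // has_count -/c c0.
have cr : (c <= r)%N by rewrite -es count_size.
have -> : \prod_(1 <= m < r.+1) (c%:R - m%:R) = 0 :> rat.
  by rewrite (bigD1_seq c) ?iota_uniq ?mem_index_iota ?cgt0 //= subrr mul0r.
by rewrite rmorph0 mul0r.
Qed.

Section Envelope.
Variable n : nat.

Lemma tq_injB : zmod_morphism (@tq_inj n).
Proof.
move=> x y; rewrite /tq_inj -sumrB; apply: eq_bigr => p _.
rewrite -sumrB; apply: eq_bigr => i _; rewrite -sumrB; apply: eq_bigr => j _.
by rewrite qcoefB rmorphB mulrBl.
Qed.

Lemma qcoefQ p i j c (x : gl n) : qcoef p i j (inQ c * x) = c * qcoef p i j x.
Proof. exact: superEndQE. Qed.

Lemma tq_injQ c (x : gl n) : tq_inj (inQ c * x) = inQ c * tq_inj x.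
Proof.
rewrite /tq_inj [RHS]mulr_sumr; apply: eq_bigr => p _.
rewrite [RHS]mulr_sumr; apply: eq_bigr => i _; rewrite [RHS]mulr_sumr;
  apply: eq_bigr => j _.
by rewrite qcoefQ rmorphM mulrA.
Qed.

Lemma qcoef_qunit p i j q (k l : 'I_n) :
  qcoef p i j (qunit q k l) = [&& p == q, i == k & j == l]%:R.
Proof.
rewrite /qcoef /qunit; case: p q => [] []; rewrite !mxE /pos /neg
  ?(eq_lshift, eq_rshift, eq_lrshift, eq_rlshift) /= ?andbF ?addr0 ?add0r //.
Qed.

Lemma qunit_expand (V : superalgType) (F : bool -> 'I_n -> 'I_n -> V) q (k l : 'I_n) :
  \sum_p \sum_i \sum_j inQ (qcoef p i j (qunit q k l)) * F p i j = F q k l.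
Proof.
rewrite (bigD1 q) //= (bigD1 k) //= (bigD1 l) //= qcoef_qunit !eqxx rmorph1 mul1r.
rewrite big1 => [|j /negPf nj]; last by rewrite qcoef_qunit nj !andbF rmorph0 mul0r.
rewrite big1 => [|i /negPf ni]; last first.
  by rewrite big1 // => j _; rewrite qcoef_qunit ni !andbF rmorph0 mul0r.
rewrite big1 => [|p /negPf np]; last first.
  rewrite big1 // => i _; rewrite big1 // => j _.
  by rewrite qcoef_qunit np rmorph0 mul0r.
by rewrite !addr0.
Qed.

Lemma tq_inj_qunit p i j : tq_inj (qunit p i j) = fgen _ (p, i, j) :> tq n.
Proof. exact: (qunit_expand (fun p i j => fgen _ (p, i, j) : tq n)). Qed.

Lemma uq_inj_rep : queer_rep (@uq_inj n).
Proof.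
split=> [x y|c x|p q x y qx qy hx hy].
- by rewrite /uq_inj tq_injB (superalg_homB (spi_hom _)).
- have hs := spi_hom (uq_rels n); rewrite /uq_inj.
  by rewrite tq_injQ (superalg_homM hs).2 (superalg_homQ hs).
rewrite -(superalg_hom_scomm p q _ _ (spi_hom (uq_rels n))); apply/esym/spiP.
rewrite -[X in ideal _ X]mul1r -[X in ideal _ X]mulr1; apply: ideal_gen.
exact: UqRel.
Qed.

End Envelope.

Lemma queer_rep_comp n (A B : superalgType) (iota : gl n -> A) (f : A -> B) :
  superalg_hom f -> queer_rep iota -> queer_rep (f \o iota).
Proof.
move=> hf [iB iQ iL]; split=> [x y|c x|p q x y qx qy hx hy] /=.
- by rewrite iB (superalg_homB hf).
- by rewrite iQ (superalg_homM hf).2 (superalg_homQ hf).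
by rewrite iL // (superalg_hom_scomm p q _ _ hf).
Qed.

Lemma superalg_hom_comp (A B C : superalgType) (f : A -> B) (g : B -> C) :
  superalg_hom f -> superalg_hom g -> superalg_hom (g \o f).
Proof.
move=> [fB [f1 fM] fQ fh] [gB [g1 gM] gQ gh]; split=> /=.
- by move=> x y /=; rewrite fB gB.
- by split=> [|x y] /=; rewrite ?f1 ?fM.
- by move=> a; rewrite fQ gQ.
by move=> p x /fh/gh.
Qed.

Lemma superalg_hom_prod (A B : superalgType) (f : A -> B) I (s : seq I) P (F : I -> A) :
  superalg_hom f -> f (\prod_(i <- s | P i) F i) = \prod_(i <- s | P i) f (F i).
Proof. by move=> hf; apply: (big_morph f (superalg_homM hf).2 (superalg_homM hf).1). Qed.

Lemma superalg_hom_nat (A B : superalgType) (f : A -> B) m :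
  superalg_hom f -> f m%:R = m%:R.
Proof.
move=> hf; rewrite -(rmorph_nat (@inQ A)) -(rmorph_nat (@inQ B)); exact: superalg_homQ.
Qed.

Lemma to_simage_hom (A B : superalgType) (f : A -> B) (hf : superalg_hom f) :
  superalg_hom (to_simage hf).
Proof.
split=> [x y||a|p x hx].
- by apply: val_inj; rewrite /= (superalg_homB hf).
- by split=> [|x y]; apply: val_inj; rewrite /= ?(superalg_homM hf).1 ?(superalg_homM
  hf).2.
- by apply: val_inj.
exact: (superalg_hom_homog hf).
Qed.

Lemma superalg_iso_ker (A B : superalgType) (f : A -> B) : superalg_hom f ->
  (forall x, f x = 0 -> x = 0) -> (forall y, exists x, f x = y) -> superalg_iso f.
Proof.
move=> hf inj surj; split=> //; exists (fun y => sval (cid (surj y))).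
  move=> x; case: cid => x' /= e; apply/eqP; rewrite -subr_eq0; apply/eqP/inj.
  by rewrite (superalg_homB hf) e subrr.
by move=> y; case: cid.
Qed.

Section FirstPart.
Variables n r : nat.

Lemma phi_unr_rel (u : Uq n) : unr_rels n r u -> to_simage (phi_hom n r) u = 0.
Proof.
have hp := phi_hom n r.
have ph p i : phi r (uq_inj (qh p i)) = tact r (qh p i).
  by apply: phi_uq_inj; apply: queer_qunit.
move=> hu; apply: val_inj; rewrite val_to_simage -[RHS]/(0 : tEnd n r).
case: hu => [|i].
  rewrite (superalg_homB hp) (superalg_hom_nat _ hp) (zmodmor_sum (superalg_homB hp)).
  under eq_bigr do rewrite ph.
  by rewrite -(zmodmor_sum (@tactB n r)) -gl1_sum tact1 subrr.
rewrite (superalg_homM hp).2 (superalg_hom_prod _ _ _ hp) ph -[RHS](tact_prod_h r i).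
by congr (_ * _); apply: eq_bigr => m _; rewrite (superalg_homB hp) ph (superalg_hom_nat
  _ hp).
Qed.

Theorem Unr_iso : exists phibar : Unr n r -> QSchur n r,
    superalg_iso phibar
    /\ (forall u : Uq n, \val (phibar (spi (unr_rels n r) u)) = phi r u).
Proof.
have ht := to_simage_hom (phi_hom n r).
have hs := spi_hom (unr_rels n r); have hs' := spi_hom (uq_rels n).
have E u : squot_lift (to_simage (phi_hom n r)) (spi (unr_rels n r) u)
   = to_simage (phi_hom n r) u.
  exact: (squot_liftE ht phi_unr_rel).
exists (squot_lift (to_simage (phi_hom n r))); split; last by move=> u; rewrite E.
have rep := queer_rep_comp hs (uq_inj_rep n).
apply: superalg_iso_ker; first exact: (squot_lift_hom ht phi_unr_rel).
  move=> x; rewrite -[x]sreprK E -[srepr x]sreprK => /(congr1 val).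
  rewrite val_to_simage => h0.
  apply: (@kernel_sub n r _ _ rep _ _ _ _ (tq_act r) (spi (unr_rels n r) \o spi (uq_rels
    n))).
  - rewrite /= -(zmodmor_sum (superalg_homB hs)) -(superalg_hom_nat r hs).
    apply/spiP; rewrite -[X in ideal _ X]mul1r -[X in ideal _ X]mulr1; apply: ideal_gen.
    exact: UnrSum.
  - move=> i /=; under eq_bigr do
      rewrite -(superalg_hom_nat _ hs) -(superalg_homB hs).
    rewrite -(superalg_hom_prod _ _ _ hs) -(superalg_homM hs).2 -(zmodmor0 (superalg_homB
      hs)).
    apply/spiP; rewrite subr0 -[X in ideal _ X]mul1r -[X in ideal _ X]mulr1;
      apply: ideal_gen.
    exact: UnrProd.
  - exact: tq_act_hom.
  - exact: superalg_hom_comp.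
  - move=> [[p i] j]; exists p, (qunit p i j); split.
    + exact: queer_qunit.
    + exact: homog_qunit.
    + exact: feval_gen.
    by rewrite /= -tq_inj_qunit.
  by move: h0; rewrite /phi (@squot_liftE _ (uq_rels n) _ _ (@tq_act_hom n r)
    (@tq_act_rel n r)).
move=> y; have [u eu] := simageP y; exists (spi _ u).
by rewrite E; apply: val_inj.
Qed.
End FirstPart.

(** * The presented algebra satisfies the Serre relations *)

Lemma scomm_super_bracket (A : superalgType) : super_bracket (fun p q => @scomm A p q).
Proof.
split.
- by move=> p q z x y; rewrite /scomm !mulr_sign; case: (p && q); ring_expand; zmod.
- by move=> p q x y z; apply: scommBr.
- move=> p q x y; rewrite /scomm !mulr_sign /zsign [q && p]andbC.
  by case: (p && q); ring_expand; zmod.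
move=> p q s x y z; rewrite /scomm !mulr_sign /zsign.
by case: p q s => [] [] [] /=; ring_expand; zmod.
Qed.

Lemma wformE n (i : 'I_n) (l : 'I_n.-1) :
  wform (eps i) (alpha l) = (i == cur l)%:R - (i == nxt l)%:R.
Proof.
rewrite /wform /alpha linearB /= mulmxBr /eps !trmx_delta !mul_delta_mx_cond.
by case: (i == cur l); case: (i == nxt l); rewrite ?mulr1n ?mulr0n !mxE ?eqxx.
Qed.

Lemma inQ_wform n (A : superalgType) (i : 'I_n) (l : 'I_n.-1) (x : A) :
  inQ (wform (eps i) (alpha l)) * x = x *+ (i == l :> nat) - x *+ (i == l.+1 :> nat).
Proof.
rewrite wformE rmorphB !rmorph_nat mulrBl -!val_eqE /=.
by rewrite !mulr_natl.
Qed.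

Section Presentation.
Variables n r : nat.
Local Notation B := (QSpres n r).
Local Notation pi := (spi (qs_rels n r)).
Let hpi : superalg_hom pi := spi_hom (qs_rels n r).
Local Notation br := (fun p q => @scomm B p q).
Let Hbr : super_bracket br := @scomm_super_bracket B.

(** The generators of the presented algebra as families indexed by all natural
    numbers, zero out of range. *)
Definition pres_h p m : B := if insub m is Some i then pi (gh p i) else 0.
Definition pres_e p m : B := if insub m is Some l then pi (ge p l) else 0.
Definition pres_f p m : B := if insub m is Some l then pi (gf p l) else 0.
Local Notation h := pres_h.
Local Notation e := pres_e.
Local Notation f := pres_f.

Lemma pres_hE p (i : 'I_n) : h p i = pi (gh p i).
Proof. by rewrite /pres_h valK. Qed.
Lemma pres_eE p (l : 'I_n.-1) : e p l = pi (ge p l).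
Proof. by rewrite /pres_e valK. Qed.
Lemma pres_fE p (l : 'I_n.-1) : f p l = pi (gf p l).
Proof. by rewrite /pres_f valK. Qed.

Lemma QS_eq x y : QS r x y -> pi x = pi y.
Proof.
move=> H; apply/spiP; rewrite -[X in ideal _ X]mul1r -[X in ideal _ X]mulr1.
by apply: ideal_gen; exists (x, y).
Qed.

Lemma pres_scomm p q x y : pi (scomm p q x y) = scomm p q (pi x) (pi y).
Proof. exact: superalg_hom_scomm. Qed.
Lemma presM x y : pi (x * y) = pi x * pi y. Proof. exact: (superalg_homM hpi).2. Qed.
Lemma presD x y : pi (x + y) = pi x + pi y. Proof. exact: (zmodmorD (superalg_homB hpi)).
  Qed.
Lemma presN x : pi (- x) = - pi x. Proof. exact: (zmodmorN (superalg_homB hpi)). Qed.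
Lemma pres0 : pi 0 = 0. Proof. exact: (zmodmor0 (superalg_homB hpi)). Qed.
Lemma presQ c : pi (inQ c) = inQ c. Proof. exact: (superalg_homQ hpi). Qed.
Lemma pres_nat m : pi m%:R = m%:R. Proof. exact: superalg_hom_nat. Qed.
Lemma pres_if (b : bool) x : pi (if b then x else 0) = pi x *+ b.
Proof. by case: b => //; apply: pres0. Qed.

Lemma pres_hh p q (i j : 'I_n) : scomm p q (h p i) (h q j) =
  (h (p (+) q) i - zsign (p && q) (h (p (+) q) i)) *+ (i == j :> nat).
Proof.
case: p q => [] []; rewrite /zsign /= ?subrr ?mul0rn !pres_hE.
- by rewrite -pres_scomm (QS_eq (QS1_h'h' r i j)) !presM !pres_nat !mulr_natl -mulrnA
  mulnC mulrnA opprK -mulr2n val_eqE.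
- by rewrite (brC Hbr) -pres_scomm (QS_eq (QS1_hh' r j i)) pres0 oppr0.
- by rewrite -pres_scomm (QS_eq (QS1_hh' r i j)) pres0.
by rewrite -pres_scomm (QS_eq (QS1_hh r i j)) pres0.
Qed.

Lemma pres_he p q (i : 'I_n) (l : 'I_n.-1) : scomm p q (h p i) (e q l) =
  e (p (+) q) l *+ (i == l :> nat) - zsign (p && q) (e (p (+) q) l) *+ (i == l.+1 :> nat).
Proof.
have nil : (i == l :> nat) && (i == l.+1 :> nat) = false.
  by apply/negP => /andP[/eqP -> /eqP]; lia.
case: p q => [] []; rewrite /zsign /= !pres_hE !pres_eE -pres_scomm.
- rewrite (QS_eq (QS3_h'e' r i l)) pres_if -!val_eqE /=.
  move: nil; case: (i == l :> nat); case: (i == l.+1 :> nat) => //= _;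
    by rewrite ?mulr1n ?mulr0n; zmod.
- by rewrite (QS_eq (QS3_h'e r i l)) [LHS]presM [X in X * _]presQ inQ_wform.
- by rewrite (QS_eq (QS2_he' r i l)) [LHS]presM [X in X * _]presQ inQ_wform.
by rewrite (QS_eq (QS2_he r i l)) [LHS]presM [X in X * _]presQ inQ_wform.
Qed.

Lemma pres_hf p q (i : 'I_n) (l : 'I_n.-1) : scomm p q (h p i) (f q l) =
  f (p (+) q) l *+ (i == l.+1 :> nat) - zsign (p && q) (f (p (+) q) l) *+ (i == l :> nat).
Proof.
have nil : (i == l :> nat) && (i == l.+1 :> nat) = false.
  by apply/negP => /andP[/eqP -> /eqP]; lia.
case: p q => [] []; rewrite /zsign /= !pres_hE !pres_fE -pres_scomm.
- rewrite (QS_eq (QS3_h'f' r i l)) pres_if -!val_eqE /=.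
  move: nil; case: (i == l :> nat); case: (i == l.+1 :> nat) => //= _;
    by rewrite ?mulr1n ?mulr0n; zmod.
- by rewrite (QS_eq (QS3_h'f r i l)) [LHS]presM [X in X * _]presN [X in - X * _]presQ
  mulNr inQ_wform opprB.
- by rewrite (QS_eq (QS2_hf' r i l)) [LHS]presM [X in X * _]presN [X in - X * _]presQ
  mulNr inQ_wform opprB.
by rewrite (QS_eq (QS2_hf r i l)) [LHS]presM [X in X * _]presN [X in - X * _]presQ mulNr
  inQ_wform opprB.
Qed.

Lemma pres_ef p q (k l : 'I_n.-1) : scomm p q (e p k) (f q l) =
  (h (p (+) q) k - zsign (p && q) (h (p (+) q) k.+1)) *+ (k == l :> nat).
Proof.
have hc s : h s k = pi (gh s (cur k)) := pres_hE s (cur k).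
have hx s : h s k.+1 = pi (gh s (nxt k)) := pres_hE s (nxt k).
case: p q => [] []; rewrite /zsign /= !pres_eE !pres_fE hc hx -pres_scomm.
- by rewrite (QS_eq (QS4_e'f' r k l)) [LHS]presM [X in X * _]pres_nat [X in _ * X]presD
  mulr_natl opprK val_eqE.
- by rewrite (QS_eq (QS4_e'f r k l)) [LHS]presM [X in X * _]pres_nat [X in _ * X]presD
  [X in _ * (_ + X)]presN mulr_natl val_eqE.
- by rewrite (QS_eq (QS4_ef' r k l)) [LHS]presM [X in X * _]pres_nat [X in _ * X]presD
  [X in _ * (_ + X)]presN mulr_natl val_eqE.
by rewrite (QS_eq (QS4_ef r k l)) [LHS]presM [X in X * _]pres_nat [X in _ * X]presD
  [X in _ * (_ + X)]presN mulr_natl val_eqE.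
Qed.

Lemma distn_neq1_far (k l : nat) : (k.+1 < l)%N || (l.+1 < k)%N ->
  [/\ `|k - l|%N != 1%N, `|l - k|%N != 1%N & (1 < `|k - l|)%N].
Proof. by move=> H; split; lia. Qed.

Lemma queer_serre_pres : queer_serre br n h e f.
Proof.
have lo i : (i.+1 < n)%N -> (i < n.-1)%N by case: (n).
split.
- by move=> p q i j ii jj; apply: (pres_hh p q (Ordinal ii) (Ordinal jj)).
- by move=> p q i j ii /lo jj; apply: (pres_he p q (Ordinal ii) (Ordinal jj)).
- by move=> p q i j ii /lo jj; apply: (pres_hf p q (Ordinal ii) (Ordinal jj)).
- by move=> p q i j /lo ii /lo jj; apply: (pres_ef p q (Ordinal ii) (Ordinal jj)).
- move=> p q i j /lo ii /lo jj /distn_neq1_far [d1 d2 d3].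
  rewrite (pres_eE p (Ordinal ii)) (pres_eE q (Ordinal jj)).
  case: p q => [] [].
  + by rewrite -pres_scomm (QS_eq (QS5_e'e' r (k := Ordinal ii) (l := Ordinal jj) d1))
    pres0.
  + by rewrite (brC Hbr) -pres_scomm (QS_eq (QS5_ee' r (k := Ordinal jj) (l := Ordinal
    ii) d2)) pres0 oppr0.
  + by rewrite -pres_scomm (QS_eq (QS5_ee' r (k := Ordinal ii) (l := Ordinal jj) d1))
    pres0.
  by rewrite -pres_scomm (QS_eq (QS5_ee r (k := Ordinal ii) (l := Ordinal jj) d3)) pres0.
- move=> p q i j /lo ii /lo jj /distn_neq1_far [d1 d2 d3].
  rewrite (pres_fE p (Ordinal ii)) (pres_fE q (Ordinal jj)).
  case: p q => [] [].
  + by rewrite -pres_scomm (QS_eq (QS5_f'f' r (k := Ordinal ii) (l := Ordinal jj) d1))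
    pres0.
  + by rewrite (brC Hbr) -pres_scomm (QS_eq (QS5_ff' r (k := Ordinal jj) (l := Ordinal
    ii) d2)) pres0 oppr0.
  + by rewrite -pres_scomm (QS_eq (QS5_ff' r (k := Ordinal ii) (l := Ordinal jj) d1))
    pres0.
  by rewrite -pres_scomm (QS_eq (QS5_ff r (k := Ordinal ii) (l := Ordinal jj) d3)) pres0.
- move=> p q i /lo ii; set l : 'I_n.-1 := Ordinal ii.
  have d : `|l - l|%N != 1%N by rewrite distnn.
  rewrite !(pres_eE _ l); case: p q => [] [].
  + by rewrite -pres_scomm (QS_eq (QS5_e'e' r d)) pres0.
  + by rewrite (brC Hbr) -pres_scomm (QS_eq (QS5_ee' r d)) pres0 oppr0.
  + by rewrite -pres_scomm (QS_eq (QS5_ee' r d)) pres0.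
  exact: scommxx.
- move=> p q i /lo ii; set l : 'I_n.-1 := Ordinal ii.
  have d : `|l - l|%N != 1%N by rewrite distnn.
  rewrite !(pres_fE _ l); case: p q => [] [].
  + by rewrite -pres_scomm (QS_eq (QS5_f'f' r d)) pres0.
  + by rewrite (brC Hbr) -pres_scomm (QS_eq (QS5_ff' r d)) pres0 oppr0.
  + by rewrite -pres_scomm (QS_eq (QS5_ff' r d)) pres0.
  exact: scommxx.
- move=> q i ii; have k1 := lo _ ii; have k0 := lo _ (ltnW ii).
  rewrite !(pres_eE _ (Ordinal k0)) !(pres_eE _ (Ordinal k1)) -!pres_scomm.
  have d : Ordinal k1 = (Ordinal k0).+1 :> nat by [].
  by case: q; [exact: esym (QS_eq (QS5_eeS r d))|exact: esym (QS_eq (QS5_eeS' r d))].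
- move=> q i ii; have k1 := lo _ ii; have k0 := lo _ (ltnW ii).
  rewrite !(pres_fE _ (Ordinal k0)) !(pres_fE _ (Ordinal k1)) -!pres_scomm.
  have d : Ordinal k1 = (Ordinal k0).+1 :> nat by [].
  by case: q; [exact: esym (QS_eq (QS5_ffS r d))|exact: QS_eq (QS5_ffS' r d)].
- move=> p i j /lo ii /lo jj dd.
  have d : `|Ordinal ii - Ordinal jj|%N = 1%N by case/orP: dd => /eqP /= ->; lia.
  rewrite !(pres_eE _ (Ordinal ii)) !(pres_eE _ (Ordinal jj)) -!pres_scomm -pres0.
  by case: p; [apply: QS_eq (QS6_e'ee r d)|apply: QS_eq (QS6_eee r d)].
move=> p i j /lo ii /lo jj dd.
have d : `|Ordinal ii - Ordinal jj|%N = 1%N by case/orP: dd => /eqP /= ->; lia.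
rewrite !(pres_fE _ (Ordinal ii)) !(pres_fE _ (Ordinal jj)) -!pres_scomm -pres0.
by case: p; [apply: QS_eq (QS6_f'ff r d)|apply: QS_eq (QS6_fff r d)].
Qed.
End Presentation.

(** * The presented algebra receives the queer Lie superalgebra *)

(** q(n) is generated by the h_i, h'_i, e_j and f_j: an even off-diagonal unit
    is an iterated bracket of simple ones, and E'_ij = [h'_i, E_ij] for i <>
    j. *)
Lemma qunit_gen_ind n (P : bool -> gl n -> Prop) :
  (forall p i, P p (qh p i)) ->
  (forall j, P false (qe false j)) -> (forall j, P false (qf false j)) ->
  (forall p q x y, queer x -> queer y -> homog p x -> homog q y ->
     P p x -> P q y -> P (p (+) q) (scomm p q x y)) ->
  forall p i j, P p (qunit p i j).
Proof.
move=> Ph Pe Pf PS p i j; have [<-|nij] := eqVneq i j; first exact: Ph.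
have PU p' q' (a b c : 'I_n) : a != c -> P p' (qunit p' a b) -> P q' (qunit q' b c) ->
    P (p' (+) q') (qunit (p' (+) q') a c).
  move=> nac Pa Pb.
  have := PS _ _ _ _ (queer_qunit p' a b) (queer_qunit q' b c)
     (@homog_qunit n p' a b) (@homog_qunit n q' b c) Pa Pb.
  by rewrite scomm_qunit eqxx [c == a]eq_sym (negPf nac) mulr0 subr0.
suff Pev : P false (qunit false i j).
  by case: p => //; apply: (PU true false i i j) => //; apply: (Ph true i).
have nn : n = n.-1.+1 by rewrite prednK //; apply: leq_trans (ltn_ord i).
have up d : forall a b : 'I_n, (b = a + d.+1 :> nat)%N -> P false (qunit false a b).
  elim: d => [|d IH] a b eb.
    have la : (a < n.-1)%N by have := ltn_ord b; lia.
    have := Pe (Ordinal la); congr (P false (qunit false _ _)); apply: val_inj => //=.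
    by rewrite eb addn1.
  have la : (a + d.+1 < n.-1)%N by have := ltn_ord b; lia.
  have lb : (a + d.+1 < n)%N by lia.
  apply: (PU false false a (Ordinal lb) b); first by rewrite -val_eqE /=; lia.
    exact: IH.
  have := Pe (Ordinal la); congr (P false (qunit false _ _)); apply: val_inj => //=.
  by rewrite eb !addnS.
have down d : forall a b : 'I_n, (a = b + d.+1 :> nat)%N -> P false (qunit false a b).
  elim: d => [|d IH] a b eb.
    have la : (b < n.-1)%N by have := ltn_ord a; lia.
    have := Pf (Ordinal la); congr (P false (qunit false _ _)); apply: val_inj => //=.
    by rewrite eb addn1.
  have la : (b + d.+1 < n.-1)%N by have := ltn_ord a; lia.
  have lb : (b + d.+1 < n)%N by lia.
  apply: (PU false false a (Ordinal lb) b); first by rewrite -val_eqE /=; lia.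
    have := Pf (Ordinal la); congr (P false (qunit false _ _)); apply: val_inj => //=.
    by rewrite eb !addnS.
  exact: IH.
case: (ltngtP i j) => [ij|ji|/val_inj e]; last by rewrite e eqxx in nij.
  by apply: (up (j - i).-1); lia.
by apply: (down (i - j).-1); lia.
Qed.

Lemma homog_qcoef n p q i j (x : gl n) : homog q x -> p != q -> qcoef p i j x = 0.
Proof.
move=> hx npq; apply/eqP/negPn/negP => /hx.
by rewrite vpar_pos; case: p npq; rewrite ?vpar_neg ?vpar_pos => npq e; rewrite -e in npq.
Qed.

Lemma queer_homog_ext n (V : superalgType) (F G : gl n -> V) q :
  zmod_morphism F -> zmod_morphism G ->
  (forall c x, F (inQ c * x) = inQ c * F x) -> (forall c x, G (inQ c * x) = inQ c * G x)
    ->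
  (forall i j, F (qunit q i j) = G (qunit q i j)) ->
  forall x, queer x -> homog q x -> F x = G x.
Proof.
move=> FB GB FQ GQ FG x qx hx; rewrite (queer_sum qx).
rewrite (zmodmor_sum FB) (zmodmor_sum GB); apply: eq_bigr => p _.
rewrite (zmodmor_sum FB) (zmodmor_sum GB); apply: eq_bigr => i _.
rewrite (zmodmor_sum FB) (zmodmor_sum GB); apply: eq_bigr => j _.
rewrite FQ GQ; have [->|npq] := eqVneq p q; first by rewrite FG.
by rewrite (homog_qcoef _ _ hx npq) rmorph0 !mul0r.
Qed.

Section RootRep.
Variables (n : nat) (B : superalgType) (h e f : bool -> nat -> B).
Local Notation br := (fun p q => @scomm B p q).
Hypothesis R : queer_serre br n h e f.
Let Hbr : super_bracket br := @scomm_super_bracket B.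
Let tors := @superalg_no2tors B.
Local Notation E := (root_vector br h e f).

Definition root_rep (x : gl n) : B := \sum_p \sum_i \sum_j inQ (qcoef p i j x) * E p i j.

Lemma root_rep_qunit p (i j : 'I_n) : root_rep (qunit p i j) = E p i j.
Proof. exact: (qunit_expand (fun p i j => E p i j)). Qed.

Lemma root_repB : zmod_morphism root_rep.
Proof.
move=> x y; rewrite /root_rep -sumrB; apply: eq_bigr => p _.
rewrite -sumrB; apply: eq_bigr => i _; rewrite -sumrB; apply: eq_bigr => j _.
by rewrite qcoefB rmorphB mulrBl.
Qed.

Lemma root_repQ c x : root_rep (inQ c * x) = inQ c * root_rep x.
Proof.
rewrite /root_rep mulr_sumr; apply: eq_bigr => p _.
rewrite mulr_sumr; apply: eq_bigr => i _; rewrite mulr_sumr; apply: eq_bigr => j _.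
by rewrite qcoefQ rmorphM mulrA.
Qed.

Definition bracket_preserved p x := forall q y, queer y -> homog q y ->
  root_rep (scomm p q x y) = scomm p q (root_rep x) (root_rep y).

Lemma bracket_preserved_units p x :
  (forall q k l, root_rep (scomm p q x (qunit q k l)) = scomm p q (root_rep x) (E q k l))
    ->
  bracket_preserved p x.
Proof.
move=> H q y qy hy.
apply: (@queer_homog_ext n B (fun y => root_rep (scomm p q x y))
  (fun y => scomm p q (root_rep x) (root_rep y)) q) => //.
- by move=> u v; rewrite scommBr root_repB.
- by move=> u v; rewrite root_repB scommBr.
- by move=> c u; rewrite scommQr root_repQ.
- by move=> c u; rewrite root_repQ scommQr.
by move=> i j; rewrite H root_rep_qunit.
Qed.

Lemma root_rep_scomm_qunit p q (i j k l : 'I_n) :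
  root_rep (scomm p q (qunit p i j) (qunit q k l)) =
   E (p (+) q) i l *+ (j == k) - zsign (p && q) (E (p (+) q) k j *+ (l == i)).
Proof.
rewrite scomm_qunit root_repB (zmodmor_sign _ _ root_repB) mulr_sign.
have r0 := zmodmor0 root_repB.
by case: (j == k); case: (l == i); rewrite ?root_rep_qunit ?r0.
Qed.

(** By the Jacobi identity the elements x such that root_rep preserves
    brackets with x are closed under brackets; for the generators this is the
    computation of their action on root vectors. *)
Lemma all_bracket_preserved p (i j : 'I_n) : bracket_preserved p (qunit p i j).
Proof.
move: p i j; apply: (@qunit_gen_ind n bracket_preserved).
- move=> p i; apply: bracket_preserved_units => q k l.
  rewrite root_rep_scomm_qunit root_rep_qunit root_diag (cartan_root Hbr R) //.
  rewrite -!val_eqE /=; congr (_ - _).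
    by case: eqP => // ->.
  rewrite [in RHS]eq_sym /zsign; case: (p && q); rewrite ?mulNrn.
    by case: eqP => [->|_]; rewrite ?mulr0n.
  by case: eqP => // ->.
- move=> j; apply: bracket_preserved_units => q k l.
  rewrite root_rep_scomm_qunit root_rep_qunit.
  rewrite [root_vector _ _ _ _ false _ _]root_lt ?posroot_simple //.
  by rewrite (ad_simple_root tors Hbr R) //; apply: (ltn_ord (nxt j)).
- move=> j; apply: bracket_preserved_units => q k l.
  rewrite root_rep_scomm_qunit root_rep_qunit.
  rewrite [root_vector _ _ _ _ false _ _]root_ge; last exact: leqnSn.
  rewrite /nonneg ltn_eqF // posroot_simple.
  rewrite (ad_opposite_root _ tors Hbr R) //; last exact: (ltn_ord (nxt j)).
  by rewrite -!val_eqE /= [(nat_of_ord l == _)%N]eq_sym [(nat_of_ord k == _)%N]eq_sym.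
move=> p q x y qx qy hx hy Px Py s z qz hz.
rewrite (brJl (@scomm_super_bracket (gl n))) root_repB.
have zs b u : root_rep (zsign b u) = zsign b (root_rep u).
  by case: b => //; rewrite /zsign (zmodmorN root_repB).
rewrite zs (Px _ _ (queer_scomm q s qy qz) (homog_scomm hy hz)).
rewrite (Py _ _ (queer_scomm p s qx qz) (homog_scomm hx hz)).
by rewrite (Px _ y) // (Py _ z) // (Px _ z) // (brJl Hbr).
Qed.

Lemma root_rep_queer : queer_rep root_rep.
Proof.
split; [exact: root_repB|exact: root_repQ|move=> p q x y qx qy hx hy].
apply: (@queer_homog_ext n B (fun x => root_rep (scomm p q x y))
  (fun x => scomm p q (root_rep x) (root_rep y)) p) => //.
- by move=> u v; rewrite scommBl root_repB.
- by move=> u v; rewrite root_repB scommBl.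
- by move=> c u; rewrite scommQl root_repQ.
- by move=> c u; rewrite root_repQ scommQl.
by move=> i j; apply: all_bracket_preserved.
Qed.
End RootRep.

(** * The presentation of the queer Schur superalgebra *)

Section SecondPart.
Variables n r : nat.
Local Notation T := (@tact n r).

Definition qs_uq : qsfree n -> Uq n := feval (fun x => uq_inj (qselt x)).

Lemma queer_qselt (x : qsgen n) : queer (qselt x).
Proof. by case: x => p [i|[j|j]]; apply: queer_qunit. Qed.
Lemma homog_qselt (x : qsgen n) : homog (qspar x) (qselt x).
Proof. by case: x => p [i|[j|j]]; apply: homog_qunit. Qed.

Lemma qs_uq_hom : superalg_hom qs_uq.
Proof. by apply: feval_hom => x; apply/homog_uq_inj/homog_qselt. Qed.

Lemma qs_uq_gen x : qs_uq (fgen _ x) = uq_inj (qselt x).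
Proof. exact: feval_gen. Qed.

Definition qs_act (u : qsfree n) : tEnd n r := phi r (qs_uq u).
Lemma qs_act_hom : superalg_hom qs_act.
Proof. exact: (superalg_hom_comp qs_uq_hom (phi_hom n r)). Qed.

Lemma qs_act_gen x : qs_act (fgen _ x) = T (qselt x).
Proof. by rewrite /qs_act qs_uq_gen phi_uq_inj //; apply: queer_qselt. Qed.

Let hK := qs_act_hom.
Local Notation K := qs_act.
Lemma qs_act_scomm p q x y : K (scomm p q x y) = scomm p q (K x) (K y).
Proof. exact: superalg_hom_scomm. Qed.
Lemma qs_actM x y : K (x * y) = K x * K y. Proof. exact: (superalg_homM hK).2. Qed.
Lemma qs_actD x y : K (x + y) = K x + K y. Proof. exact: (zmodmorD (superalg_homB hK)).
  Qed.
Lemma qs_actN x : K (- x) = - K x. Proof. exact: (zmodmorN (superalg_homB hK)). Qed.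
Lemma qs_act0 : K 0 = 0. Proof. exact: (zmodmor0 (superalg_homB hK)). Qed.
Lemma qs_actQ c : K (inQ c) = inQ c. Proof. exact: (superalg_homQ hK). Qed.
Lemma qs_act_nat m : K m%:R = m%:R. Proof. exact: superalg_hom_nat. Qed.
Lemma qs_act_h p i : K (gh p i) = T (qunit p i i). Proof. exact: qs_act_gen. Qed.
Lemma qs_act_e p l : K (ge p l) = T (qunit p (cur l) (nxt l)). Proof. exact: qs_act_gen.
  Qed.
Lemma qs_act_f p l : K (gf p l) = T (qunit p (nxt l) (cur l)). Proof. exact: qs_act_gen.
  Qed.

Lemma tact_qunit_scomm p q i j k l :
  scomm p q (T (qunit p i j)) (T (qunit q k l)) =
  T (qunit (p (+) q) i l) *+ (j == k) - zsign (p && q) (T (qunit (p (+) q) k j)) *+ (l ==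
    i).
Proof.
rewrite -(tact_scomm r (@homog_qunit n p i j) (@homog_qunit n q k l)) scomm_qunit tactB.
rewrite (zmodmor_sign _ _ (@tactB n r)) mulr_sign.
have t0 : T 0 = 0 := zmodmor0 (@tactB n r).
by rewrite /zsign; case: (p && q); case: (j == k); case: (l == i);
  rewrite ?mulr1n ?mulr0n ?t0 ?oppr0.
Qed.

Lemma tact_cartan_scomm p q i k l :
  scomm p q (T (qunit p i i)) (T (qunit q k l)) =
  T (qunit (p (+) q) k l) *+ (i == k) - zsign (p && q) (T (qunit (p (+) q) k l)) *+ (i ==
    l).
Proof.
rewrite tact_qunit_scomm [l == i]eq_sym; congr (_ - _); first by case: eqP => // ->.
by case: eqP => // ->.
Qed.

Lemma tact_ee p q (k l : 'I_n.-1) : scomm p q (K (ge p k)) (K (ge q l)) =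
  T (qunit (p (+) q) (cur k) (nxt l)) *+ (k.+1 == l :> nat)
  - zsign (p && q) (T (qunit (p (+) q) (cur l) (nxt k))) *+ (l.+1 == k :> nat).
Proof. by rewrite !qs_act_e tact_qunit_scomm -!val_eqE. Qed.

Lemma tact_ff p q (k l : 'I_n.-1) : scomm p q (K (gf p k)) (K (gf q l)) =
  T (qunit (p (+) q) (nxt k) (cur l)) *+ (k == l.+1 :> nat)
  - zsign (p && q) (T (qunit (p (+) q) (nxt l) (cur k))) *+ (l == k.+1 :> nat).
Proof. by rewrite !qs_act_f tact_qunit_scomm -!val_eqE. Qed.

Lemma mulrb_adjacent0 (V : zmodType) (k l : nat) (x y : V) : `|k - l|%N != 1%N ->
  x *+ (k.+1 == l) - y *+ (l.+1 == k) = 0.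
Proof.
by move=> d; do 2 (case: eqP => ?; first by exfalso; lia); rewrite !mulr0n subr0.
Qed.

Lemma tact_ee0 p q (k l : 'I_n.-1) : `|k - l|%N != 1%N -> scomm p q (K (ge p k)) (K (ge q
  l)) = 0.
Proof. by move=> d; rewrite tact_ee mulrb_adjacent0. Qed.
Lemma tact_ff0 p q (k l : 'I_n.-1) : `|k - l|%N != 1%N -> scomm p q (K (gf p k)) (K (gf q
  l)) = 0.
Proof.
by move=> d; rewrite tact_ff [_ == l.+1 :> nat]eq_sym [l == k.+1 :> nat]eq_sym
  -opprB mulrb_adjacent0 ?oppr0 // distnC.
Qed.

Lemma tact_eeS p q (k l : 'I_n.-1) : l = k.+1 :> nat -> scomm p q (K (ge p k)) (K (ge q
  l)) =
  T (qunit (p (+) q) (cur k) (nxt l)).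
Proof. by move=> e; rewrite tact_ee e eqxx gtn_eqF ?mulr0n ?subr0. Qed.
Lemma tact_ffS p q (k l : 'I_n.-1) : l = k.+1 :> nat -> scomm p q (K (gf p l)) (K (gf q
  k)) =
  T (qunit (p (+) q) (nxt l) (cur k)).
Proof. by move=> e; rewrite tact_ff e eqxx [k == _ :> nat]ltn_eqF ?mulr0n ?subr0. Qed.

Lemma tact_eee p (k l : 'I_n.-1) : `|k - l|%N = 1%N ->
  scomm p false (K (ge p k)) (scomm false false (K (ge false k)) (K (ge false l))) = 0.
Proof.
have Hbr := @scomm_super_bracket (tEnd n r).
move=> d; rewrite tact_ee /zsign /= scommBr (brMr Hbr) [X in _ - X](brMr Hbr) qs_act_e
  !tact_qunit_scomm.
rewrite -!val_eqE /= !andbF /zsign.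
by repeat case: eqP => ?; rewrite ?(mulr0n, mulr1n, mul0rn, subr0) //; exfalso; lia.
Qed.

Lemma tact_fff p (k l : 'I_n.-1) : `|k - l|%N = 1%N ->
  scomm p false (K (gf p k)) (scomm false false (K (gf false k)) (K (gf false l))) = 0.
Proof.
have Hbr := @scomm_super_bracket (tEnd n r).
move=> d; rewrite tact_ff /zsign /= scommBr (brMr Hbr) [X in _ - X](brMr Hbr) qs_act_f
  !tact_qunit_scomm.
rewrite -!val_eqE /= !andbF /zsign.
by repeat case: eqP => ?; rewrite ?(mulr0n, mulr1n, mul0rn, subr0) //; exfalso; lia.
Qed.

(** All relations hold in End(V^(x)r) because tact preserves brackets and the
    matrix units satisfy them; the last two are [gl1_sum] and [tact_prod_h]. *)
Lemma qs_act_relation x y : QS r x y -> K x = K y.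
Proof.
have kQ c u : K (inQ c * u) = inQ c * K u by rewrite qs_actM qs_actQ.
have kNQ c u : K (- inQ c * u) = - (inQ c * K u) by rewrite qs_actM qs_actN qs_actQ mulNr.
have kn m u : K (m%:R * u) = K u *+ m by rewrite qs_actM qs_act_nat mulr_natl.
have kif (b : bool) u : K (if b then u else 0) = K u *+ b by case: b => //;
  apply: qs_act0.
have ef p q (k l : 'I_n.-1) : scomm p q (T (qunit p (cur k) (nxt k))) (T (qunit q (nxt l)
  (cur l)))
    = T (qunit (p (+) q) (cur k) (cur l)) *+ (k == l) -
      zsign (p && q) (T (qunit (p (+) q) (nxt l) (nxt k))) *+ (k == l).
  rewrite tact_qunit_scomm; congr (_ *+ nat_of_bool _ - _ *+ nat_of_bool _).
  by rewrite eq_sym -!val_eqE.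
have far (k l : 'I_n.-1) : (1 < `|k - l|)%N -> `|k - l|%N != 1%N by lia.
case.
- by move=> i j; rewrite qs_act_scomm qs_act0 !qs_act_h tact_cartan_scomm subrr.
- by move=> i j; rewrite qs_act_scomm qs_act0 !qs_act_h tact_cartan_scomm subrr.
- move=> i j; rewrite qs_act_scomm [RHS]kn [X in X *+ 2]kn !qs_act_h tact_cartan_scomm.
  by have [->|_] := eqVneq i j; rewrite /zsign /= ?mulr1n ?mulr0n ?subr0 ?mul0rn // opprK
    mulr2n.
- by move=> i l; rewrite qs_act_scomm [RHS]kQ qs_act_h qs_act_e tact_cartan_scomm
  inQ_wform -!val_eqE.
- by move=> i l; rewrite qs_act_scomm [RHS]kQ qs_act_h qs_act_e tact_cartan_scomm
  inQ_wform -!val_eqE.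
- by move=> i l; rewrite qs_act_scomm [RHS]kNQ qs_act_h qs_act_f tact_cartan_scomm
  inQ_wform opprB -!val_eqE.
- by move=> i l; rewrite qs_act_scomm [RHS]kNQ qs_act_h qs_act_f tact_cartan_scomm
  inQ_wform opprB -!val_eqE.
- by move=> i l; rewrite qs_act_scomm [RHS]kQ qs_act_h !qs_act_e tact_cartan_scomm
  inQ_wform -!val_eqE.
- by move=> i l; rewrite qs_act_scomm [RHS]kNQ qs_act_h !qs_act_f tact_cartan_scomm
  inQ_wform opprB -!val_eqE.
- move=> i l; rewrite qs_act_scomm [RHS]kif qs_act_h !qs_act_e tact_cartan_scomm
  -!val_eqE /= /zsign.
  by do 2 case: eqP => ?; try (by exfalso; lia); rewrite ?mulr1n ?mulr0n ?mulNrn; zmod.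
- move=> i l; rewrite qs_act_scomm [RHS]kif qs_act_h !qs_act_f tact_cartan_scomm
  -!val_eqE /= /zsign.
  by do 2 case: eqP => ?; try (by exfalso; lia); rewrite ?mulr1n ?mulr0n ?mulNrn; zmod.
- move=> k l; rewrite qs_act_scomm [RHS]kn qs_actD qs_actN !qs_act_h qs_act_e qs_act_f ef.
  by have [->|_] := eqVneq k l; rewrite ?(mulr0n, mulr1n) /zsign ?opprK ?subr0 //= ?subr0.
- move=> k l; rewrite qs_act_scomm [RHS]kn qs_actD !qs_act_h qs_act_e qs_act_f ef.
  by have [->|_] := eqVneq k l; rewrite ?(mulr0n, mulr1n) /zsign ?opprK ?subr0 //= ?subr0.
- move=> k l; rewrite qs_act_scomm [RHS]kn qs_actD qs_actN !qs_act_h qs_act_e qs_act_f ef.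
  by have [->|_] := eqVneq k l; rewrite ?(mulr0n, mulr1n) /zsign ?opprK ?subr0 //= ?subr0.
- move=> k l; rewrite qs_act_scomm [RHS]kn qs_actD qs_actN !qs_act_h qs_act_e qs_act_f ef.
  by have [->|_] := eqVneq k l; rewrite ?(mulr0n, mulr1n) /zsign ?opprK ?subr0 //= ?subr0.
- by move=> k l d; rewrite qs_act_scomm qs_act0 tact_ee0.
- by move=> k l d; rewrite qs_act_scomm qs_act0 tact_ee0.
- by move=> k l d; rewrite qs_act_scomm qs_act0 tact_ff0.
- by move=> k l d; rewrite qs_act_scomm qs_act0 tact_ff0.
- by move=> k l d; rewrite qs_act_scomm qs_act0 tact_ee0 ?far.
- by move=> k l d; rewrite qs_act_scomm qs_act0 tact_ff0 ?far.
- by move=> k l d; rewrite [LHS]qs_act_scomm [RHS]qs_act_scomm [LHS]tact_eeS //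
  [RHS]tact_eeS.
- by move=> k l d; rewrite [LHS]qs_act_scomm [RHS]qs_act_scomm [LHS]tact_eeS //
  [RHS]tact_eeS.
- by move=> k l d; rewrite [LHS]qs_act_scomm [RHS]qs_act_scomm [LHS]tact_ffS //
  [RHS]tact_ffS.
- by move=> k l d; rewrite [LHS]qs_act_scomm [RHS]qs_act_scomm [LHS]tact_ffS //
  [RHS]tact_ffS.
- by move=> k l d; rewrite [LHS]qs_act_scomm [X in scomm _ _ _ X]qs_act_scomm qs_act0
  tact_eee.
- by move=> k l d; rewrite [LHS]qs_act_scomm [X in scomm _ _ _ X]qs_act_scomm qs_act0
  tact_eee.
- by move=> k l d; rewrite [LHS]qs_act_scomm [X in scomm _ _ _ X]qs_act_scomm qs_act0
  tact_fff.
- by move=> k l d; rewrite [LHS]qs_act_scomm [X in scomm _ _ _ X]qs_act_scomm qs_act0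
  tact_fff.
- rewrite (zmodmor_sum (superalg_homB hK)) qs_act_nat.
  under eq_bigr do rewrite qs_act_h.
  by rewrite -(zmodmor_sum (@tactB n r)) -gl1_sum tact1.
move=> i; rewrite qs_actM (superalg_hom_prod _ _ _ hK) qs_act_h qs_act0
  -[RHS](tact_prod_h r i).
congr (_ * _); apply: eq_bigr => m _.
by rewrite qs_actD qs_actN qs_act_h qs_act_nat.
Qed.

Local Notation B := (QSpres n r).
Local Notation pi := (spi (qs_rels n r)).
Local Notation rho := (root_rep (@pres_h n r) (@pres_e n r) (@pres_f n r)).

Lemma root_rep_qselt x : rho (qselt x) = pi (fgen _ x).
Proof.
case: x => p [i|[l|l]]; rewrite root_rep_qunit.
- by rewrite root_diag pres_hE.
- by rewrite root_lt // [posroot _ _ _ _ _](posroot_simple _ _ _ l) pres_eE.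
rewrite root_ge; last exact: leqnSn.
by rewrite /nonneg ltn_eqF // [posroot _ _ _ _ _](posroot_simple _ _ _ l) pres_fE.
Qed.

Lemma qs_uq_surj (u : Uq n) : exists w, qs_uq w = u.
Proof.
rewrite -[u]sreprK; have hs := spi_hom (uq_rels n); have hq := qs_uq_hom.
have rep := uq_inj_rep n.
elim/fsalg_ind: (srepr u) => [a|[[p i] j]|v w [v' ev] [w' ew]|v w [v' ev] [w' ew]].
- by exists (inQ a); rewrite (superalg_homQ hs) (superalg_homQ hq).
- rewrite -tq_inj_qunit -/(uq_inj _).
  move: p i j; apply: (@qunit_gen_ind n (fun p x => exists w, qs_uq w = uq_inj x)).
  + by move=> p i; exists (gh p i); apply: qs_uq_gen.
  + by move=> l; exists (ge false l); apply: qs_uq_gen.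
  + by move=> l; exists (gf false l); apply: qs_uq_gen.
  move=> p q x y qx qy hx hy [v ev] [w ew]; exists (scomm p q v w).
  by rewrite (superalg_hom_scomm _ _ _ _ hq) ev ew (queer_repL rep).
- by exists (v' + w'); rewrite (zmodmorD (superalg_homB hq)) (zmodmorD (superalg_homB
  hs)) ev ew.
by exists (v' * w'); rewrite (superalg_homM hq).2 (superalg_homM hs).2 ev ew.
Qed.

Theorem QSpres_iso : exists psi : QSpres n r -> QSchur n r,
    superalg_iso psi
    /\ (forall x : qsgen n,
          \val (psi (spi (qs_rels n r) (fgen _ x))) = phi r (uq_inj (qselt x))).
Proof.
pose g := to_simage (phi_hom n r) \o qs_uq.
have hg : superalg_hom g := superalg_hom_comp qs_uq_hom (to_simage_hom (phi_hom n r)).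
have gS (u : qsfree n) : qs_rels n r u -> g u = 0.
  move=> [[x y] /= H ->]; apply: val_inj.
  have e : K (x - y) = 0 by rewrite qs_actD qs_actN (qs_act_relation H) subrr.
  exact: e.
have E u : squot_lift g (pi u) = g u by exact: (squot_liftE hg gS).
have hpi := spi_hom (qs_rels n r).
exists (squot_lift g); split; last by move=> x; rewrite E /g /= qs_uq_gen.
apply: superalg_iso_ker; first exact: (squot_lift_hom hg gS).
  move=> x; rewrite -[x]sreprK E => /(congr1 val) h0.
  have rep := root_rep_queer (queer_serre_pres n r).
  have rh p i : rho (qh p i) = pi (gh p i) := root_rep_qselt (p, inl i).
  apply: (@kernel_sub n r _ _ rep _ _ _ _ K pi) => //.
  - under eq_bigr do rewrite rh.
    by rewrite -(zmodmor_sum (superalg_homB hpi)) (QS_eq (QS7 n r)) (superalg_hom_nat _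
      hpi).
  - move=> i; rewrite rh -[RHS](zmodmor0 (superalg_homB hpi)) -(QS_eq (QS8 r i)).
    rewrite (superalg_homM hpi).2 (superalg_hom_prod _ _ _ hpi); congr (_ * _).
    apply: eq_bigr => m _; rewrite rh (superalg_homB hpi); congr (_ - _).
    by rewrite (superalg_hom_nat _ hpi).
  move=> y; exists (qspar y), (qselt y); split.
  + exact: queer_qselt.
  + exact: homog_qselt.
  + exact: qs_act_gen.
  exact/esym/root_rep_qselt.
move=> y; have [u eu] := simageP y; have [w ew] := qs_uq_surj u.
by exists (pi w); rewrite E; apply: val_inj; rewrite /g /= ew.
Qed.
End SecondPart.

Theorem theorem4p7 (n r : nat) (n_gt0 : (0 < n)%N) (r_gt0 : (0 < r)%N) :
  (exists phibar : Unr n r -> QSchur n r,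
    superalg_iso phibar
    /\ (forall u : Uq n, \val (phibar (spi (unr_rels n r) u)) = phi r u))
  /\
  (exists psi : QSpres n r -> QSchur n r,
    superalg_iso psi
    /\ (forall x : qsgen n,
          \val (psi (spi (qs_rels n r) (fgen _ x))) = phi r (uq_inj (qselt x)))).
Proof. by split; [apply: Unr_iso|apply: QSpres_iso]. Qed.
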